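(* Let $M=\{r=0\}$ be a germ at $p$ of a $\mathcal C^\infty$ real hypersurface in $\mathbb C^n$, where $r$ is a real-valued $\mathcal C^\infty$ local defining function with $r(p)=0$ and $dr(p)\neq 0$, and let $p\in M$. Then $\Delta(M,p)=\infty$ if and only if there exists a nonconstant formal complex curve $\zeta(t)=(\zeta_1(t),\dots,\zeta_n(t))$ with $\zeta(0)=p$ such that $r\circ\zeta$ vanishes to infinite order at $0$.
   Context: For a germ of a nonconstant holomorphic curve $\zeta:(\mathbb C,0)\to(\mathbb C^n,p)$, $\nu(\zeta)$ denotes the order of vanishing at $0$ of $|\zeta_1(t)-\zeta_1(0)|+\cdots+|\zeta_n(t)-\zeta_n(0)|$, and $\nu(\zeta^*r)$ denotes the order of vanishing of $r\circ\zeta$ at $0$. The D'Angelo type is $\Delta(M,p)=\sup_\zeta \nu(\zeta^*r)/\nu(\zeta)$, the supremum over all such germs $\zeta$. A formal complex curve through $p$ is an $n$-tuple $\zeta=(\zeta_1,\dots,\zeta_n)$ of formal power series in one complex variable $t$ with $\zeta(0)=p$; $r\circ\zeta$ means the composition of the formal Taylor series of $r$ at $p$ (in $z-p$ and $\overline{z-p}$) with $\zeta$, a formal power series in $t,\bar t$, and ''vanishes to infinite order'' means all its coefficients are zero. *)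

(* Defs.v *)
From HB Require Import structures.
From mathcomp Require Import all_boot all_order all_algebra.
From mathcomp Require Import all_classical all_reals all_analysis.
From mathcomp.real_closed Require Import complex.
Import Order.TTheory GRing.Theory Num.Theory.
Import numFieldNormedType.Exports.

Set Implicit Arguments.
Unset Strict Implicit.
Unset Printing Implicit Defensive.

Local Open Scope ring_scope.
Local Open Scope complex_scope.
Local Open Scope classical_set_scope.

Section Defs.
Variable R : realType.
Variable n : nat.

Notation Cn := 'rV[R[i]]_n.
Notation RIdx := (prod (ordinal n) bool).

Definition cabs (t : R[i]) : R := ComplexField.Normc.normc t.

(* The 2n real coordinate directions of C^n = R^{2n}:
   (j, false) is the direction of x_j = Re z_j, (j, true) that of y_j = Im z_j. *)
Definition rdir (k : RIdx) : Cn :=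
  (if k.2 then 'i else 1) *: delta_mx ord0 k.1.

Definition rpartial (k : RIdx) (g : Cn -> R) : Cn -> R :=
  fun x => derive1 (fun h : R => g (x + h%:C *: rdir k)) 0.

Definition rpartial_exists (k : RIdx) (g : Cn -> R) (x : Cn) : Prop :=
  derivable (fun h : R => g (x + h%:C *: rdir k)) 0 1.

Definition iter_rpartial (s : seq RIdx) (g : Cn -> R) : Cn -> R :=
  foldr rpartial g s.

Definition cball (p : Cn) (e : R) (x : Cn) : Prop :=
  forall j : 'I_n, cabs (x 0 j - p 0 j) < e.

Definition cont_at (g : Cn -> R) (x : Cn) : Prop :=
  forall eps : R, 0 < eps -> exists2 d : R, 0 < d &
    forall y, cball x d y -> `|g y - g x| < eps.

Definition smooth_near (g : Cn -> R) (p : Cn) : Prop :=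
  exists2 e : R, 0 < e &
    forall x, cball p e x ->
      forall s : seq RIdx,
        [/\ cont_at (iter_rpartial s g) x
           & forall k, rpartial_exists k (iter_rpartial s g) x].

Definition vanishes_to (f : R[i] -> R) (k : nat) : Prop :=
  exists C : R, exists2 d : R, 0 < d &
    forall t : R[i], cabs t < d -> `|f t| <= C * cabs t ^+ k.

Definition ord_vanish (f : R[i] -> R) : \bar R :=
  ereal_sup [set ((k%:R : R)%:E) | k in [set k : nat | vanishes_to f k]].

Definition holo_near0 (zeta : R[i] -> Cn) : Prop :=
  exists2 d : R, 0 < d &
    forall t : R[i], cabs t < d ->
      forall j : 'I_n, derivable (fun s : R[i]^o => (zeta s 0 j : R[i]^o)) t 1.

Definition const_near0 (zeta : R[i] -> Cn) : Prop :=
  exists2 d : R, 0 < d & forall t : R[i], cabs t < d -> zeta t = zeta 0.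

Definition holo_curve_germ (p : Cn) (zeta : R[i] -> Cn) : Prop :=
  [/\ holo_near0 zeta, zeta 0 = p & ~ const_near0 zeta].

Definition nu_curve (zeta : R[i] -> Cn) : \bar R :=
  ord_vanish (fun t => \sum_(j < n) cabs (zeta t 0 j - zeta 0 0 j)).

Definition nu_pullback (r : Cn -> R) (zeta : R[i] -> Cn) : \bar R :=
  ord_vanish (fun t => r (zeta t)).

(* D'Angelo type; for a nonconstant holomorphic germ nu(zeta) is a finite
   positive number, so the ratio is nu(zeta^* r) * (nu zeta)^-1 *)
Definition dangelo_type (r : Cn -> R) (p : Cn) : \bar R :=
  ereal_sup [set (nu_pullback r zeta * ((fine (nu_curve zeta))^-1)%:E)%E
            | zeta in holo_curve_germ p].

(* formal power series in t, tbar with complex coefficients: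
   F a b = coefficient of t^a tbar^b *)
Definition ps2 := nat -> nat -> R[i].

Definition ps2_one : ps2 := fun a b => if (a == 0)%N && (b == 0)%N then 1 else 0.

Definition ps2_mul (F G : ps2) : ps2 :=
  fun a b => \sum_(i < a.+1) \sum_(j < b.+1) F i j * G (a - i)%N (b - j)%N.

Definition ps2_exp (F : ps2) (k : nat) : ps2 := iter k (ps2_mul F) ps2_one.

(* a formal complex curve: zeta j m = coefficient of t^m in zeta_j *)
Definition formal_curve := 'I_n -> nat -> R[i].

Definition formal_nonconstant (zeta : formal_curve) : Prop :=
  exists j : 'I_n, exists2 m : nat, (0 < m)%N & zeta j m != 0.

(* the real coordinate x_k - x_k(p) evaluated on the formal curve, as a
   series in t, tbar:  x_j - Re p_j = (u_j + conj u_j)/2,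
   y_j - Im p_j = (u_j - conj u_j)/(2i),  where u_j = zeta_j - p_j *)
Definition formal_rcoord (zeta : formal_curve) (k : RIdx) : ps2 :=
  fun a b =>
    if (0 < a)%N && (b == 0)%N then
      (if k.2 then zeta k.1 a / (2 * 'i) else zeta k.1 a / 2)
    else if (a == 0)%N && (0 < b)%N then
      (if k.2 then - (zeta k.1 b)^* / (2 * 'i) else (zeta k.1 b)^* / 2)
    else 0.

Definition mindex (N : nat) := {ffun RIdx -> 'I_N.+1}.

Definition mindex_seq N (g : mindex N) : seq RIdx :=
  flatten [seq nseq (g k) k | k <- enum {: RIdx}].

Definition taylor_coef (r : Cn -> R) (p : Cn) N (g : mindex N) : R :=
  iter_rpartial (mindex_seq g) r p / (\prod_(k : RIdx) (g k)`!)%:R.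

Definition formal_monomial (zeta : formal_curve) N (g : mindex N) : ps2 :=
  foldr (fun k acc => ps2_mul (ps2_exp (formal_rcoord zeta k) (g k)) acc)
        ps2_one (enum {: RIdx}).

(* coefficient of t^a tbar^b in (formal Taylor series of r at p) o zeta.
   Since each x_k - x_k(p) has no constant term, only multi-indices of total
   order <= a + b contribute, so the sum below is the full (finite) sum. *)
Definition formal_comp (r : Cn -> R) (p : Cn) (zeta : formal_curve) : ps2 :=
  fun a b => \sum_(g : mindex (a + b)) (taylor_coef r p g)%:C
                                       * formal_monomial zeta g a b.

Definition formal_vanishes_inf (F : ps2) : Prop := forall a b, F a b = 0.

End Defs.

(* Main.v *)
Require Import Defs.
From HB Require Import structures.
From mathcomp Require Import all_boot all_order all_algebra.
From mathcomp Require Import all_classical all_reals all_analysis.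
From mathcomp.real_closed Require Import complex.
From mathcomp Require Import ring lra zify.
Import Order.TTheory GRing.Theory Num.Theory.
Import numFieldNormedType.Exports.
Set Implicit Arguments.
Unset Strict Implicit.
Unset Printing Implicit Defensive.
Local Open Scope ring_scope.

(* If the type is infinite, Taylor polynomials of holomorphic curves give formal
   curves Z_K of order m_K such that r o Z_K vanishes to order K m_K.  Hence the
   Hermitian form attached to the Taylor series of r vanishes on the span V_K of
   the functionals phi |-> [t^a] phi(Z_K), a < K m_K / 2, which is stable under
   the transposes of multiplication by the coordinates.  An ultralimit of the
   V_K is again isotropic and stable, and it has elements of arbitrarily large
   degree.  Such a space V contains all functionals phi |-> [t^a] phi(zeta) for
   some nonconstant formal curve zeta: in a minimal V some coordinate acts
   surjectively, its formal inverse limit is a finite extension of the power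
   series in that coordinate, and Puiseux's theorem provides zeta.  Isotropy of
   V says that r o zeta = 0.  Conversely, truncations of a formal curve have a
   fixed order, and their contact with r = 0 is unbounded. *)

(** * Formal power series *)

(** The curves Z_K need not converge in any sense: their orders m_K vary and their coefficients may
    be unbounded. What passes to the limit is linear. By polarization the coefficient of t^a
    conj(t)^b in r o Z_K is the value, at a pair of functionals, of a Hermitian form that depends
    only on the Taylor series of r. Contact of order K m_K therefore makes all pairs with a, b < K
    m_K / 2 orthogonal, and once degrees are bounded this relation involves finitely many values.
    Since Z_K has order m_K, these functionals reach degree about K / 2, which tends to infinity:
    only the ratio of the two orders matters, as in the definition of the type. Modules of such
    functionals are Macaulay's inverse systems: V is dual to a quotient of the power series ring, an
    unbounded V to a quotient of positive dimension, a minimal unbounded one to the ring of an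
    irreducible formal curve, whose parametrization is sought. Holomorphic means complex
    differentiable near 0, so the Taylor polynomials of the curves rest on Goursat's argument and
    Cauchy's formula on squares. *)

Lemma course_of_values (T : Type) (x0 : T) (F : nat -> (nat -> T) -> T) :
  exists x : nat -> T, forall m, x m = F m (fun i => if (i < m)%N then x i else x0).
Proof.
pose step (y : nat -> T) := fun m => F m (fun i => if (i < m)%N then y i else x0).
(* The values of the [k]-th iterate below [k] are already final, so the sequence sought is read off
   the diagonal. *)
pose y k := iter k step (fun=> x0).
have stab : forall k l m, (m < k)%N -> (m < l)%N -> y k m = y l m.
  elim=> [//|k IH] [//|l] m mk ml.
  rewrite /y !iterS /step; congr (F m _); apply/funext => i.
  by case: ltnP => // im; apply: IH; apply: leq_trans im _.
exists (fun m => y m.+1 m) => m.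
rewrite {1}/y iterS /step; congr (F m _); apply/funext => i.
by case: ltnP => // im; apply: stab.
Qed.

(** The record keeps the Cauchy product apart from the pointwise structures on [nat -> A]. *)
Record fps (A : Type) := Fps { fcoef : nat -> A }.

Lemma fpsP (A : Type) (f g : fps A) : (forall k, fcoef f k = fcoef g k) -> f = g.
Proof. by case: f g => [f] [g] /= fg; congr Fps; apply/funext. Qed.

HB.instance Definition _ (A : Type) := gen_eqMixin (fps A).
HB.instance Definition _ (A : Type) := gen_choiceMixin (fps A).

Section FpsRing.
Variable A : comNzRingType.
Implicit Types f g h : fps A.

Definition fps_zero : fps A := Fps (fun=> 0).
Definition fps_add f g := Fps (fun k => fcoef f k + fcoef g k).
Definition fps_opp f := Fps (fun k => - fcoef f k).

Fact fps_addA : associative fps_add.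
Proof. by move=> f g h; apply: fpsP => k /=; rewrite addrA. Qed.
Fact fps_addC : commutative fps_add.
Proof. by move=> f g; apply: fpsP => k /=; rewrite addrC. Qed.
Fact fps_add0 : left_id fps_zero fps_add.
Proof. by move=> f; apply: fpsP => k /=; rewrite add0r. Qed.
Fact fps_addN : left_inverse fps_zero fps_opp fps_add.
Proof. by move=> f; apply: fpsP => k /=; rewrite addNr. Qed.

HB.instance Definition _ := GRing.isZmodule.Build (fps A)
  fps_addA fps_addC fps_add0 fps_addN.

Definition fps_one : fps A := Fps (fun k => (k == 0)%N%:R).
Definition fps_mul f g :=
  Fps (fun k => \sum_(i < k.+1) fcoef f i * fcoef g (k - i)).

Let trunc N f : {poly A} := \poly_(i < N) fcoef f i.

Let coef_trunc N f i : (i < N)%N -> (trunc N f)`_i = fcoef f i.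
Proof. by move=> iN; rewrite coef_poly iN. Qed.

(** A coefficient of a product depends only on truncations of the factors, so the ring laws are
    inherited from polynomials. *)
Let mulE N f g k : (k < N)%N -> fcoef (fps_mul f g) k = (trunc N f * trunc N g)`_k.
Proof.
move=> kN; rewrite coefM; apply: eq_bigr => i _.
rewrite !coef_trunc //; first exact: leq_ltn_trans (leq_subr _ _) kN.
by apply: leq_ltn_trans kN; rewrite -ltnS.
Qed.

Fact fps_mulC : commutative fps_mul.
Proof. by move=> f g; apply: fpsP => k; rewrite !(@mulE k.+1) // mulrC. Qed.

Fact fps_mulA : associative fps_mul.
Proof.
move=> f g h; apply: fpsP => k; rewrite !(@mulE k.+1) //.
transitivity ((trunc k.+1 f * (trunc k.+1 g * trunc k.+1 h))`_k).
  rewrite !coefM; apply: eq_bigr => i _; congr (_ * _).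
  have ki : (k - i < k.+1)%N by rewrite ltnS leq_subr.
  by rewrite coef_trunc // (@mulE k.+1).
rewrite mulrA !coefM; apply: eq_bigr => i _; congr (_ * _).
have ki : (i < k.+1)%N by [].
by rewrite coef_trunc // (@mulE k.+1).
Qed.

Fact fps_mul1 : left_id fps_one fps_mul.
Proof.
move=> f; apply: fpsP => k /=; rewrite big_ord_recl /= mul1r subn0.
by rewrite big1 ?addr0 // => i _; rewrite mul0r.
Qed.

Fact fps_mulDl : left_distributive fps_mul +%R.
Proof.
move=> f g h; apply: fpsP => k /=; rewrite -big_split /=.
by apply: eq_bigr => i _; rewrite mulrDl.
Qed.

Fact fps_oner_neq0 : fps_one != 0.
Proof. by apply/eqP => /(congr1 (fun f => fcoef f 0%N)) /= /eqP; rewrite oner_eq0. Qed.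

HB.instance Definition _ := GRing.Zmodule_isComNzRing.Build (fps A)
  fps_mulA fps_mulC fps_mul1 fps_mulDl fps_oner_neq0.

Definition fps_unit : pred (fps A) := fun f => `[< exists g, g * f = 1 >].
Definition fps_inv f : fps A :=
  if pselect (exists g, g * f = 1) is left e then projT1 (cid e) else f.

Fact fps_mulV : {in fps_unit, left_inverse 1 fps_inv *%R}.
Proof.
move=> f /asboolP fu; rewrite /fps_inv; case: pselect => // e.
by case: cid => g /= ->.
Qed.
Fact fps_unitP f g : g * f = 1 -> fps_unit f.
Proof. by move=> gf; apply/asboolP; exists g. Qed.
Fact fps_inv0id : {in [predC fps_unit], fps_inv =1 id}.
Proof. by move=> f /= /asboolPn nf; rewrite /fps_inv; case: pselect. Qed.

HB.instance Definition _ := GRing.ComNzRing_hasMulInverse.Build (fps A)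
  fps_mulV fps_unitP fps_inv0id.

Lemma fcoef0 k : fcoef (0 : fps A) k = 0. Proof. by []. Qed.
Lemma fcoef1 k : fcoef (1 : fps A) k = (k == 0)%N%:R. Proof. by []. Qed.
Lemma fcoefD f g k : fcoef (f + g) k = fcoef f k + fcoef g k. Proof. by []. Qed.
Lemma fcoefM f g k :
  fcoef (f * g) k = \sum_(i < k.+1) fcoef f i * fcoef g (k - i).
Proof. by []. Qed.

Lemma fcoef_sum (I : Type) (s : seq I) (P : pred I) (F : I -> fps A) k :
  fcoef (\sum_(i <- s | P i) F i) k = \sum_(i <- s | P i) fcoef (F i) k.
Proof. by elim/big_rec2: _ => //= i _ y _ <-. Qed.

Lemma fcoefM0 f g : fcoef (f * g) 0 = fcoef f 0 * fcoef g 0.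
Proof. by rewrite fcoefM big_ord_recl big_ord0 addr0. Qed.

Definition fpsC (a : A) : fps A := Fps (fun k => a *+ (k == 0)%N).
Definition fpsXn (e : nat) : fps A := Fps (fun k => (k == e)%:R).

Lemma fcoefCM a f k : fcoef (fpsC a * f) k = a * fcoef f k.
Proof.
rewrite fcoefM big_ord_recl /= mulr1n subn0 big1 ?addr0 // => i _.
by rewrite mulr0n mul0r.
Qed.

Lemma fcoefXnM e f k :
  fcoef (fpsXn e * f) k = if (k < e)%N then 0 else fcoef f (k - e).
Proof.
rewrite fcoefM; case: ltnP => ke.
  rewrite big1 // => i _ /=; rewrite (ltn_eqF (leq_trans (ltn_ord i) ke)).
  by rewrite mul0r.
have ek : (e < k.+1)%N by [].
rewrite (bigD1 (Ordinal ek)) //= eqxx mul1r big1 ?addr0 // => i ie.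
suff -> : (nat_of_ord i == e) = false by rewrite mul0r.
by apply: contraNF ie => /eqP ie; apply/eqP/val_inj.
Qed.

Lemma fpsXnD e e' : fpsXn (e + e') = fpsXn e * fpsXn e'.
Proof.
apply: fpsP => k; rewrite fcoefXnM /=; case: ltnP => ke.
  by rewrite ltn_eqF // (leq_trans ke) // leq_addr.
by rewrite -{1}(subnKC ke) eqn_add2l.
Qed.

Lemma fpsXn0 : fpsXn 0 = 1. Proof. by []. Qed.

Lemma fpsXnX e k : fpsXn e ^+ k = fpsXn (e * k).
Proof. by elim: k => [|k IH]; rewrite ?muln0 // exprS IH mulnS fpsXnD. Qed.

(** The series f(t^e): a ramification of the parameter. *)
Definition fsubst (e : nat) f : fps A :=
  Fps (fun k => if (e %| k)%N then fcoef f (k %/ e) else 0).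

Lemma fcoef_fsubst e f k : (0 < e)%N -> fcoef (fsubst e f) (k * e) = fcoef f k.
Proof. by move=> e0 /=; rewrite dvdn_mull // mulnK. Qed.

Lemma fsubst_additive e : additive (fsubst e).
Proof. by move=> f g; apply: fpsP => k /=; case: ifP; rewrite ?subr0. Qed.

Lemma fsubstM e f g : (0 < e)%N -> fsubst e (f * g) = fsubst e f * fsubst e g.
Proof.
move=> e0; apply: fpsP => k; rewrite fcoefM [LHS]/=; case: ifPn => ek; last first.
  rewrite big1 // => i _ /=; case: ifPn => ei; last by rewrite mul0r.
  case: ifPn => [eki|_]; last by rewrite mulr0.
  by case/negP: ek; rewrite -(subnK (_ : i <= k)%N) ?dvdn_add // -ltnS.
have [q ->] := dvdnP ek; rewrite mulnK //.
rewrite -[LHS](big_mkord predT (fun i => fcoef f i * fcoef g (q - i))).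
rewrite -[RHS](big_mkord predT
  (fun i => fcoef (fsubst e f) i * fcoef (fsubst e g) (q * e - i))).
rewrite [RHS](bigID (fun i => e %| i)%N) /= [X in _ + X]big1 ?addr0; last first.
  by move=> i /negbTE ei; rewrite ei mul0r.
rewrite -!(big_filter _ (fun i => e %| i)%N).
have -> : [seq i <- index_iota 0 (q * e).+1 | (e %| i)%N] =
          [seq (i * e)%N | i <- index_iota 0 q.+1].
  apply: (@irr_sorted_eq _ ltn); [exact: ltn_trans | exact: ltnn | | | ].
  - by apply: sorted_filter; [exact: ltn_trans | exact: iota_ltn_sorted].
  - rewrite sorted_map; apply: sub_sorted (iota_ltn_sorted 0 _) => i j /=.
    by rewrite ltn_pmul2r.
  move=> i; rewrite mem_filter mem_index_iota; apply/idP/mapP.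
    move=> /andP[/dvdnP[j ->]]; rewrite ltnS leq_pmul2r // => jq; exists j => //.
    by rewrite mem_index_iota ltnS.
  move=> [j]; rewrite mem_index_iota /= ltnS => jq ->.
  by rewrite dvdn_mull // ltnS leq_pmul2r.
rewrite big_map; apply: eq_bigr => i _.
by rewrite /= -mulnBl !dvdn_mull // !mulnK.
Qed.

Lemma fsubst1 e : (0 < e)%N -> fsubst e 1 = 1.
Proof.
move=> e0; apply: fpsP => -[|k] /=; first by rewrite dvdn0 div0n.
case: ifP => // ek; rewrite eqn0Ngt divn_gt0 //.
by rewrite (dvdn_leq _ ek).
Qed.

Lemma fsubstXn e m : (0 < e)%N -> fsubst e (fpsXn m) = fpsXn (m * e).
Proof.
move=> e0; apply: fpsP => k /=; case: ifPn => [/dvdnP[q ->]|ek].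
  by rewrite mulnK // eqn_pmul2r.
by case: eqP ek => // ->; rewrite dvdn_mull.
Qed.

End FpsRing.

Section FpsIdomain.
Variable A : idomainType.
Implicit Types f g h : fps A.

Lemma fps_neq0_ord f : f != 0 ->
  exists2 v, fcoef f v != 0 & forall k, (k < v)%N -> fcoef f k = 0.
Proof.
move=> f0; have ex : exists v, fcoef f v != 0.
  apply: contrapT => nex; case/eqP: f0; apply: fpsP => k.
  by apply/eqP; apply: contrapT => /negP fk; apply: nex; exists k.
exists (ex_minn ex); first by case: ex_minnP.
case: ex_minnP => v _ vmin k kv; apply/eqP; apply: contraTT kv => /vmin.
by rewrite -leqNgt.
Qed.

Fact fps_integral : GRing.integral_domain_axiom (fps A).
Proof.
move=> f g fg0; apply: contrapT => /negP; rewrite negb_or => /andP[].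
move=> /fps_neq0_ord[v fv vm] /fps_neq0_ord[w gw wm].
move/(congr1 (fun f => fcoef f (v + w))): fg0; apply/eqP.
have vw : (v < (v + w).+1)%N by rewrite ltnS leq_addr.
rewrite fcoefM (bigD1 (Ordinal vw)) //= addKn big1 ?addr0 ?mulf_neq0 //.
move=> i iv; have : nat_of_ord i != v by apply: contraNN iv => /eqP iv; apply/eqP/val_inj.
rewrite neq_ltn => /orP[/vm ->|vi]; first by rewrite mul0r.
by rewrite wm ?mulr0 // ltn_subLR ?ltn_add2r // -ltnS.
Qed.

HB.instance Definition _ := GRing.ComUnitRing_isIntegral.Build (fps A) fps_integral.

Lemma fpsXn_neq0 e : fpsXn A e != 0.
Proof.
by apply/eqP => /(congr1 (fun f => fcoef f e))/eqP; rewrite /= eqxx oner_eq0.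
Qed.

Lemma fsubst_eq0 e f : (0 < e)%N -> (fsubst e f == 0) = (f == 0).
Proof.
move=> e0; apply/eqP/eqP => [f0|->]; last first.
  by apply: fpsP => k /=; case: ifP.
apply: fpsP => k; move/(congr1 (fun f => fcoef f (k * e))): f0 => /=.
by rewrite dvdn_mull // mulnK.
Qed.

Lemma fpsXn_factor e f : (forall k, (k < e)%N -> fcoef f k = 0) ->
  exists g, f = fpsXn A e * g.
Proof.
move=> fe; exists (Fps (fun k => fcoef f (k + e))); apply: fpsP => k.
by rewrite fcoefXnM; case: ltnP => [/fe|] //= ke; rewrite subnK.
Qed.
End FpsIdomain.

Section FpsField.
Variable K : fieldType.
Implicit Types f g : fps K.

Lemma fps_unitE f : (f \is a GRing.unit) = (fcoef f 0 != 0).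
Proof.
apply/idP/idP => [fu|f0].
  have /(congr1 (fun f => fcoef f 0)) := mulrV fu; rewrite fcoefM0 fcoef1 /=.
  by apply: contra_eqN => /eqP ->; rewrite mul0r eq_sym oner_neq0.
have [g gE] := course_of_values (0 : K) (fun m (g : nat -> K) => (fcoef f 0)^-1 *
  ((m == 0)%:R - \sum_(i < m) fcoef f i.+1 * g (m - i.+1)%N)).
suff fg : f * Fps g = 1 by apply/unitrP; exists (Fps g); rewrite mulrC.
apply: fpsP => k; rewrite fcoefM fcoef1 big_ord_recl subn0.
rewrite [fcoef (Fps g) k]gE mulrA divff // mul1r -addrA.
rewrite -[RHS]addr0; congr (_ + _); apply/eqP; rewrite addrC subr_eq0; apply/eqP.
by apply: eq_bigr => i _; rewrite ltn_subrL (leq_ltn_trans _ (ltn_ord i)).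
Qed.

Lemma fps_ord_unit f : f != 0 ->
  exists v u, [/\ u \is a GRing.unit & f = fpsXn K v * u].
Proof.
move=> /fps_neq0_ord[v fv vm]; have [u fE] := fpsXn_factor vm.
exists v, u; split=> //; rewrite fps_unitE.
by move: fv; rewrite fE fcoefXnM ltnn subnn.
Qed.

(** Power series over a field form a discrete valuation ring. The second alternative is strict and
    keeps a factor t; this factor later excludes a root with a pole. *)
Lemma fps_dvd_total f g : f != 0 -> g != 0 ->
  (exists h, f = g * h) \/ (exists h, g = f * (fpsXn K 1 * h)).
Proof.
move=> /fps_ord_unit[v [u [uu ->]]] /fps_ord_unit[w [u' [uu' ->]]].
have [wv|vw] := leqP w v; [left|right].
  exists (fpsXn K (v - w) * u'^-1 * u).
  rewrite -{1}(subnKC wv) fpsXnD -!mulrA; congr (_ * _).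
  by rewrite mulrCA mulVKr.
exists (fpsXn K (w - v).-1 * u^-1 * u').
have wE : w = (v + (1 + (w - v).-1))%N.
  by rewrite add1n prednK ?subn_gt0 // subnKC // ltnW.
rewrite {1}wE !fpsXnD -!mulrA; congr (_ * _).
by rewrite [RHS]mulrCA; congr (_ * _); rewrite [RHS]mulrCA mulVKr.
Qed.
End FpsField.

(** * Hensel lemma and Puiseux theorem *)

Lemma coef_neq0_size (A : nzSemiRingType) (p : {poly A}) i : p`_i != 0 -> (i < size p)%N.
Proof. by move=> pi; rewrite ltnNge; apply: contra pi => /leq_sizeP/(_ i (leqnn i)) ->. Qed.

Section Hensel.
Variable K : fieldType.
Implicit Types P Q : {poly fps K}.

(** [P] is viewed as a power series in t with polynomial coefficients, the form in which Hensel
    lifting proceeds order by order in t. *)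
Definition slice (k : nat) P : {poly K} := \poly_(i < size P) fcoef P`_i k.

Lemma coef_slice k P i : (slice k P)`_i = fcoef P`_i k.
Proof. by rewrite coef_poly; case: ltnP => // /leq_sizeP ->. Qed.

Lemma eq_slice P Q : (forall k, slice k P = slice k Q) -> P = Q.
Proof.
move=> PQ; apply/polyP => i; apply: fpsP => k.
by rewrite -!coef_slice PQ.
Qed.

Lemma sliceM k P Q : slice k (P * Q) = \sum_(i < k.+1) slice i P * slice (k - i) Q.
Proof.
apply/polyP => j; rewrite coef_slice coefM fcoef_sum coef_sum.
under eq_bigr do rewrite fcoefM.
rewrite exchange_big /=; apply: eq_bigr => i _; rewrite coefM.
by apply: eq_bigr => a _; rewrite !coef_slice.
Qed.

Lemma slice0_monic P : P \is monic -> size (slice 0 P) = size P /\ slice 0 P \is monic.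
Proof.
move=> Pm; have P0 : (slice 0 P)`_(size P).-1 = 1.
  by rewrite coef_slice (monicP Pm : P`_(size P).-1 = 1).
have sP : size (slice 0 P) = size P.
  apply/eqP; rewrite eqn_leq size_poly /=.
  have := monic_neq0 Pm; rewrite -size_poly_gt0 => sP0.
  rewrite -[X in (X <= _)%N](prednK sP0); by apply: coef_neq0_size; rewrite P0 oner_neq0.
by split=> //; apply/monicP; rewrite /lead_coef sP P0.
Qed.

Lemma slice_monic_size k P : P \is monic -> (0 < k)%N -> (size (slice k P) < size P)%N.
Proof.
move=> Pm k0; have := monic_neq0 Pm; rewrite -size_poly_gt0 => sP0.
rewrite -(prednK sP0) ltnS; apply/leq_sizeP => j; rewrite leq_eqVlt => /orP[/eqP <-|].
  by rewrite coef_slice (monicP Pm : P`_(size P).-1 = 1) fcoef1 eqn0Ngt k0.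
by rewrite prednK // => /leq_sizeP Pj; rewrite coef_slice (Pj j).
Qed.

Definition unslice (m : nat) (x : nat -> {poly K}) : {poly fps K} :=
  \poly_(i < m) Fps (fun k => (x k)`_i).

Lemma slice_unslice m (x : nat -> {poly K}) k : (forall j, (size (x j) <= m)%N) -> slice k (unslice m x) = x k.
Proof.
move=> xm; apply/polyP => i; rewrite coef_slice coef_poly.
by case: ltnP => // mi; rewrite fcoef0 nth_default // (leq_trans (xm k)).
Qed.

Lemma unslice_monic m (x : nat -> {poly K}) : x 0%N \is monic -> size (x 0%N) = m.+1 ->
  (forall j, (size (x j.+1) <= m)%N) ->
  unslice m.+1 x \is monic /\ size (unslice m.+1 x) = m.+1.
Proof.
move=> x0 sx0 xm.
have top : (unslice m.+1 x)`_m = 1.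
  rewrite coef_poly ltnSn; apply: fpsP => -[|k] /=.
    by have := monicP x0; rewrite /lead_coef sx0.
  by rewrite nth_default.
have s : size (unslice m.+1 x) = m.+1.
  apply/eqP; rewrite eqn_leq size_poly; apply: coef_neq0_size.
  by rewrite top oner_neq0.
by split=> //; apply/monicP; rewrite /lead_coef s.
Qed.

Lemma hensel P (g h : {poly K}) : P \is monic -> slice 0 P = g * h ->
  g \is monic -> h \is monic -> coprimep g h ->
  exists G H, [/\ P = G * H, G \is monic, H \is monic, size G = size g & size H = size h].
Proof.
move=> Pm P0 gm hm /Bezout_eq1_coprimepP[[u v] /= uv].
have h0 := monic_neq0 hm; have g0 := monic_neq0 gm.
(* [y k] will be the pair of slices of order [k] of the two factors. Order [k] of P = G H reads g
   h_k + h g_k = [E k y]. By Bezout h_k may be taken as [E k y * u] modulo [h], and g_k is then an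
   exact quotient by [h]. *)
pose E k (y : nat -> {poly K} * {poly K}) :=
  slice k P - \sum_(i < k.+1 | (0 < i < k)%N) (y i).1 * (y (k - i)%N).2.
have [y yE] := course_of_values (0 : {poly K} * {poly K})
  (fun k (y : nat -> {poly K} * {poly K}) => if k == 0%N then (g, h) else
     let hk := (E k y * u) %% h in ((E k y - g * hk) %/ h, hk)).
have y0 : y 0%N = (g, h) by rewrite yE eqxx.
pose E' k := E k y.
have yS k : (0 < k)%N -> y k = ((E' k - g * ((E' k * u) %% h)) %/ h, (E' k * u) %% h).
  move=> k0; rewrite yE eqn0Ngt k0 /=; suff -> : E k (fun i => if (i < k)%N then y i else 0) = E' k by [].
  rewrite /E' /E; congr (_ - _); apply: eq_bigr => i /andP[i0 ik].
  by rewrite ik ltn_subrL i0 k0.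
(* The error has degree below deg g + deg h; hence g_k has degree below deg g, and both factors stay
   monic of the prescribed degrees. *)
have sE k : (0 < k)%N -> (forall i, (0 < i < k)%N ->
    (size (y i).1 < size g)%N /\ (size (y i).2 < size h)%N) ->
    (size (E' k) <= (size g + size h).-2)%N.
  move=> k0 IH; apply: leq_trans (size_polyD _ _) _; rewrite size_polyN geq_max.
  have sP : (size P = (size g + size h).-1)%N.
    by rewrite -(slice0_monic Pm).1 P0 size_monicM.
  apply/andP; split.
    by have := slice_monic_size Pm k0; rewrite sP; case: (_ + _)%N => [|[]].
  apply: leq_trans (size_sum _ _ _) _; apply/bigmax_leqP => i /andP[i0 ik].
  have [] := IH i; first by rewrite i0.
  have [] := IH (k - i)%N; first by rewrite subn_gt0 ik ltn_subrL i0 k0.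
  move=> _ s2 s1 _; apply: leq_trans (size_polyMleq _ _) _.
  move: s1 s2; clear; move: (size _) (size _) (size _) (size _) => a b c d; lia.
have dv k : E' k - g * ((E' k * u) %% h) = ((E' k - g * ((E' k * u) %% h)) %/ h) * h.
  rewrite divpK //; apply/dvdpP; exists (E' k * v + g * ((E' k * u) %/ h)).
  have := divp_eq (E' k * u) h; set q := _ %/ _; set r := _ %% _ => e.
  have -> : r = E' k * u - q * h by rewrite e; ring.
  have -> : E' k - g * (E' k * u - q * h) = E' k * (1 - u * g) + g * q * h by ring.
  by rewrite -uv; ring.
have sy k : (0 < k)%N -> (size (y k).1 < size g)%N /\ (size (y k).2 < size h)%N.
  elim/ltn_ind: k => k IH k0; rewrite yS //=.
  have s2 : (size ((E' k * u) %% h)%R < size h)%N by rewrite ltn_modp.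
  split=> //; rewrite size_divp //.
  have sg : (0 < size g)%N by rewrite size_poly_gt0.
  have sEk : (size (E' k) <= (size g + size h).-2)%N.
    by apply: sE => // i /andP[i0 ik]; apply: IH.
  have : (size (E' k - g * ((E' k * u) %% h))%R <= (size g + size h).-2)%N.
    apply: leq_trans (size_polyD _ _) _; rewrite size_polyN geq_max sEk /=.
    apply: leq_trans (size_polyMleq _ _) _; move: s2; clear.
    by move: (size _) (size _) (size _) => a b c; lia.
  move: sg s2; clear; move: (size _) (size _) (size _) (size _) => a b c d; lia.
have [Gm sG] : unslice (size g) (fun k => (y k).1) \is monic /\
    size (unslice (size g) (fun k => (y k).1)) = size g.
  have sg : (0 < size g)%N by rewrite size_poly_gt0.
  rewrite -(prednK sg); apply: unslice_monic; rewrite ?y0 //= ?prednK // => j.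
  by have [s1 _] := sy j.+1 isT; rewrite -ltnS prednK.
have [Hm sH] : unslice (size h) (fun k => (y k).2) \is monic /\
    size (unslice (size h) (fun k => (y k).2)) = size h.
  have sh : (0 < size h)%N by rewrite size_poly_gt0.
  rewrite -(prednK sh); apply: unslice_monic; rewrite ?y0 //= ?prednK // => j.
  by have [_ s2] := sy j.+1 isT; rewrite -ltnS prednK.
exists (unslice (size g) (fun k => (y k).1)), (unslice (size h) (fun k => (y k).2)).
split=> //; apply: eq_slice => k; rewrite sliceM.
have sly i : slice i (unslice (size g) (fun k => (y k).1)) = (y i).1.
  by apply: slice_unslice => -[|j]; [rewrite y0|apply/ltnW; case: (sy j.+1)].
have slz i : slice i (unslice (size h) (fun k => (y k).2)) = (y i).2.
  by apply: slice_unslice => -[|j]; [rewrite y0|apply/ltnW; case: (sy j.+1)].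
under eq_bigr do rewrite sly slz.
case: k => [|k]; first by rewrite big_ord_recl big_ord0 addr0 y0.
have e := dv k.+1; rewrite big_ord_recl big_ord_recr /= y0 subn0 subnn y0 /=.
rewrite [y k.+1]yS //= -e.
have -> : E' k.+1 = slice k.+1 P -
    \sum_(i < k) (y (bump 0 i)).1 * (y (k.+1 - bump 0 i)%N).2.
  rewrite /E' /E big_mkcond big_ord_recl big_ord_recr /= /bump /=.
  rewrite !add1n ltnn addr0 add0r.
  by congr (_ - _); apply: eq_bigr => i _; rewrite !add1n ltnS ltn_ord.
ring.
Qed.
End Hensel.

Section Puiseux.
Variable K : numClosedFieldType.
Implicit Types P Q : {poly fps K}.

(** The exponent is [e.+1], so that every [ram e] is an injective ring morphism. *)
Definition ram (e : nat) (f : fps K) : fps K := fsubst e.+1 f.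

HB.instance Definition _ e := GRing.isZmodMorphism.Build (fps K) (fps K) (ram e)
  (fsubst_additive e.+1).
Fact ram_multiplicative e : monoid_morphism (ram e).
Proof. by split=> [|f g]; rewrite /ram ?fsubst1 ?fsubstM. Qed.
HB.instance Definition _ e := GRing.isMonoidMorphism.Build (fps K) (fps K) (ram e)
  (ram_multiplicative e).

Lemma ram_ram e e' f : ram e' (ram e f) = ram (e.+1 * e'.+1).-1 f.
Proof.
apply: fpsP => k; rewrite /ram prednK ?muln_gt0 // [LHS]/= [RHS]/=.
have [/dvdnP[q ->]|ek] := boolP (e'.+1 %| k)%N; last first.
  by case: ifP => // /(dvdn_trans (dvdn_mull _ (dvdnn _))); rewrite (negbTE ek).
by rewrite mulnK // dvdn_pmul2r // divnMr.
Qed.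

Lemma ram0 e : ram e 0 = 0. Proof. exact: rmorph0. Qed.
Lemma ram1 e : ram e 1 = 1. Proof. exact: rmorph1. Qed.

Lemma ram_eq0 e f : (ram e f == 0) = (f == 0).
Proof. exact: fsubst_eq0. Qed.

(** Roots exist only after a ramification, as X^2 - t shows. *)
Definition splits P := exists e (s : seq (fps K)),
  map_poly (ram e) P = \prod_(z <- s) ('X - z%:P).

Lemma map_ram_ram e e' P :
  map_poly (ram e') (map_poly (ram e) P) = map_poly (ram (e.+1 * e'.+1).-1) P.
Proof. by apply/polyP => i; rewrite !coef_map /= ram_ram. Qed.

Lemma splits_ram e P : splits (map_poly (ram e) P) -> splits P.
Proof. by move=> [e' [s Ps]]; exists (e.+1 * e'.+1).-1, s; rewrite -map_ram_ram. Qed.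

Lemma map_ram_prod e (s : seq (fps K)) :
  map_poly (ram e) (\prod_(z <- s) ('X - z%:P)) = \prod_(z <- map (ram e) s) ('X - z%:P).
Proof.
rewrite rmorph_prod big_map; apply: eq_bigr => z _ /=.
by rewrite map_polyXsubC.
Qed.

Lemma splitsM P Q : splits P -> splits Q -> splits (P * Q).
Proof.
move=> [e [s Ps]] [e' [s' Qs]].
exists (e.+1 * e'.+1).-1, (map (ram e') s ++ map (ram e) s').
rewrite rmorphM /= big_cat /= -!map_ram_prod -Ps -Qs !map_ram_ram.
by rewrite [(e'.+1 * _)%N]mulnC.
Qed.

Lemma splits_shift P a : splits (P \Po ('X + a%:P)) -> splits P.
Proof.
move=> [e [s Ps]]; exists e, [seq z + ram e a | z <- s].
have : map_poly (ram e) P \Po ('X + (ram e a)%:P) = \prod_(z <- s) ('X - z%:P).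
  by rewrite -Ps map_comp_poly /= rmorphD /= map_polyX map_polyC.
move/(congr1 (fun Q => Q \Po ('X - (ram e a)%:P))).
rewrite comp_polyXaddC_K => ->; rewrite rmorph_prod big_map.
apply: eq_bigr => z _; rewrite /= comp_polyB comp_polyX comp_polyC polyCD.
by rewrite opprD addrAC addrA.
Qed.

Lemma coef_comp_scaleX P c j : (P \Po (c *: 'X))`_j = P`_j * c ^+ j.
Proof.
rewrite coef_comp_poly; under eq_bigr do rewrite exprZn coefZ coefXn.
have [jP|Pj] := ltnP j (size P).
  rewrite (bigD1 (Ordinal jP)) //= eqxx mulr1 big1 ?addr0 // => i ij.
  suff -> : (j == i :> nat) = false by rewrite !mulr0.
  by apply: contraNF ij => /eqP ij; apply/eqP/val_inj.
rewrite nth_default // mul0r big1 // => i _.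
by rewrite gtn_eqF ?mulr0 // (leq_trans (ltn_ord i)).
Qed.

(** The roots of [P] are [c] times those of [Q]. The factorization is checked after composition with
    c X, which multiplies the [j]-th coefficient by the nonzero c^j and so loses nothing. *)
Lemma splits_scale P Q c m : c != 0 -> size Q = m.+1 ->
  P \Po (c *: 'X) = c ^+ m *: Q -> splits Q -> splits P.
Proof.
move=> c0 sQ PQ [e [s Qs]]; exists e, [seq ram e c * z | z <- s].
have c'0 : ram e c != 0 by rewrite ram_eq0.
have ss : size s = m.
  apply/succn_inj; rewrite -sQ -(size_prod_XsubC s id) -Qs size_map_poly_id0 //.
  by rewrite ram_eq0 lead_coef_eq0 -size_poly_eq0 sQ.
have eq : map_poly (ram e) P \Po (ram e c *: 'X) =
    (\prod_(z <- [seq ram e c * z | z <- s]) ('X - z%:P)) \Po (ram e c *: 'X).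
  have := congr1 (map_poly (ram e)) PQ.
  rewrite map_comp_poly /= !linearZ /= map_polyX Qs => ->.
  rewrite rmorph_prod big_map -ss rmorphXn /=.
  elim: (s) => [|z s' IH]; first by rewrite !big_nil expr0 scale1r.
  rewrite !big_cons exprS -scalerA -IH /= comp_polyB comp_polyX comp_polyC.
  by rewrite polyCM -!mul_polyC; ring.
apply/polyP => j; apply: (mulIf (expf_neq0 j c'0)).
by rewrite -!coef_comp_scaleX eq.
Qed.

Lemma splits_Xn m : splits ('X^m).
Proof.
exists 0%N, (nseq m 0); rewrite rmorphXn /= map_polyX big_nseq subr0.
by elim: m => //= m <-; rewrite exprS.
Qed.

(** The quantity minimized is v i / (m - i), the slope of an edge of the Newton polygon ending at
    the vertex of index [m]. The common denominator m! keeps it a natural number. *)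
Lemma newton_slope (m : nat) (v : nat -> nat) (S : pred nat) (i0 : nat) :
  S i0 -> (i0 < m)%N -> exists2 i, S i && (i < m)%N &
    forall j, S j -> (j < m)%N -> (v i * (m - j) <= v j * (m - i))%N.
Proof.
move=> Si0 i0m; pose w (i : 'I_m) := (v i * (m`! %/ (m - i)))%N.
case: (arg_minnP (P := fun i : 'I_m => S i) w (Si0 : S (Ordinal i0m))) => i Si wm.
exists (nat_of_ord i); first by rewrite Si ltn_ord.
move=> j Sj jm; have := wm (Ordinal jm) Sj; rewrite /w /=.
have dv k : (k < m)%N -> (m`! = (m`! %/ (m - k)) * (m - k))%N.
  by move=> km; rewrite divnK // dvdn_fact // subn_gt0 km leq_subr.
have mi := ltn_ord i; have f0 := fact_gt0 m.
have ei := dv i mi; have ej := dv j jm.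
have mi0 : (0 < m - i)%N by rewrite subn_gt0.
have mj0 : (0 < m - j)%N by rewrite subn_gt0.
move=> le; rewrite -(leq_pmul2r f0).
set A := (m`! %/ (m - i))%N in ei le *; set B := (m`! %/ (m - j))%N in ej le *.
have := leq_mul le (leqnn ((m - i) * (m - j))%N).
have -> : (v i * A * ((m - i) * (m - j)) = v i * (m - j) * m`!)%N by rewrite ei; ring.
by have -> : (v j * B * ((m - i) * (m - j)) = v j * (m - i) * m`!)%N by rewrite ej; ring.
Qed.

Lemma coef_XaddC_exp (A : comNzRingType) (a : A) m j :
  (('X + a%:P) ^+ m)`_j = a ^+ (m - j) *+ 'C(m, j).
Proof.
rewrite addrC exprDn coef_sum.
under eq_bigr do rewrite coefMn -polyC_exp coefCM coefXn.
have [jm|mj] := leqP j m.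
  have jm' : (j < m.+1)%N by [].
  rewrite (bigD1 (Ordinal jm')) //= eqxx mulr1 big1 ?addr0 // => i ij.
  suff -> : (j == i :> nat) = false by rewrite mulr0 mul0rn.
  by apply: contraNF ij => /eqP ij; apply/eqP/val_inj.
rewrite bin_small // mulr0n big1 // => i _.
by rewrite gtn_eqF ?mulr0 ?mul0rn // (leq_trans (ltn_ord i)).
Qed.

Lemma coef_comp_XaddC (A : comNzRingType) (P : {poly A}) a m :
  P \is monic -> size P = m.+2 ->
  (P \Po ('X + a%:P))`_m = P`_m + a *+ m.+1.
Proof.
move=> Pm sP; rewrite coef_comp_poly sP !big_ord_recr /= big1; last first.
  by move=> i _; rewrite coef_XaddC_exp bin_small // mulr0n mulr0.
have <- : lead_coef P = P`_m.+1 by rewrite /lead_coef sP.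
rewrite (monicP Pm) mul1r !coef_XaddC_exp subnn binn expr0 mulr1n mulr1 add0r.
by rewrite subSnn expr1 binSn.
Qed.

Lemma natr_fps_unit m : (m.+1%:R : fps K) \is a GRing.unit.
Proof.
rewrite fps_unitE; suff -> : fcoef (m.+1%:R : fps K) 0 = m.+1%:R by rewrite pnatr_eq0.
by elim: m.+1 => // k IH; rewrite mulrSr fcoefD IH mulrSr.
Qed.

Lemma monic_comp_XaddC (P : {poly fps K}) a : P \is monic ->
  P \Po ('X + a%:P) \is monic /\ size (P \Po ('X + a%:P)) = size P.
Proof.
move=> Pm; split; last by rewrite size_comp_poly2 ?size_XaddC.
apply/monicP; rewrite lead_coef_comp ?size_XaddC //.
by rewrite (monicP Pm) lead_coefXaddC expr1n mulr1.
Qed.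

(* The induction step of Newton's method: after the Tschirnhaus shift the next
   to leading coefficient is zero, and rescaling along the steepest edge of the
   Newton polygon makes the reduction modulo [t] different from ['X^m]. *)
Lemma puiseux_step P m i : P \is monic -> size P = m.+2 -> P`_m = 0 ->
  (i < m.+1)%N -> P`_i != 0 ->
  exists e h Q, [/\ Q \is monic, size Q = m.+2, Q`_m = 0,
    exists2 j, (j < m.+1)%N & (slice 0 Q)`_j != 0 &
    map_poly (ram e) P \Po (fpsXn K h *: 'X) = fpsXn K h ^+ m.+1 *: Q].
Proof.
move=> Pm sP Pm0 im Pi.
have PT : P`_m.+1 = 1 by rewrite -(monicP Pm) /lead_coef sP.
have /choice[v vP] : forall i, exists v : nat, P`_i != 0 ->
    fcoef P`_i v != 0 /\ forall k, (k < v)%N -> fcoef P`_i k = 0.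
  move=> j; have [->|/fps_neq0_ord[k k1 k2]] := eqVneq P`_j 0.
    by exists 0%N; rewrite ?eqxx.
  by exists k.
have [{Pi im}i /andP[/= Pi im] iv] := newton_slope v (S := fun i => P`_i != 0) Pi im.
have ie : ((m.+1 - i).-1.+1 = m.+1 - i)%N by rewrite prednK ?subn_gt0.
(* The slope is h / (m + 1 - i). Replacing t by t^(m + 1 - i) turns it into the integer [h], so X is
   rescaled by t^h and the [j]-th coefficient is divided by t^(h (m + 1 - j)). *)
set e := (m.+1 - i).-1 in ie *; set h := v i in iv *.
pose q j := Fps (fun k => fcoef (ram e P`_j) (k + h * (m.+1 - j))%N).
have qE j : (j < m.+2)%N -> fpsXn K (h * (m.+1 - j)) * q j = ram e P`_j.
  move=> jm; apply: fpsP => k; rewrite fcoefXnM.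
  case: ltnP => kh; last by rewrite /= subnK.
  rewrite /ram /= ie; case: ifPn => // /dvdnP[k' k'E].
  rewrite k'E mulnK ?subn_gt0 //.
  have [-> //|Pj] := eqVneq P`_j 0; have [_ ->] := vP j Pj => //.
  have jm' : (j < m.+1)%N.
    rewrite ltn_neqAle -ltnS jm andbT; apply: contraTneq kh => ->.
    by rewrite subnn muln0.
  have := leq_trans kh (iv j Pj jm'); rewrite k'E ltn_pmul2r //.
  by rewrite subn_gt0.
pose Q := \poly_(j < m.+2) q j.
have QT : Q`_m.+1 = 1.
  rewrite coef_poly ltnSn; have := qE m.+1 (ltnSn _).
  by rewrite subnn muln0 fpsXn0 mul1r PT ram1.
have sQ : size Q = m.+2.
  apply/eqP; rewrite eqn_leq size_poly; apply: coef_neq0_size.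
  by rewrite QT oner_neq0.
exists e, h, Q; split=> //.
- by apply/monicP; rewrite /lead_coef sQ.
- rewrite coef_poly ltnW //; apply/(mulfI (fpsXn_neq0 K (h * (m.+1 - m)))).
  by rewrite (qE m (ltnW (ltnSn _))) Pm0 ram0 mulr0.
- exists i; first exact: im.
  have [vi _] := vP i Pi; rewrite coef_slice coef_poly (leqW im).
  have -> : fcoef (q i) 0 = fcoef P`_i h; last exact: vi.
  have -> : fcoef (q i) 0 = fcoef (ram e P`_i) (h * (m.+1 - i)) by [].
  by rewrite /ram ie fcoef_fsubst ?subn_gt0.
apply/polyP => j; rewrite coef_comp_scaleX coefZ.
have -> : (map_poly (ram e) P)`_j = ram e P`_j by rewrite coef_map.
have [jm|mj] := ltnP j m.+2; last first.
  by rewrite [P`_j]nth_default ?sP // ram0 mul0r [Q`_j]nth_default ?sQ ?mulr0.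
rewrite [Q`_j]coef_poly jm -qE // !fpsXnX mulrC mulrA -fpsXnD -mulnDr subnKC //.
Qed.

Lemma monic_size1 (A : nzRingType) (p : {poly A}) : p \is monic -> size p = 1%N -> p = 1.
Proof.
move=> pm sp; have p0 : p`_0 = 1 by have := monicP pm; rewrite /lead_coef sp.
by rewrite [p]size1_polyC ?sp // p0.
Qed.

Theorem puiseux P : P \is monic -> splits P.
Proof.
move: {2}(size P) (leqnn (size P)) => N; elim: N P => [|N IH] P sPN Pm.
  by have := monic_neq0 Pm; rewrite -size_poly_leq0 sPN.
case sP : (size P) => [|[|m]].
- by move/eqP: sP; rewrite size_poly_eq0 (negbTE (monic_neq0 Pm)).
- by rewrite (monic_size1 Pm sP); apply: (splits_Xn 0).
(* [a] is the mean of the roots, so after the shift they have sum zero. *)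
pose a := - (m.+1%:R^-1 * P`_m); apply: (@splits_shift _ a).
have [P1m sP1] := monic_comp_XaddC a Pm.
have P1m0 : (P \Po ('X + a%:P))`_m = 0.
  rewrite (coef_comp_XaddC _ Pm sP) -mulr_natl mulrN mulrA mulrV ?natr_fps_unit //.
  by rewrite mul1r subrr.
move: P1m sP1 P1m0 sPN; rewrite sP; set P1 := P \Po _.
move: P1 => {sP Pm a}P Pm sP Pm0 sPN.
have [/existsP[i Pi]|/existsPn P0] := boolP [exists i : 'I_m.+1, P`_i != 0]; last first.
  have -> : P = 'X^(m.+1); last exact: splits_Xn.
  apply/polyP => j; rewrite coefXn; have [jm|] := ltnP j m.+1.
    by have := P0 (Ordinal jm); rewrite negbK (ltn_eqF jm) => /eqP.
  rewrite leq_eqVlt => /orP[/eqP <-|mj]; first by rewrite eqxx -(monicP Pm) /lead_coef sP.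
  by rewrite nth_default ?sP // gtn_eqF.
have [e [h [Q [Qm sQ Qm0 [j jm Qj] PQ]]]] := puiseux_step Pm sP Pm0 (ltn_ord i) Pi.
apply: (@splits_ram e); apply: splits_scale PQ _; rewrite ?fpsXn_neq0 //.
have [sQ0 Q0m] := slice0_monic Qm; set Q0 := slice 0 Q in sQ0 Q0m Qj *.
have [c rc] : exists c, root Q0 c by apply/closed_rootP; rewrite sQ0 sQ.
have [k [H0]] := multiplicity_XsubC Q0 c; rewrite (monic_neq0 Q0m) /= => H0c Q0E.
have gm : ('X - c%:P) ^+ k \is monic by rewrite monic_exp ?monicXsubC.
have Hm : H0 \is monic by rewrite -(monicMr _ gm) -Q0E.
have Q0E' : slice 0 Q = ('X - c%:P) ^+ k * H0 by rewrite -/Q0 Q0E mulrC.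
have cop : coprimep (('X - c%:P) ^+ k) H0.
  by rewrite coprimep_expl // coprimep_sym coprimep_XsubC.
have [G [H [QE Gm Hm' sG sH]]] := hensel Qm Q0E' gm Hm cop.
have k0 : (0 < k)%N.
  by case: k Q0E {gm sG QE Q0E' cop} => // Q0E; move: rc; rewrite Q0E expr0 mulr1 (negbTE H0c).
have sGE : size G = k.+1 by rewrite sG size_exp_XsubC.
(* If [c] were the only root, [Q0] would be (X - c)^(m + 1) with vanishing subleading coefficient.
   In characteristic zero this gives c = 0, hence [Q0] = X^(m + 1), against the nonzero lower
   coefficient [Qj]. *)
have H01 : (1 < size H0)%N.
  rewrite ltnNge; apply/negP => H01.
  have H0E : H0 = 1.
    apply: (monic_size1 Hm); apply/eqP; rewrite eqn_leq H01 /= size_poly_gt0.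
    exact: monic_neq0 Hm.
  have kE : k = m.+1.
    by apply/eqP; rewrite -eqSS -sQ -sQ0 Q0E H0E mul1r size_exp_XsubC.
  have {}Q0E' : Q0 = ('X + (- c)%:P) ^+ m.+1 by rewrite Q0E H0E mul1r kE polyCN.
  have : Q0`_m = 0 by rewrite coef_slice Qm0.
  rewrite Q0E' coef_XaddC_exp subSnn binSn expr1 -mulr_natl => /eqP.
  rewrite mulf_eq0 pnatr_eq0 /= oppr_eq0 => /eqP c0.
  by move: Qj; rewrite Q0E' c0 oppr0 addr0 coefXn (ltn_eqF jm) eqxx.
have szQ : size Q = (size G + size H).-1.
  by rewrite QE size_monicM // monic_neq0.
rewrite QE; apply: splitsM; apply: IH => //; move: szQ k0 H01 sPN;
  rewrite sQ sGE sH; clear; move: (size _) => b; lia.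
Qed.
End Puiseux.

(** * Inverse systems *)

(** Elimination by cross-multiplication with a pivot in the last column, hence without division: it
    serves for scalars and for power series alike. *)
Lemma lin_dep (A : idomainType) (m : nat) (w : 'I_m.+1 -> 'I_m -> A) :
  exists c : 'I_m.+1 -> A, (exists k, c k != 0) /\
    forall i, \sum_k c k * w k i = 0.
Proof.
elim: m w => [|m IH] w.
  by exists (fun=> 1); split=> [|[]//]; exists ord0; rewrite oner_neq0.
have [/existsP[p wp]|/existsPn w0] := boolP [exists p, w p ord_max != 0].
  have [c' [[k c'k] c'0]] := IH (fun k i => w p ord_max * w (lift p k) (lift ord_max i)
                                 - w (lift p k) ord_max * w p (lift ord_max i)).
  pose c k := if unlift p k is Some k' then c' k' * w p ord_max
              else - \sum_k' c' k' * w (lift p k') ord_max.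
  have cl k' : c (lift p k') = c' k' * w p ord_max by rewrite /c liftK.
  exists c; split=> [|i]; first by exists (lift p k); rewrite cl mulf_neq0.
  rewrite (bigD1_ord p) //= {1}/c unlift_none.
  under eq_bigr do rewrite cl.
  rewrite mulNr mulr_suml addrC; apply/eqP; rewrite subr_eq0; apply/eqP.
  case: (unliftP ord_max i) => [i' ->|->]; last first.
    by apply: eq_bigr => j _; rewrite -!mulrA [w p _ * _]mulrC.
  apply/eqP; rewrite -subr_eq0 -sumrB -[X in _ == X](c'0 i'); apply/eqP.
  by apply: eq_bigr => j _; ring.
have [c' [[k c'k] c'0]] := IH (fun k i => w (lift ord_max k) (lift ord_max i)).
pose c k := if unlift ord_max k is Some k' then c' k' else 0.
have cl k' : c (lift ord_max k') = c' k' by rewrite /c liftK.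
exists c; split=> [|i]; first by exists (lift ord_max k); rewrite cl.
rewrite (bigD1_ord ord_max) //= {1}/c unlift_none mul0r add0r.
under eq_bigr do rewrite cl.
case: (unliftP ord_max i) => [i' ->|->]; first exact: c'0.
by rewrite big1 // => j _; have := w0 (lift ord_max j); rewrite negbK => /eqP ->; rewrite mulr0.
Qed.

(** A subspace of maximal dimension among those inside [W] is all of [W], since a missing vector
    would enlarge it. This is how sets of functionals acquire a dimension. *)
Lemma pred_vspace (K : fieldType) (vT : vectType K) (W : vT -> Prop) :
  W 0 -> (forall c x y, W x -> W y -> W (c *: x + y)) ->
  exists U : {vspace vT}, forall x, W x <-> x \in U.
Proof.
move=> W0 WL.
have ex : exists d, `[< exists2 U : {vspace vT}, \dim U = d & forall x, x \in U -> W x >].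
  by exists 0%N; apply/asboolP; exists 0%VS; rewrite ?dimv0 // => x; rewrite memv0 => /eqP ->.
have bd d : `[< exists2 U : {vspace vT}, \dim U = d & forall x, x \in U -> W x >] ->
    (d <= \dim {:vT})%N.
  by move=> /asboolP[U <- _]; apply: dimvS; apply: subvf.
case: (ex_maxnP ex bd) => d /asboolP[U dU UW] dmax; exists U => x; split=> [Wx|/UW //].
apply: contrapT => /negP xU.
have : (\dim (U + <[x]>) <= d)%N.
  apply: dmax; apply/asboolP; exists (U + <[x]>)%VS => // y /memv_addP[u uU [v]].
  by move=> /vlineP[k ->] ->; rewrite addrC; apply: WL => //; apply: UW.
rewrite -dU leqNgt => /negP; apply; rewrite (ltn_leqif (dimv_leqif_sup (addvSl U <[x]>%VS))).
apply: contra xU => /subvP; apply.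
by rewrite -[X in X \in _]add0r; apply: memv_add (mem0v _) (memv_line _).
Qed.

Definition mon (n : nat) := {ffun 'I_n -> nat}.

Section Functionals.
Local Open Scope classical_set_scope.
Variables (K : numClosedFieldType) (n : nat).
Implicit Types (a b : mon n) (f g : mon n -> K) (V W : set (mon n -> K)).

Definition mdeg a := (\sum_j a j)%N.
Definition minc j a : mon n := [ffun k => (a k + (k == j))%N].
Definition mon0 : mon n := [ffun=> 0%N].

Lemma mdeg_minc j a : mdeg (minc j a) = (mdeg a).+1.
Proof.
rewrite /mdeg; under eq_bigr do rewrite ffunE.
by rewrite big_split /= -big_mkcond /= big_pred1_eq addn1.
Qed.

Lemma mdeg0 : mdeg mon0 = 0%N.
Proof. by rewrite /mdeg big1 // => j _; rewrite ffunE. Qed.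

Lemma minc_pos a : (0 < mdeg a)%N -> exists j b, a = minc j b.
Proof.
rewrite lt0n sum_nat_eq0 => /forallPn[j]; rewrite negb_imply /= => aj.
exists j, [ffun k => (a k - (k == j))%N]; apply/ffunP => k; rewrite !ffunE subnK //.
by case: eqP => // ->; rewrite lt0n.
Qed.

Lemma mon_ind (Q : mon n -> Prop) :
  Q mon0 -> (forall j a, Q a -> Q (minc j a)) -> forall a, Q a.
Proof.
move=> Q0 QS a; move: {2}(mdeg a) (erefl (mdeg a)) => d; elim: d a => [|d IH] a ad.
  suff -> : a = mon0 by [].
  apply/ffunP => k; rewrite ffunE; move/eqP: ad.
  by rewrite sum_nat_eq0 => /forallP /(_ k) /eqP.
have a0 : (0 < mdeg a)%N by rewrite ad.
have [j [b aE]] := minc_pos a0.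
by rewrite aE; apply: QS; apply: IH; apply/succn_inj; rewrite -(mdeg_minc j) -aE.
Qed.

(* A functional on polynomials is given by its values on monomials; [shift j] is
   the transpose of multiplication by the [j]-th variable. *)
Definition shift j f : mon n -> K := fun a => f (minc j a).
Definition bdeg D f := forall a, (D < mdeg a)%N -> f a = 0.

(** Macaulay's inverse systems. Elements have finite degree, individually but not uniformly; degrees
    are unbounded exactly when the dual quotient ring has infinite dimension. *)
Record submod V : Prop := Submod {
  submod0 : V (fun=> 0);
  submodL : forall c f g, V f -> V g -> V (fun a => c * f a + g a);
  submod_shift : forall j f, V f -> V (shift j f);
  submod_bdeg : forall f, V f -> exists D, bdeg D f }.

Definition unbounded V := forall D, exists f a, [/\ V f, (D <= mdeg a)%N & f a != 0].

Lemma submod_sum V (I : Type) (s : seq I) (c : I -> K) (F : I -> mon n -> K) :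
  submod V -> (forall i, V (F i)) -> V (fun a => \sum_(i <- s) c i * F i a).
Proof.
move=> sV VF; elim: s => [|i s IH].
  have -> : (fun a : mon n => \sum_(i <- [::]) c i * F i a) = fun=> 0.
    by apply/funext => a; rewrite big_nil.
  exact: submod0.
have -> : (fun a : mon n => \sum_(i <- i :: s) c i * F i a) =
    (fun a => c i * F i a + \sum_(i <- s) c i * F i a).
  by apply/funext => a; rewrite big_cons.
exact: submodL.
Qed.

Definition exact_deg N f := bdeg N f /\ exists2 a, mdeg a = N & f a != 0.

(** Shifting by a variable that divides a monomial of top degree lowers the exact degree by one, so
    every degree below that of a given element occurs. *)
Lemma unbounded_exact V N : submod V -> unbounded V -> exists2 f, V f & exact_deg N f.
Proof.
move=> sV uV; have [f [a [Vf Na fa]]] := uV N; have [D fD] := submod_bdeg sV Vf.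
have ex : exists M, `[< exists2 a, mdeg a = M & f a != 0 >].
  by exists (mdeg a); apply/asboolP; exists a.
have bd M : `[< exists2 a, mdeg a = M & f a != 0 >] -> (M <= D)%N.
  by move=> /asboolP[b <- fb]; rewrite leqNgt; apply: contra fb => /fD ->.
case: (ex_maxnP ex bd) => M /asboolP fM Mmax.
have fE : exact_deg M f.
  split=> // b Mb; apply: contrapT => /eqP fb; move: Mb; rewrite ltnNge => /negP; apply.
  by apply: Mmax; apply/asboolP; exists b.
have NM : (N <= M)%N by apply: leq_trans Na _; apply: Mmax; apply/asboolP; exists a.
move: NM fE Vf; clear -sV => NM.
have [k ->] : exists k, M = (N + k)%N by exists (M - N)%N; rewrite subnKC.
elim: k f => [|k IH] f; first by rewrite addn0; exists f.
move=> [fb [a aN fa]] Vf.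
have a0 : (0 < mdeg a)%N by rewrite aN addnS.
have [j [b aE]] := minc_pos a0.
apply: (IH (shift j f)); last exact: submod_shift.
split=> [c Nc|]; first by apply: fb; rewrite mdeg_minc addnS ltnS.
by exists b; rewrite /shift -?aE //; apply/succn_inj; rewrite -(mdeg_minc j) -aE aN addnS.
Qed.

(** With distinct degrees the last nonzero term of a combination cannot be cancelled by the others.
    A nontrivial solution of [m] linear conditions therefore remains nonzero in some degree between
    [D] and [D + m]. *)
Lemma exact_deg_dep m D (f : nat -> mon n -> K) (w : 'I_m.+1 -> 'I_m -> K) :
  (forall k, (k <= m)%N -> exact_deg (D + k) (f k)) ->
  exists c : 'I_m.+1 -> K, (forall i, \sum_k c k * w k i = 0) /\
    exists2 a, (D <= mdeg a <= D + m)%N & \sum_k c k * f k a != 0.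
Proof.
move=> fE; have [c [[k0 ck0] c0]] := lin_dep w; exists c; split=> //.
case: (arg_maxnP (P := fun k => c k != 0) (fun k : 'I_m.+1 => k : nat) ck0) => k ck kmax.
have [_ [a aD fa]] := fE k (leq_ord k); exists a.
  by rewrite aD leq_addr leq_add2l leq_ord.
rewrite (bigD1 k) //= big1 ?addr0 ?mulf_neq0 // => j jk.
have [-> |cj] := eqVneq (c j) 0; first by rewrite mul0r.
have jk' : (j < k)%N by rewrite ltn_neqAle jk; apply: kmax.
by have [-> //] := fE j (leq_ord j); rewrite ?mulr0 // aD ltn_add2l.
Qed.

Definition box N := {ffun 'I_n -> 'I_N.+1}.
Definition mon_of N (b : box N) : mon n := [ffun j => b j : nat].

Lemma mon_ofP N a : (mdeg a <= N)%N -> exists b : box N, a = mon_of b.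
Proof.
move=> aN; exists [ffun j => inord (a j)]; apply/ffunP => j; rewrite !ffunE inordK //.
by rewrite ltnS (leq_trans _ aN) // /mdeg (bigD1 j) //= leq_addr.
Qed.

(* Each filtration step [V :&: bdeg N] is finite dimensional, so it is constant
   from some member of the chain on; hence a chain of unbounded submodules has
   an unbounded intersection. *)
Lemma minimal_unbounded V0 : submod V0 -> unbounded V0 ->
  exists V, [/\ submod V, unbounded V, V `<=` V0 &
    forall W, submod W -> unbounded W -> W `<=` V -> W = V].
Proof.
move=> sV0 uV0.
(* Zorn's lemma is applied to the complements in [V0]: a maximal complement gives a minimal
   submodule. *)
pose P A := submod (V0 `\` A) /\ unbounded (V0 `\` A).
suff /Zorn_bigcup[A [[sA uA] Amax]] : forall F : set (set (mon n -> K)), F `<=` P ->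
    total_on F subset -> P (\bigcup_(X in F) X).
  exists (V0 `\` A); split=> // W sW uW WV.
  have WE : W = V0 `\` ~` W.
    by rewrite setDE setCK setIidr // => f /WV[].
  have AB : A `<=` ~` W by move=> f Af Wf; case: (WV f Wf).
  apply/seteqP; split=> // f [V0f Af]; apply: contrapT => Wf.
  apply: (Amax (~` W)); last by rewrite /P -WE.
  by split=> // /(_ f Wf).
(* [V0] is added to the chain, so that the intersection lies in [V0] and the empty chain is
   covered. *)
move=> F FP tot; pose G : set (set (mon n -> K)) := [set V0] `|` [set V0 `\` A | A in F].
have GP M : G M -> submod M /\ unbounded M by move=> [->|[A /FP[] ? ? <-]].
have Gtot M M' : G M -> G M' -> M `<=` M' \/ M' `<=` M.
  move=> [->|[A FA <-]] [->|[B FB <-]]; [by left|by right=> f []|by left=> f []|].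
  by case: (tot A B FA FB) => AB; [right|left] => f [? nf]; split=> // /AB.
have DE : V0 `\` \bigcup_(X in F) X = \bigcap_(M in G) M.
  apply/seteqP; split=> [f [V0f nf] M [->//|[A FA <-]]|f Gf].
    by split=> // Af; apply: nf; exists A.
  split=> [|[A FA Af]]; first by apply: Gf; left.
  by have [] := Gf (V0 `\` A) (or_intror (ex_intro2 _ _ A FA erefl)).
rewrite /P DE; split.
  split=> [M /GP[sM _]|c f g Gf Gg M GM|j f Gf M GM|f Gf].
  - exact: submod0.
  - by apply: submodL; [case: (GP M GM)|exact: Gf|exact: Gg].
  - by apply: submod_shift; [case: (GP M GM)|exact: Gf].
  - by apply: (submod_bdeg sV0); apply: Gf; left.
move=> N.
pose res f : {ffun box N -> K^o} := [ffun b => f (mon_of b)].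
pose WM M x := exists2 f, M f /\ bdeg N f & x = res f.
have WMU M : G M -> exists U : {vspace {ffun box N -> K^o}}, forall x, WM M x <-> x \in U.
  move=> /GP[sM _]; apply: pred_vspace.
    exists (fun=> 0); first by split=> //; exact: submod0.
    by apply/ffunP => b; rewrite !ffunE.
  move=> c _ _ [f [Mf bf] ->] [g [Mg bg] ->]; exists (fun a => c * f a + g a).
    by split; [exact: submodL|move=> a Na; rewrite bf // bg // mulr0 addr0].
  by apply/ffunP => b; rewrite !ffunE.
have ex : exists d, `[< exists M (U : {vspace {ffun box N -> K^o}}),
    [/\ G M, forall x, WM M x <-> x \in U & \dim U = d] >].
  have GV0 : G V0 by left.
  by have [U UP] := WMU V0 GV0; exists (\dim U); apply/asboolP; exists V0, U.
case: (ex_minnP ex) => d /asboolP[M [U [GM UM dU]]] dmin.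
have [sM uM] := GP M GM; have [f Mf [fb [a aN fa]]] := unbounded_exact N sM uM.
exists f, a; split; rewrite ?aN // => M' GM'.
have [MM'|M'M] := Gtot M M' GM GM'; first exact: MM'.
have [U' UM'] := WMU M' GM'.
have dle : (d <= \dim U')%N by apply: dmin; apply/asboolP; exists M', U'.
have sU : (U' <= U)%VS.
  by apply/subvP => x /UM'[g [/M'M Mg bg] ->]; apply/UM; exists g.
have UU' : U' = U by apply/eqP; rewrite -(geq_leqif (dimv_leqif_eq sU)) dU.
have : res f \in U' by rewrite UU'; apply/UM; exists f.
move=> /UM'[g [M'g bg] fg]; suff -> : f = g by [].
apply/funext => b; have [bN|Nb] := leqP (mdeg b) N; last by rewrite fb // bg.
by have [b' ->] := mon_ofP bN; have /ffunP/(_ b') := fg; rewrite !ffunE.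
Qed.

End Functionals.

(** * Shift operators on power series with coefficients in an inverse system *)

Section CurveInModule.
Local Open Scope classical_set_scope.
Variables (K : numClosedFieldType) (n : nat).
Implicit Types (a b : mon n) (f g : mon n -> K) (V W : set (mon n -> K)).
Implicit Types (Psi : mon n -> fps K).

Lemma mincC i j a : minc i (minc j a) = minc j (minc i a).
Proof. by apply/ffunP => k; rewrite !ffunE addnAC. Qed.

Lemma iter_mincC k i j a : iter k (minc i) (minc j a) = minc j (iter k (minc i) a).
Proof. by elim: k => //= k ->; rewrite mincC. Qed.

(* By minimality the kernel of a nonzero shift is bounded; counting dimensions,
   the image is then unbounded, hence everything. *)
Lemma minimal_surjective V : submod V -> unbounded V ->
    (forall W, submod W -> unbounded W -> W `<=` V -> W = V) ->
  exists j D, (forall f, V f -> shift j f = (fun=> 0) -> bdeg D f) /\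
    (forall f, V f -> exists2 g, V g & shift j g = f).
Proof.
move=> sV uV Vmin; have [f0 [a [Vf0 a1 f0a]]] := uV 1%N.
have [j [b aE]] := minc_pos a1; exists j.
pose ker := [set f | V f /\ shift j f = fun=> 0].
pose im := [set shift j g | g in V].
have sker : submod ker.
  split=> [|c f g [Vf fz] [Vg gz]|i f [Vf fj]|f [Vf _]].
  - by split; [exact: submod0|].
  - split; first exact: submodL.
    apply/funext => d; have := congr1 (fun h => h d) fz; have := congr1 (fun h => h d) gz.
    by rewrite /shift => -> ->; rewrite mulr0 addr0.
  - split; first exact: submod_shift.
    apply/funext => d; have := congr1 (fun h => h (minc i d)) fj.
    by rewrite /shift mincC.
  - exact: submod_bdeg sV _ Vf.
have [D kerD] : exists D, forall f, ker f -> bdeg D f.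
  apply: contrapT => nD; suff uker : unbounded ker.
    have kV : ker `<=` V by move=> f [].
    have := Vmin ker sker uker kV => kE; have : ker f0 by rewrite kE.
    by move=> [_ /(congr1 (fun h => h b))]; rewrite /shift -aE; apply/eqP.
  move=> D; apply: contrapT => nf; apply: nD; exists D => f kf c Dc.
  by apply: contrapT => /eqP fc; apply: nf; exists f, c; split=> //; apply: ltnW.
exists D; split=> [f Vf fj|]; first by apply: kerD.
have sim : submod im.
  split=> [|c _ _ [f Vf <-] [g Vg <-]|i _ [f Vf <-]|_ [f Vf <-]].
  - by exists (fun=> 0) => //; exact: submod0.
  - by exists (fun a => c * f a + g a) => //; apply: submodL.
  - exists (shift i f); first exact: submod_shift.
    by apply/funext => d; rewrite /shift mincC.
  - have [E fE] := submod_bdeg sV Vf; exists E => d Ed.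
    by rewrite /shift fE // mdeg_minc leqW.
suff uim : unbounded im.
  have iV : im `<=` V by move=> _ [f Vf <-]; apply: submod_shift.
  by move=> f; rewrite -{1}(Vmin im sim uim iV) => -[g Vg gf]; exists g.
move=> D'; apply: contrapT => nim.
have imD g : V g -> forall c, (D' <= mdeg c)%N -> shift j g c = 0.
  move=> Vg c Dc; apply: contrapT => /eqP gc; apply: nim; exists (shift j g), c.
  by split=> //; exists g.
have /choice[f fP] : forall k, exists f, V f /\ exact_deg (D.+1 + k) f.
  by move=> k; have [f] := unbounded_exact (D.+1 + k) sV uV; exists f.
pose m := #|{: box n D'}|.
(* If the image were bounded by [D'], it would have at most [m] coordinates. Then a combination of
   [m + 1] functionals of distinct degrees above [D] would be killed by the shift and yet be nonzero
   in a degree above [D]. *)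
have [c [c0 [d /andP[dD _] fd]]] := @exact_deg_dep _ _ m D.+1 f
  (fun k i => shift j (f k) (mon_of (enum_val i))) (fun k _ => (fP k).2).
pose h a := \sum_(k < m.+1) c k * f k a.
have kh : ker h.
  split; first by apply: submod_sum => // k; have [] := fP k.
  apply/funext => q; rewrite /shift /h.
  have [qD|Dq] := leqP (mdeg q) D'; last first.
    rewrite big1 // => k _; have := imD (f k) (fP k).1 q (ltnW Dq).
    by rewrite /shift => ->; rewrite mulr0.
  have [r rE] := mon_ofP qD; have := c0 (enum_rank r).
  by under eq_bigr do rewrite enum_rankK /shift -rE.
by move: fd; rewrite -/(h d) (kerD h kh d dD) eqxx.
Qed.

(** Shifts lower the degree, so the last nonzero iterate is killed by the shift; preimages under the
    surjective shift continue it forever. Read as the coefficients of a series in t, such a chain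
    turns the shift into multiplication by t. *)
Lemma socle_chain V j : submod V -> unbounded V ->
    (forall f, V f -> exists2 g, V g & shift j g = f) ->
  exists Phi : nat -> mon n -> K, [/\ forall k, V (Phi k), exists a, Phi 0%N a != 0,
    shift j (Phi 0%N) = (fun=> 0) & forall k, shift j (Phi k.+1) = Phi k].
Proof.
move=> sV uV surj.
have /choice[lift liftP] : forall f, exists g, V f -> V g /\ shift j g = f.
  move=> f; have [/surj[g Vg gf]|nVf] := pselect (V f); first by exists g.
  by exists f => /nVf.
have [f [a [Vf _ fa]]] := uV 0%N; have [D fD] := submod_bdeg sV Vf.
have [g [Vg [b gb] gj]] : exists g, [/\ V g, exists b, g b != 0 & shift j g = fun=> 0].
  elim: D f a Vf fa fD => [|D IH] f a Vf fa fD.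
    exists f; split=> //; first by exists a.
    by apply/funext => b; apply: fD; rewrite mdeg_minc.
  have [fj|/existsNP[b /eqP fb]] := pselect (forall b, shift j f b = 0).
    by exists f; split=> //; [exists a|apply/funext].
  apply: (IH (shift j f) b (submod_shift sV j Vf) fb) => c Dc.
  by apply: fD; rewrite mdeg_minc.
exists (fun k => iter k lift g).
have VP k : V (iter k lift g) by elim: k => //= k Vk; have [] := liftP _ Vk.
split=> //; first by exists b.
by move=> k /=; have [] := liftP _ (VP k).
Qed.

(** [Psi] stands for an element of V[[t]], a module over K[[t]] on which the shifts act. *)
Definition coefs_in V Psi := forall k, V (fun a => fcoef (Psi a) k).

Lemma coefs_inM V x Psi : submod V -> coefs_in V Psi -> coefs_in V (fun a => x * Psi a).
Proof.
move=> sV VP k; pose F (i : 'I_k.+1) a := fcoef (Psi a) (k - i).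
rewrite (_ : (fun a => _) = fun a => \sum_(i < k.+1) fcoef x i * F i a) //.
by apply: submod_sum => // i; apply: VP.
Qed.

Lemma coefs_inD V Psi Psi' : submod V -> coefs_in V Psi -> coefs_in V Psi' ->
  coefs_in V (fun a => Psi a + Psi' a).
Proof.
move=> sV VP VP' k; have := submodL sV 1 (VP k) (VP' k).
by congr V; apply/funext => a; rewrite mul1r.
Qed.

Lemma coefs_in0 V : submod V -> coefs_in V (fun=> 0).
Proof. by move=> sV k; apply: submod0. Qed.

Lemma coefs_in_sum V (I : Type) (s : seq I) (F : I -> mon n -> fps K) : submod V ->
  (forall i, coefs_in V (F i)) -> coefs_in V (fun a => \sum_(i <- s) F i a).
Proof.
move=> sV VF; elim: s => [|i s IH].
  have -> : (fun a : mon n => \sum_(i <- [::]) F i a) = fun=> 0.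
    by apply/funext => a; rewrite big_nil.
  exact: coefs_in0.
have -> : (fun a : mon n => \sum_(i <- i :: s) F i a) =
    (fun a => F i a + \sum_(i <- s) F i a) by apply/funext => a; rewrite big_cons.
exact: coefs_inD.
Qed.

Lemma coefs_in_iter V k i Psi : submod V -> coefs_in V Psi ->
  coefs_in V (fun a => Psi (iter k (minc i) a)).
Proof.
move=> sV; elim: k Psi => // k IH Psi VP.
by apply: (IH (fun a => Psi (minc i a))) => m; apply: (submod_shift sV i (VP m)).
Qed.

(* [pact i p] is the polynomial [p] in the shift operator of the [i]-th variable. *)
Definition pact i (p : {poly fps K}) Psi a :=
  \sum_(k < size p) p`_k * Psi (iter k (minc i) a).

Lemma pact_widen N i (p : {poly fps K}) Psi a : (size p <= N)%N ->
  pact i p Psi a = \sum_(k < N) p`_k * Psi (iter k (minc i) a).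
Proof.
move=> sN; rewrite /pact (big_ord_widen N (fun k => p`_k * Psi (iter k (minc i) a))) //.
rewrite big_mkcond; apply: eq_bigr => k _.
by case: ltnP => // /leq_sizeP/(_ _ (leqnn _)) ->; rewrite mul0r.
Qed.

Lemma coefs_in_pact V i p Psi : submod V -> coefs_in V Psi -> coefs_in V (pact i p Psi).
Proof.
move=> sV VP; apply: coefs_in_sum => // k; apply: coefs_inM => //.
exact: coefs_in_iter.
Qed.

Lemma pactZ i c p Psi a : pact i (c *: p) Psi a = c * pact i p Psi a.
Proof.
rewrite !(@pact_widen (size p)) ?size_scale_leq // mulr_sumr.
by apply: eq_bigr => k _; rewrite coefZ mulrA.
Qed.

Lemma pact1 i Psi a : pact i 1 Psi a = Psi a.
Proof. by rewrite /pact size_poly1 big_ord1 coef1 mul1r. Qed.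

Definition lin i (l eta : fps K) Psi a := l * Psi (minc i a) - eta * Psi a.

Lemma pact_linM i l eta p Psi a :
  pact i ((l *: 'X - eta%:P) * p) Psi a = pact i p (lin i l eta Psi) a.
Proof.
have s : (size ((l *: 'X - eta%:P) * p)%R <= (size p).+1)%N.
  apply: leq_trans (size_polyMleq _ _) _.
  have : (size (l *: 'X - eta%:P)%R <= 2)%N.
    apply: leq_trans (size_polyD _ _) _; rewrite size_polyN geq_max.
    rewrite (leq_trans (size_scale_leq _ _)) ?size_polyX //.
    by rewrite (leq_trans (size_polyC_leq1 _)).
  by move: (size _) (size _) => u v; lia.
rewrite (pact_widen _ _ _ s) /pact.
under eq_bigr do rewrite mulrBl -scalerAl coefB coefZ coefXM coefCM mulrBl.
rewrite big_split /= [X in X + _]big_ord_recl /= mulr0 mul0r add0r.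
rewrite sumrN [X in _ - X]big_ord_recr /= [p`_(size p)]nth_default // mulr0 mul0r addr0.
rewrite -sumrB; apply: eq_bigr => k _; rewrite /lin /=; ring.
Qed.

Lemma pact_lin1 i l eta Psi a : pact i (l *: 'X - eta%:P) Psi a = lin i l eta Psi a.
Proof. by rewrite -[_ - _]mulr1 pact_linM pact1. Qed.

Definition rel_ann i p Psi := forall a, pact i p Psi a = 0.

Lemma rel_ann_lin i p i' l eta Psi : rel_ann i p Psi -> rel_ann i p (lin i' l eta Psi).
Proof.
move=> Psi0 a; have -> : pact i p (lin i' l eta Psi) a =
    l * pact i p Psi (minc i' a) - eta * pact i p Psi a.
  rewrite /pact /lin !mulr_sumr -sumrB; apply: eq_bigr => k _.
  by rewrite iter_mincC; ring.
by rewrite !Psi0 !mulr0 subrr.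
Qed.

(** The linear factors are applied one after the other: the last nonzero stage is annihilated by the
    next factor. [P] collects the properties that must survive these applications. *)
Lemma eigenvector i (l : fps K) (s : seq (fps K)) (P : (mon n -> fps K) -> Prop) Psi :
    (forall eta Psi, P Psi -> P (lin i l eta Psi)) -> P Psi -> (exists a, Psi a != 0) ->
    rel_ann i (\prod_(eta <- s) (l *: 'X - eta%:P)) Psi ->
  exists Psi', [/\ P Psi', exists a, Psi' a != 0 &
    exists eta, rel_ann i (l *: 'X - eta%:P) Psi'].
Proof.
move=> Plin; elim: s Psi => [|eta s IH] Psi PPsi [a Psia].
  by rewrite big_nil => /(_ a); rewrite pact1 => Psia0; rewrite Psia0 eqxx in Psia.
rewrite big_cons => rel.
have [l0|/existsNP[b /eqP lb]] := pselect (forall a, lin i l eta Psi a = 0).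
  exists Psi; split=> //; first by exists a.
  by exists eta => b; rewrite pact_lin1.
apply: (IH (lin i l eta Psi)); first exact: Plin.
  by exists b.
by move=> c; rewrite -pact_linM.
Qed.

Lemma pact_ram e i p Psi a :
  pact i (map_poly (ram e) p) (fun a => ram e (Psi a)) a = ram e (pact i p Psi a).
Proof.
rewrite (@pact_widen (size p)) ?size_poly // /pact.
have -> : ram e (\sum_(k < size p) p`_k * Psi (iter k (minc i) a)) =
    \sum_(k < size p) ram e (p`_k * Psi (iter k (minc i) a)) by rewrite raddf_sum.
by apply: eq_bigr => k _; rewrite coef_map [RHS]fsubstM.
Qed.

Lemma rel_ann_ram e i p Psi :
  rel_ann i p Psi -> rel_ann i (map_poly (ram e) p) (fun a => ram e (Psi a)).
Proof. by move=> rel a; rewrite pact_ram rel ram0. Qed.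

Lemma coefs_in_ram e V Psi : submod V -> coefs_in V Psi ->
  coefs_in V (fun a => ram e (Psi a)).
Proof.
move=> sV VP k; rewrite /ram /=; case: (e.+1 %| k)%N; first exact: VP.
exact: submod0.
Qed.

(* The relation [p] becomes monic in [lead_coef p * 'X]. *)
Lemma splits_nonmonic (p : {poly fps K}) : (1 < size p)%N ->
  exists e s, map_poly (ram e) (lead_coef p ^+ (size p).-2 *: p) =
    \prod_(eta <- s) (ram e (lead_coef p) *: 'X - eta%:P).
Proof.
set l := lead_coef p; case sp : (size p) => [|[|d]] // _.
pose q := \poly_(k < d.+2) (if k == d.+1 then 1 else p`_k * l ^+ (d - k)).
have qT : q`_d.+1 = 1 by rewrite coef_poly ltnSn eqxx.
have sq : size q = d.+2.
  apply/eqP; rewrite eqn_leq size_poly; apply: coef_neq0_size.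
  by rewrite qT oner_neq0.
have qm : q \is monic by apply/monicP; rewrite /lead_coef sq.
have qp : q \Po (l *: 'X) = l ^+ d *: p.
  apply/polyP => k; rewrite coef_comp_scaleX coefZ coef_poly.
  have [kd|dk] := ltnP k d.+2; last by rewrite nth_default ?sp // mul0r mulr0.
  case: eqP => [->|/eqP kd'].
    have -> : p`_d.+1 = l by rewrite /l /lead_coef sp.
    by rewrite mul1r -exprSr.
  have kd2 : (k <= d)%N by rewrite -ltnS ltn_neqAle kd' -ltnS.
  by rewrite -mulrA -exprD subnK // mulrC.
have [e [s qs]] := puiseux qm; exists e, s.
rewrite /= -qp map_comp_poly /= qs rmorph_prod; apply: eq_bigr => eta _.
rewrite /= comp_polyB comp_polyX comp_polyC.
by rewrite linearZ /= map_polyX.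
Qed.

End CurveInModule.

(** * Simultaneous eigenvectors of the shifts and the formal curve *)

Section CurveExistence.
Local Open Scope classical_set_scope.
Variables (K : numClosedFieldType) (n : nat).
Implicit Types (a b : mon n) (f g : mon n -> K) (V W : set (mon n -> K)).
Implicit Types (Psi : mon n -> fps K).

(** The eigenvalue eta / l is a power series without constant term. A pole would make every value of
    [Psi] divisible by all powers of t. A nonzero constant term would make the lowest coefficient of
    [Psi] an eigenvector of the shift for a nonzero eigenvalue, impossible for a functional of
    finite degree. *)
Lemma rel_ann_root V i l eta Psi : submod V -> coefs_in V Psi -> (exists a, Psi a != 0) ->
  l != 0 -> rel_ann i (l *: 'X - eta%:P) Psi ->
  exists2 zeta, fcoef zeta 0 = 0 & forall a, Psi (minc i a) = zeta * Psi a.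
Proof.
move=> sV VP [a0 Pa0] l0 rel.
have {}rel a : l * Psi (minc i a) = eta * Psi a.
  by apply/eqP; rewrite -subr_eq0 -[X in X == 0]/(lin i l eta Psi a) -pact_lin1 rel.
have [zeta zP] : exists zeta, forall a, Psi (minc i a) = zeta * Psi a.
  have [eta0|eta0] := eqVneq eta 0.
    by exists 0 => a; apply: (mulfI l0); rewrite rel eta0 !mul0r mulr0.
  have [[h etaE]|[h lE]] := fps_dvd_total eta0 l0.
    by exists h => a; apply: (mulfI l0); rewrite rel etaE mulrA.
  have PE a : Psi a = fpsXn K 1 * (h * Psi (minc i a)).
    by apply: (mulfI eta0); rewrite -rel {1}lE -!mulrA.
  suff P0 : forall k a, fcoef (Psi a) k = 0.
    by case/eqP: Pa0; apply: fpsP => k; rewrite P0.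
  elim/ltn_ind => -[|k] IH a; rewrite PE fcoefXnM //.
  have -> : (k.+1 < 1)%N = false by [].
  rewrite subn1 fcoefM.
  by rewrite big1 // => m _; rewrite IH ?mulr0 // ltnS leq_subr.
exists zeta => //; apply: contrapT => /eqP z0.
have ex : exists k, `[< exists a, fcoef (Psi a) k != 0 >].
  have [k Pk _] := fps_neq0_ord Pa0; by exists k; apply/asboolP; exists a0.
case: (ex_minnP ex) => k /asboolP[a Pk] kmin.
have low m b : (m < k)%N -> fcoef (Psi b) m = 0.
  move=> mk; apply: contrapT => /eqP Pm; move: mk; rewrite ltnNge => /negP; apply.
  by apply: kmin; apply/asboolP; exists b.
have step b : fcoef (Psi (minc i b)) k = fcoef zeta 0 * fcoef (Psi b) k.
  rewrite zP fcoefM big_ord_recl /= subn0 big1 ?addr0 // => m _.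
  by rewrite low ?mulr0 // ltn_subrL /= (leq_ltn_trans _ (ltn_ord m)).
have [D bD] := submod_bdeg sV (VP k).
have P1 N : fcoef (Psi (iter N (minc i) a)) k != 0.
  by elim: N => //= N IH; rewrite step mulf_neq0.
have dN N : mdeg (iter N (minc i) a) = (N + mdeg a)%N.
  by elim: N => //= N IH; rewrite mdeg_minc IH.
by have := P1 D.+1; rewrite bD ?eqxx // dN leq_addr.
Qed.

(** Invariant of a simultaneous diagonalization: all shifts are algebraic over K[[t]], and those in
    [s] already act as scalars. Variable [j] acts as a positive power of t, which will make the
    curve nonconstant. *)
Definition curve_state V j (s : seq 'I_n) Psi :=
  [/\ coefs_in V Psi, exists a, Psi a != 0,
    exists e, rel_ann j (1 *: 'X - (fpsXn K e.+1)%:P) Psi,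
    forall i, exists2 c, c != 0 & rel_ann i c Psi &
    forall i, i \in s -> exists l eta, l != 0 /\ rel_ann i (l *: 'X - eta%:P) Psi].

Lemma map_ram_linear e (l eta : fps K) :
  map_poly (ram e) (l *: 'X - eta%:P) = ram e l *: 'X - (ram e eta)%:P.
Proof. by rewrite rmorphB /= linearZ /= map_polyX map_polyC. Qed.

(** Puiseux's theorem splits the relation of variable [i] after a ramification, and one of the
    linear factors yields an eigenvector. The other relations survive because the shifts commute. *)
Lemma curve_step V j s i Psi : submod V -> curve_state V j s Psi ->
  exists Psi', curve_state V j (i :: s) Psi'.
Proof.
move=> sV [VP [a0 Pa0] [e jP] cP sP].
have [c c0 ci] := cP i.
have c1 : (1 < size c)%N.
  rewrite ltnNge; apply/negP => /size1_polyC cE; move: (ci a0).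
  rewrite cE -[_%:P]mulr1 mul_polyC pactZ pact1 => /eqP; rewrite mulf_eq0 (negbTE Pa0) orbF.
  by move=> /eqP c00; move: c0; rewrite cE c00 eqxx.
have [e' [t ct]] := splits_nonmonic c1.
pose P Psi := [/\ coefs_in V Psi,
    exists e, rel_ann j (1 *: 'X - (fpsXn K e.+1)%:P) Psi,
    forall i, exists2 c, c != 0 & rel_ann i c Psi &
    forall i, i \in s -> exists l eta, l != 0 /\ rel_ann i (l *: 'X - eta%:P) Psi].
pose Psi1 a := ram e' (Psi a).
have P1 : P Psi1.
  split; first exact: coefs_in_ram.
  - exists (e.+1 * e'.+1).-1; have := rel_ann_ram e' jP.
    by rewrite map_ram_linear ram1 [ram e' _]fsubstXn // prednK // muln_gt0.
  - move=> k; have [d d0 dk] := cP k; exists (map_poly (ram e') d); last exact: rel_ann_ram.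
    apply: contra d0 => /eqP d0; apply/eqP/polyP => m; rewrite coef0; apply/eqP.
    by rewrite -(ram_eq0 e') -[ram e' _]coef_map d0 coef0.
  - move=> k /sP[l [eta [l0 kl]]]; exists (ram e' l), (ram e' eta).
    by rewrite ram_eq0 -map_ram_linear; split=> //; apply: rel_ann_ram.
have Plin l eta Psi2 : P Psi2 -> P (lin i l eta Psi2).
  move=> [V2 [e2 j2] c2 s2]; split.
  - have -> : lin i l eta Psi2 = pact i (l *: 'X - eta%:P) Psi2.
      by apply/funext => a; rewrite pact_lin1.
    exact: coefs_in_pact.
  - by exists e2; apply: rel_ann_lin.
  - by move=> k; have [d d0 dk] := c2 k; exists d => //; apply: rel_ann_lin.
  - by move=> k /s2[l' [eta' [l0 kl]]]; exists l', eta'; split=> //; apply: rel_ann_lin.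
have Psi1a : exists a, Psi1 a != 0 by exists a0; rewrite ram_eq0.
have rel : rel_ann i (\prod_(eta <- t) (ram e' (lead_coef c) *: 'X - eta%:P)) Psi1.
  by rewrite -ct; apply: rel_ann_ram => a; rewrite pactZ ci mulr0.
have [Psi2 [[V2 j2 c2 s2] nz2 [eta eP]]] := eigenvector (Plin _) P1 Psi1a rel.
exists Psi2; split=> // k; rewrite inE => /orP[/eqP ->|/s2 //].
by exists (ram e' (lead_coef c)), eta; rewrite ram_eq0 lead_coef_eq0.
Qed.

Lemma curve_start V : submod V -> unbounded V ->
    (forall W, submod W -> unbounded W -> W `<=` V -> W = V) ->
  exists j Psi, curve_state V j [::] Psi.
Proof.
move=> sV uV Vmin; have [j [D [kD surj]]] := minimal_surjective sV uV Vmin.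
have [Phi [VPhi [a0 Pa0] Phi0 PhiS]] := socle_chain sV uV surj.
pose Psi a := Fps (fun k => Phi k a); exists j, Psi.
have VPsi : coefs_in V Psi by move=> k; apply: VPhi.
have PsiX a : Psi (minc j a) = fpsXn K 1 * Psi a.
  apply: fpsP => -[|k]; rewrite fcoefXnM.
    exact: (congr1 (fun h => h a) Phi0).
  have -> : (k.+1 < 1)%N = false by [].
  by rewrite subn1 /= -(PhiS k).
(* Induction on the order in t: when the previous coefficient vanishes, the next one is killed by
   the shift, hence has degree at most [D]. An element on which the shift is multiplication by t is
   thus determined by finitely many values. *)
have vanish Psi' : coefs_in V Psi' -> (forall a, Psi' (minc j a) = fpsXn K 1 * Psi' a) ->
    (forall b : box n D, Psi' (mon_of b) = 0) -> forall a, Psi' a = 0.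
  move=> V' X' b' a; apply: fpsP => k; rewrite fcoef0; elim: k a => [|k IH] a.
    have [aD|Da] := leqP (mdeg a) D.
      by have [b ->] := mon_ofP aD; rewrite b'.
    apply: (kD _ (V' 0%N)) => //; apply/funext => c.
    by rewrite /shift X' fcoefXnM.
  have [aD|Da] := leqP (mdeg a) D.
    by have [b ->] := mon_ofP aD; rewrite b'.
  apply: (kD _ (V' k.+1)) => //; apply/funext => c.
  rewrite /shift X' fcoefXnM; have -> : (k.+1 < 1)%N = false by [].
  by rewrite subn1 IH.
split=> //.
- by exists a0; apply/eqP => /(congr1 (fun h => fcoef h 0%N)) /eqP; apply/negP.
- by exists 0%N => a; rewrite pact_lin1 /lin mul1r PsiX subrr.
(* [Q + 1] iterates of the shift of variable [i], seen through [Q] values, are dependent over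
   K[[t]]. The dependency is the algebraic relation. *)
move=> i; pose Q := #|{: box n D}|.
have [c [[k0 ck0] c0]] := @lin_dep _ Q
  (fun k q => Psi (iter k (minc i) (mon_of (enum_val q)))).
pose p := \poly_(k < Q.+1) c (inord k).
have pk (k : 'I_Q.+1) : p`_k = c k by rewrite coef_poly ltn_ord inord_val.
exists p; first by apply: contra_neq ck0 => p0; rewrite -pk p0 coef0.
have pE a : pact i p Psi a = \sum_(k < Q.+1) c k * Psi (iter k (minc i) a).
  rewrite (@pact_widen _ _ Q.+1) ?size_poly //.
  by apply: eq_bigr => k _; rewrite pk.
apply: vanish; first exact: coefs_in_pact.
  move=> a; rewrite !pE mulr_sumr; apply: eq_bigr => k _.
  by rewrite iter_mincC PsiX mulrCA.
by move=> b; rewrite pE -[RHS](c0 (enum_rank b)); under [RHS]eq_bigr do rewrite enum_rankK.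
Qed.

Theorem curve_in_submodule V : submod V -> unbounded V ->
  exists zeta : 'I_n -> fps K, [/\ forall i, fcoef (zeta i) 0 = 0,
    exists j, zeta j != 0 &
    forall k, V (fun a => fcoef (\prod_i zeta i ^+ a i) k)].
Proof.
move=> sV0 uV0; have [V1 [sV uV V10 Vmin]] := minimal_unbounded sV0 uV0.
have [j [Psi0 st0]] := curve_start sV uV Vmin.
have [Psi [VP [a0 Pa0] [e eP] _ sP]] : exists Psi, curve_state V1 j (enum 'I_n) Psi.
  by elim: (enum 'I_n) => [|i s [Psi IH]]; [exists Psi0|apply: curve_step IH].
have /choice[zeta zP] : forall i, exists zeta, fcoef zeta 0 = 0 /\
    forall a, Psi (minc i a) = zeta * Psi a.
  move=> i; have [l [eta [l0 li]]] := sP i (mem_enum _ i).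
  have nz : exists a, Psi a != 0 by exists a0.
  by have [z z0 zi] := rel_ann_root sV VP nz l0 li; exists z.
have PE a : Psi a = \prod_i zeta i ^+ a i * Psi (mon0 n).
  elim/mon_ind: a => [|i a IH].
    by rewrite big1 ?mul1r // => i _; rewrite ffunE expr0.
  rewrite (zP i).2 IH mulrA; congr (_ * _).
  rewrite [RHS](bigD1 i) //= ffunE eqxx addn1 exprS -mulrA; congr (_ * _).
  rewrite [LHS](bigD1 i) //=; congr (_ * _); apply: eq_bigr => k /negbTE ki.
  by rewrite ffunE ki addn0.
have P0 : Psi (mon0 n) != 0.
  by apply: contra_neq Pa0 => P0; rewrite PE P0 mulr0.
exists zeta; split; first by move=> i; have [] := zP i.
  exists j; apply/eqP => zj; have /eqP := eP a0; apply/negP.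
  by rewrite pact_lin1 /lin mul1r (zP j).2 zj mul0r sub0r oppr_eq0 mulf_neq0 ?fpsXn_neq0.
(* The value of [Psi] at 1 is t^v u and need not be invertible. Multiplying [Psi] by u^-1 and
   reading the coefficient of index k + v amounts to dividing by it. *)
move=> k; apply: V10; have [v [u [uu P0E]]] := fps_ord_unit P0.
have := coefs_inM u^-1 sV VP (k + v)%N; congr V1; apply/funext => a.
rewrite PE P0E; have -> : u^-1 * (\prod_i zeta i ^+ a i * (fpsXn K v * u)) =
    fpsXn K v * (\prod_i zeta i ^+ a i).
  by rewrite mulrC -!mulrA mulrV // mulr1 mulrC.
by rewrite fcoefXnM ltnNge leq_addl /= addnK.
Qed.

End CurveExistence.

(** * Complex differentiability *)

Section DifferenceQuotient.
Local Open Scope classical_set_scope.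
Variable K : numFieldType.
Implicit Types (f : K -> K) (x c : K).

(** Free of division, with h = 0 allowed; it is used over the reals and over the complex numbers. *)
Definition has_diff f x c := forall e, 0 < e -> exists2 d, 0 < d &
  forall h, `|h| < d -> `|f (x + h) - f x - c * h| <= e * `|h|.

Lemma has_diff_cvg f x c :
  ((fun h : K => h^-1 *: ((f \o +%R^~ x) (h *: (1 : K^o)) - f x) : K^o) @ (0 : K)^' --> (c : K^o))
    <-> has_diff f x c.
Proof.
split=> [fc e e0|fc].
  move/cvgrPdist_le : fc => /(_ _ e0).
  rewrite near_withinE => /nbhs_ballP[d /= d0 dP]; exists d => // h hd.
  have [->|h0] := eqVneq h 0; first by rewrite addr0 subrr mulr0 subr0 normr0 mulr0.
  have := dP h; rewrite /ball /= sub0r normrN => /(_ hd h0).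
  rewrite [h *: _]mulr1 [h + x]addrC => H.
  have -> : f (x + h) - f x - c * h = - ((c - h^-1 * (f (x + h) - f x)) * h).
    by rewrite mulrBl mulrAC mulVf // mul1r opprB addrC.
  by rewrite normrN normrM ler_wpM2r.
apply/cvgrPdist_le => e e0; rewrite near_withinE; apply/nbhs_ballP.
have [d d0 dP] := fc _ e0; exists d => // h; rewrite /ball /= sub0r normrN => hd h0.
have := dP h hd; rewrite [h *: _]mulr1 [h + x]addrC => H.
have -> : c - h^-1 *: (f (x + h) - f x : K^o) = - ((f (x + h) - f x - c * h) / h).
  by rewrite mulrBl mulfK // opprB [_ *: _]mulrC.
by rewrite normrN normrM normfV ler_pdivrMr ?normr_gt0.
Qed.

Lemma has_diff_is_derive f x c :
  has_diff f x c <-> is_derive (x : K^o) (1 : K^o) (f : K^o -> K^o) (c : K^o).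
Proof.
split=> [/has_diff_cvg fc|[df <-]].
  by split; [apply: (cvgP (c : K^o))|apply: cvg_lim].
exact/has_diff_cvg.
Qed.

Lemma derivable_has_diff f x :
  derivable (f : K^o -> K^o) (x : K^o) 1 <-> exists c, has_diff f x c.
Proof.
split=> [df|[c /has_diff_is_derive []] //].
by exists ('D_1 (f : K^o -> K^o) x); apply/has_diff_is_derive/derivableP.
Qed.
End DifferenceQuotient.

Section ComplexAbs.
Variable R : realType.
Implicit Types (x y : R) (z w : R[i]).
Local Open Scope complex_scope.

Lemma normC_cabs z : `|z| = (cabs z)%:C.
Proof. by case: z => a b; rewrite normc_def. Qed.

Lemma cabs_ge0 z : 0 <= cabs z.
Proof. by rewrite -ler0c -normC_cabs. Qed.

Lemma cabs0 : cabs (0 : R[i]) = 0.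
Proof. exact: ComplexField.Normc.normc0. Qed.

Lemma cabs1 : cabs (1 : R[i]) = 1.
Proof. exact: ComplexField.Normc.normc1. Qed.

Lemma cabs_eq0 z : (cabs z == 0) = (z == 0).
Proof. by rewrite -(inj_eq (@complexI R)) -normC_cabs normr_eq0. Qed.

Lemma cabs_gt0 z : (0 < cabs z) = (z != 0).
Proof. by rewrite lt_neqAle cabs_ge0 andbT eq_sym cabs_eq0. Qed.

Lemma cabsM z w : cabs (z * w) = cabs z * cabs w.
Proof. exact: ComplexField.Normc.normcM. Qed.

Lemma cabsV z : cabs z^-1 = (cabs z)^-1.
Proof. exact: ComplexField.Normc.normcV. Qed.

Lemma cabsX z k : cabs (z ^+ k) = cabs z ^+ k.
Proof. by elim: k => [|k IH]; rewrite ?expr0 ?cabs1 // !exprS cabsM IH. Qed.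

Lemma cabsN z : cabs (- z) = cabs z.
Proof. by apply: complexI; rewrite -!normC_cabs normrN. Qed.

Lemma cabsD z w : cabs (z + w) <= cabs z + cabs w.
Proof. by rewrite -lecR rmorphD /= -!normC_cabs ler_normD. Qed.

Lemma cabsB z w : cabs (z - w) <= cabs z + cabs w.
Proof. by rewrite -(cabsN w) cabsD. Qed.

Lemma cabs_distC z w : cabs (z - w) = cabs (w - z).
Proof. by rewrite -cabsN opprB. Qed.

Lemma cabs_sum (I : Type) (s : seq I) (P : pred I) (F : I -> R[i]) :
  cabs (\sum_(i <- s | P i) F i) <= \sum_(i <- s | P i) cabs (F i).
Proof.
elim/big_ind2: _ => [|x z y w zx wy|//]; first by rewrite cabs0.
by apply: le_trans (cabsD _ _) (lerD _ _).
Qed.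

Lemma cabs_real x : cabs x%:C = `|x|.
Proof. by rewrite /cabs /= expr0n addr0 sqrtr_sqr. Qed.

Lemma cabs_i : cabs ('i : R[i]) = 1.
Proof. by rewrite /cabs /= expr0n expr1n add0r sqrtr1. Qed.

Lemma cabs_conj z : cabs (z^*) = cabs z.
Proof. by case: z => a b; rewrite /cabs /= sqrrN. Qed.

Lemma Re_cabs z : `|complex.Re z| <= cabs z.
Proof.
case: z => a b; rewrite /cabs /= -sqrtr_sqr ler_sqrt ?lerDl ?sqr_ge0 //.
by rewrite addr_ge0 ?sqr_ge0.
Qed.

Lemma Im_cabs z : `|complex.Im z| <= cabs z.
Proof.
case: z => a b; rewrite /cabs /= -sqrtr_sqr ler_sqrt ?lerDr ?sqr_ge0 //.
by rewrite addr_ge0 ?sqr_ge0.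
Qed.

Lemma cabs_ReIm z : cabs z <= `|complex.Re z| + `|complex.Im z|.
Proof.
rewrite {1}[z]complexE; apply: le_trans (cabsD _ _) _.
by rewrite cabsM cabs_i mul1r !cabs_real.
Qed.

Definition has_cdiff (f : R[i] -> R[i]) z c := forall e, 0 < e ->
  exists2 d, 0 < d & forall h, cabs h < d -> cabs (f (z + h) - f z - c * h) <= e * cabs h.

Lemma gt0_complexE z : 0 < z -> z = (complex.Re z)%:C /\ 0 < complex.Re z.
Proof. by case: z => a b; rewrite ltcE /= => /andP[/eqP -> a0]. Qed.

(** In the order of [R[i]] a positive number is real, so complex and real radii correspond. *)
Lemma has_cdiffE f z c : has_cdiff f z c <-> has_diff f z c.
Proof.
split=> fc e e0.
  have [eE e0'] := gt0_complexE e0.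
  have [d d0 dP] := fc _ e0'; exists d%:C; first by rewrite ltcR.
  by move=> h; rewrite !normC_cabs ltcR => /dP; rewrite eE -rmorphM lecR.
have e0' : 0 < e%:C by rewrite ltcR.
have [d d0 dP] := fc _ e0'.
have [dE d0'] := gt0_complexE d0; exists (complex.Re d) => //.
move=> h hd; have := dP h; rewrite dE !normC_cabs ltcR => /(_ hd).
by rewrite -rmorphM lecR.
Qed.

Definition hol (f : R[i] -> R[i]) z := exists c, has_cdiff f z c.

Lemma holP f z : hol f z <-> derivable (f : R[i]^o -> R[i]^o) (z : R[i]^o) 1.
Proof.
by split=> [[c /has_cdiffE fc]|/derivable_has_diff[c /has_cdiffE fc]];
  [apply/derivable_has_diff; exists c|exists c].
Qed.

End ComplexAbs.

(** * Primitives and increments of complex-valued functions of a real variable *)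

Section RealPrimitives.
Variable R : realType.
Implicit Types (x y d e M a b : R) (z w c : R[i]) (Phi phi : R -> R[i]).
Local Open Scope complex_scope.
Local Open Scope classical_set_scope.

Lemma mean_value_le (g dg : R -> R) a b M : a <= b ->
  (forall x, a <= x <= b -> has_diff g x (dg x)) ->
  (forall x, a <= x <= b -> `|dg x| <= M) -> `|g b - g a| <= M * (b - a).
Proof.
move=> ab dP dM; have dP' x : a <= x <= b -> is_derive x 1 g (dg x).
  by move=> /dP/has_diff_is_derive.
have dP2 x : x \in `]a, b[%R -> is_derive x 1 g (dg x).
  by rewrite in_itv /= => /andP[ax xb]; apply: dP'; rewrite !ltW.
have gc : {within `[a, b], continuous g}.
  apply: derivable_within_continuous => x; rewrite in_itv /= => xab.
  by have [] := dP' x xab.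
have [x + ->] := MVT_segment ab dP2 gc.
rewrite in_itv /= => xab; rewrite normrM [`|b - a|]ger0_norm ?subr_ge0 //.
by rewrite ler_wpM2r ?subr_ge0 // dM.
Qed.

Lemma mean_value_gt0 (g dg : R -> R) a b : a < b ->
  (forall x, a <= x <= b -> has_diff g x (dg x)) ->
  (forall x, a <= x <= b -> 0 < dg x) -> 0 < g b - g a.
Proof.
move=> ab dP dM; have dP' x : a <= x <= b -> is_derive x 1 g (dg x).
  by move=> /dP/has_diff_is_derive.
have dP2 x : x \in `]a, b[%R -> is_derive x 1 g (dg x).
  by rewrite in_itv /= => /andP[ax xb]; apply: dP'; rewrite !ltW.
have gc : {within `[a, b], continuous g}.
  apply: derivable_within_continuous => x; rewrite in_itv /= => xab.
  by have [] := dP' x xab.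
have [x + ->] := MVT_segment (ltW ab) dP2 gc.
by rewrite in_itv /= => xab; rewrite mulr_gt0 ?subr_gt0 ?dM.
Qed.

Lemma real_primitive (g : R -> R) r d : 0 < r -> r < d ->
  (forall x, `|x| < d -> {for x, continuous g}) ->
  exists G, forall x, `|x| < r -> has_diff G x (g x).
Proof.
move=> r0 rd gc.
pose G (x : R) := (\int[@lebesgue_measure R]_(t in [set` `[(- r), x]]) (g t))%R.
exists G => x; rewrite ltr_norml => /andP[rx xr].
have gint : (@lebesgue_measure R).-integrable `[(- r), r] (EFin \o g).
  apply: continuous_compact_integrable; first exact: segment_compact.
  apply: continuous_in_subspaceT => y; rewrite inE /= in_itv /= => yr.
  by apply: gc; apply: le_lt_trans rd; rewrite ler_norml.
have gx : {for x, continuous g}.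
  by apply: gc; apply: lt_trans rd; rewrite ltr_norml rx.
have [dG GE] := continuous_FTC1_closed xr gint rx gx.
by apply/has_diff_is_derive; rewrite -GE derive1E; apply/derivableP.
Qed.

Definition has_rdiff Phi x c := forall e, 0 < e -> exists2 d, 0 < d &
  forall h : R, `|h| < d -> cabs (Phi (x + h) - Phi x - c * h%:C) <= e * `|h|.

Definition rcont phi x := forall e, 0 < e -> exists2 d, 0 < d &
  forall h : R, `|h| < d -> cabs (phi (x + h) - phi x) < e.

Lemma ReMr c x : complex.Re (c * x%:C) = complex.Re c * x.
Proof. by case: c => a b /=; rewrite mulr0 subr0. Qed.

Lemma ReB z w : complex.Re (z - w) = complex.Re z - complex.Re w.
Proof. by case: z w => [a b] [c d]. Qed.

Lemma ImMr c x : complex.Im (c * x%:C) = complex.Im c * x.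
Proof. by case: c => a b /=; rewrite mulr0 add0r. Qed.

Lemma ImB z w : complex.Im (z - w) = complex.Im z - complex.Im w.
Proof. by case: z w => [a b] [c d]. Qed.

Lemma rdiff_Re Phi x c : has_rdiff Phi x c -> has_diff (fun y => complex.Re (Phi y)) x (complex.Re c).
Proof.
move=> P e e0; have [d d0 dP] := P e e0; exists d => // h /dP; apply: le_trans.
by rewrite /= -ReMr -!ReB Re_cabs.
Qed.

Lemma rdiff_Im Phi x c : has_rdiff Phi x c -> has_diff (fun y => complex.Im (Phi y)) x (complex.Im c).
Proof.
move=> P e e0; have [d d0 dP] := P e e0; exists d => // h /dP; apply: le_trans.
by rewrite /= -ImMr -!ImB Im_cabs.
Qed.

(** The mean value theorem holds for the real and imaginary parts separately, whence the factor
    2. *)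
Lemma rdiff_increment Phi phi a b M : a <= b ->
  (forall x, a <= x <= b -> has_rdiff Phi x (phi x)) ->
  (forall x, a <= x <= b -> cabs (phi x) <= M) ->
  cabs (Phi b - Phi a) <= 2 * M * (b - a).
Proof.
move=> ab dP dM; apply: le_trans (cabs_ReIm _) _.
rewrite -mulrA mulr_natl mulr2n ReB ImB; apply: lerD.
  apply: (mean_value_le ab (fun x xab => rdiff_Re (dP x xab))) => x /dM.
  exact/le_trans/Re_cabs.
apply: (mean_value_le ab (fun x xab => rdiff_Im (dP x xab))) => x /dM.
exact/le_trans/Im_cabs.
Qed.

Lemma rdiff_lin w Phi Psi x c c' : has_rdiff Phi x c -> has_rdiff Psi x c' ->
  has_rdiff (fun y => w * Phi y + Psi y) x (w * c + c').
Proof.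
move=> P Q e e0; have w0 : 0 < cabs w + 1 by rewrite ltr_wpDl ?cabs_ge0.
have [|d d0 dP] := P (e / 2 / (cabs w + 1)); first by rewrite !divr_gt0.
have [|d' d'0 dP'] := Q (e / 2); first by rewrite divr_gt0.
exists (Num.min d d'); first by rewrite lt_min d0.
move=> h; rewrite lt_min => /andP[/dP {}dP /dP' {}dP'].
have -> : w * Phi (x + h) + Psi (x + h) - (w * Phi x + Psi x) - (w * c + c') * h%:C =
  w * (Phi (x + h) - Phi x - c * h%:C) + (Psi (x + h) - Psi x - c' * h%:C) by ring.
apply: le_trans (cabsD _ _) _; rewrite [e in X in _ <= X]splitr mulrDl lerD // cabsM.
apply: (@le_trans _ _ ((cabs w + 1) * (e / 2 / (cabs w + 1) * `|h|))).
  by rewrite ler_pM ?cabs_ge0 ?lerDl.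
by rewrite mulrA [_ * (_ / _)]mulrC divfK ?gt_eqF.
Qed.

Lemma rdiff_line G z w c x : has_cdiff G (z + x%:C * w) c ->
  has_rdiff (fun y => G (z + y%:C * w)) x (c * w).
Proof.
move=> P e e0; have w0 : 0 < cabs w + 1 by rewrite ltr_wpDl ?cabs_ge0.
have [|d d0 dP] := P (e / (cabs w + 1)); first by rewrite !divr_gt0.
exists (d / (cabs w + 1)); first by rewrite divr_gt0.
move=> h hd; have := dP (h%:C * w); rewrite cabsM cabs_real.
have -> : z + x%:C * w + h%:C * w = z + (x + h)%:C * w by rewrite rmorphD /=; ring.
have -> : c * (h%:C * w) = c * w * h%:C by ring.
move=> H; apply: le_trans (H _) _; last first.
  have -> : e / (cabs w + 1) * (`|h| * cabs w) = e * `|h| * (cabs w / (cabs w + 1)).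
    by field; rewrite gt_eqF.
  apply: ler_piMr; first by apply: mulr_ge0 => //; apply: ltW.
  by rewrite ler_pdivrMr // mul1r lerDl.
apply: (@le_lt_trans _ _ (`|h| * (cabs w + 1))); first by rewrite ler_wpM2l ?lerDl.
by rewrite -ltr_pdivlMr.
Qed.

Lemma rcont_Re phi x : rcont phi x -> {for x, continuous (fun y => complex.Re (phi y))}.
Proof.
move=> P; apply/cvgrPdist_lt => e e0; have [d d0 dP] := P e e0.
apply/nbhs_ballP; exists d => // y; rewrite /ball /= => xy.
have := dP (y - x); rewrite [`|y - x|]distrC [x + (y - x)]addrC subrK => /(_ xy); apply: le_lt_trans.
by rewrite distrC -ReB Re_cabs.
Qed.

Lemma rcont_Im phi x : rcont phi x -> {for x, continuous (fun y => complex.Im (phi y))}.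
Proof.
move=> P; apply/cvgrPdist_lt => e e0; have [d d0 dP] := P e e0.
apply/nbhs_ballP; exists d => // y; rewrite /ball /= => xy.
have := dP (y - x); rewrite [`|y - x|]distrC [x + (y - x)]addrC subrK => /(_ xy); apply: le_lt_trans.
by rewrite distrC -ImB Im_cabs.
Qed.

Lemma has_rdiff_real (g : R -> R) x (c : R) : has_diff g x c ->
  has_rdiff (fun y => (g y)%:C) x c%:C.
Proof.
move=> P e e0; have [d d0 dP] := P e e0; exists d => // h /dP.
by rewrite -rmorphM -!rmorphB cabs_real.
Qed.

Lemma complex_primitive phi r d : 0 < r -> r < d ->
  (forall x, `|x| < d -> rcont phi x) ->
  exists Phi, forall x, `|x| < r -> has_rdiff Phi x (phi x).
Proof.
move=> r0 rd pc.
have [G GP] := real_primitive r0 rd (fun x xd => rcont_Re (pc x xd)).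
have [H HP] := real_primitive r0 rd (fun x xd => rcont_Im (pc x xd)).
exists (fun x => 'i * (H x)%:C + (G x)%:C) => x xr.
by rewrite [phi x]complexE addrC; apply: rdiff_lin; apply: has_rdiff_real; [apply: HP|apply: GP].
Qed.

End RealPrimitives.

(** * Goursat's theorem on rectangles *)

Section Goursat.
Variable R : realType.
Implicit Types (x y d e r M a b c : R) (z w t : R[i]) (Phi phi : R -> R[i]).
Implicit Types (f g h : R[i] -> R[i]) (Hx Hy : R -> R -> R[i]).
Local Open Scope complex_scope.
Local Open Scope classical_set_scope.

Definition pt x y : R[i] := x +i* y.

Lemma pt_x x y : pt x y = 'i * y%:C + x%:C * 1.
Proof. by rewrite mulr1 [LHS]complexE addrC. Qed.

Lemma pt_y x y : pt x y = x%:C + y%:C * 'i.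
Proof. by rewrite [LHS]complexE mulrC. Qed.

Lemma pt_sub x y x' y' : pt x y - pt x' y' = pt (x - x') (y - y').
Proof. by []. Qed.

Lemma cabs_pt x y : cabs (pt x y) <= `|x| + `|y|.
Proof. exact: cabs_ReIm. Qed.

(** Line integrals are increments of primitives along horizontal and vertical lines. With these,
    [rect] is the integral of h dz around a rectangle, where dz = i dy on the vertical sides. *)
Definition prim2 d h Hx Hy := forall x y, `|x| < d -> `|y| < d ->
  has_rdiff (Hx^~ y) x (h (pt x y)) /\ has_rdiff (Hy x) y (h (pt x y)).

Definition rect Hx Hy a b c e : R[i] := (Hx b c - Hx a c) + 'i * (Hy b e - Hy b c)
  - (Hx b e - Hx a e) - 'i * (Hy a e - Hy a c).

Lemma in_itv_norm d a b x : - d < a -> b < d -> a <= x <= b -> `|x| < d.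
Proof.
by move=> da bd /andP[ax xb]; rewrite ltr_norml (lt_le_trans da ax) (le_lt_trans xb bd).
Qed.

Lemma rect_bound d h Hx Hy a b c e M : prim2 d h Hx Hy ->
  - d < a -> a <= b -> b < d -> - d < c -> c <= e -> e < d ->
  (forall x y, a <= x <= b -> c <= y <= e -> cabs (h (pt x y)) <= M) ->
  cabs (rect Hx Hy a b c e) <= 4 * M * ((b - a) + (e - c)).
Proof.
move=> P da ab bd dc ce ed hM.
have nx := in_itv_norm da bd; have ny := in_itv_norm dc ed.
have hor y : c <= y <= e -> cabs (Hx b y - Hx a y) <= 2 * M * (b - a).
  move=> yc; apply: (@rdiff_increment _ (Hx^~ y) (fun x => h (pt x y))) => // x xab.
    by have [] := P x y (nx x xab) (ny y yc).
  exact: hM.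
have ver x : a <= x <= b -> cabs (Hy x e - Hy x c) <= 2 * M * (e - c).
  move=> xa; apply: (@rdiff_increment _ (Hy x) (fun y => h (pt x y))) => // y yce.
    by have [] := P x y (nx x xa) (ny y yce).
  exact: hM.
have {}hor1 := hor c; have {}hor2 := hor e; have ver1 := ver a; have ver2 := ver b.
move: hor1 hor2 ver1 ver2; rewrite !lexx ab ce => /(_ isT) h1 /(_ isT) h2 /(_ isT) v1 /(_ isT) v2.
rewrite /rect; apply: le_trans (cabsB _ _) _; rewrite cabsM cabs_i mul1r.
have := cabsB (Hx b c - Hx a c + 'i * (Hy b e - Hy b c)) (Hx b e - Hx a e).
have := cabsD (Hx b c - Hx a c) ('i * (Hy b e - Hy b c)); rewrite cabsM cabs_i mul1r.
lra.
Qed.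

(** The increments of a complex primitive [G] cancel around a closed contour, so its derivative can
    be subtracted from [h] without changing the integral. In the y direction the derivative of [G]
    is i g, which explains the factor 'i of the second witness. *)
Lemma rect_shift d h g G Hx Hy : prim2 d h Hx Hy ->
  (forall x y, `|x| < d -> `|y| < d -> has_cdiff G (pt x y) (g (pt x y))) ->
  exists Hx' Hy', prim2 d (fun z => h z - g z) Hx' Hy' /\
    forall a b c e, rect Hx' Hy' a b c e = rect Hx Hy a b c e.
Proof.
move=> P PG; exists (fun x y => -1 * G (pt x y) + Hx x y), (fun x y => 'i * G (pt x y) + Hy x y).
split=> [x y xd yd|a b c e]; last first.
  rewrite /rect; apply/eqP; rewrite -subr_eq0; apply/eqP.
  have i2 : 'i * 'i = -1 :> R[i] by rewrite -expr2 sqr_i.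
  move: (G _) (G _) (G _) (G _) => g1 g2 g3 g4.
  move: (Hx _ _) (Hx _ _) (Hx _ _) (Hx _ _) (Hy _ _) (Hy _ _) (Hy _ _) (Hy _ _).
  by move=> u1 u2 u3 u4 v1 v2 v3 v4; ring: i2.
have [D1 D2] := P x y xd yd; have DG := PG x y xd yd; split.
  have E1 : has_rdiff (fun u => G (pt u y)) x (g (pt x y)).
    have -> : (fun u => G (pt u y)) = (fun u => G ('i * y%:C + u%:C * 1)).
      by apply/funext => u; rewrite pt_x.
    by rewrite -[g _]mulr1; apply: rdiff_line; rewrite -pt_x.
  by have := rdiff_lin (-1) E1 D1; rewrite mulN1r addrC.
have E2 : has_rdiff (fun u => G (pt x u)) y (g (pt x y) * 'i).
  have -> : (fun u => G (pt x u)) = (fun u => G (x%:C + u%:C * 'i)).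
    by apply/funext => u; rewrite pt_y.
  by apply: rdiff_line; rewrite -pt_y.
have := rdiff_lin 'i E2 D2; rewrite mulrCA -expr2 sqr_i mulrN1 addrC.
by [].
Qed.

Lemma cabs_nat k : cabs (k%:R : R[i]) = k%:R.
Proof.
have -> : (k%:R : R[i]) = (k%:R : R)%:C by rewrite rmorph_nat.
by rewrite cabs_real ger0_norm.
Qed.

Lemma cdiff_quadratic u v z0 z :
  has_cdiff (fun t => u * t + v / 2 * (t - z0) ^+ 2) z (u + v * (z - z0)).
Proof.
move=> e e0; have v0 : 0 < cabs v + 1 by rewrite ltr_wpDl ?cabs_ge0.
exists (e / (cabs v + 1)) => [|k kd]; first by rewrite divr_gt0.
have -> : u * (z + k) + v / 2 * (z + k - z0) ^+ 2 - (u * z + v / 2 * (z - z0) ^+ 2)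
   - (u + v * (z - z0)) * k = (v / 2 * k) * k by field.
rewrite !cabsM ler_wpM2r ?cabs_ge0 // cabsV.
rewrite [cabs 2]cabs_nat.
have k0 := cabs_ge0 k; have v00 := cabs_ge0 v.
move: kd; rewrite ltr_pdivlMr // => kd; nra.
Qed.

Lemma goursat_local d h Hx Hy x0 y0 : prim2 d h Hx Hy -> hol h (pt x0 y0) ->
  forall e, 0 < e -> exists2 s, 0 < s & forall a b c c', - d < a -> b < d -> - d < c -> c' < d ->
    a <= x0 <= b -> c <= y0 <= c' -> b - a < s -> c' - c < s ->
    cabs (rect Hx Hy a b c c') <= 4 * e * ((b - a) + (c' - c)) ^+ 2.
Proof.
move=> P [v hv] e e0; have [s s0 hs] := hv e e0.
exists (s / 2) => [|a b c c' da bd dc cd xab ycc bs cs]; first by rewrite divr_gt0.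
set z0 := pt x0 y0 in hv hs; set u := h z0.
(* The affine approximation of [h] at [z0] has a quadratic primitive and is subtracted; what remains
   is at most [e] times the distance to [z0]. *)
have [Hx' [Hy' [P' <-]]] := @rect_shift d h (fun z => u + v * (z - z0)) _ Hx Hy P
  (fun x y _ _ => @cdiff_quadratic u v z0 (pt x y)).
rewrite expr2 mulrA -[4 * e * _]mulrA.
have [/andP[ax xb] /andP[cy yc]] := (xab, ycc).
apply: (rect_bound P') => // [||x y /andP[ax' xb'] /andP[cy' yc']];
  [exact: le_trans ax xb|exact: le_trans cy yc|].
have hz : cabs (pt x y - z0) <= (b - a) + (c' - c).
  rewrite pt_sub; apply: le_trans (cabs_pt _ _) _; rewrite lerD // ler_norml; apply/andP; lra.
have := hs (pt x y - z0); rewrite [z0 + _]addrC subrK => /(_ _)/le_trans.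
have -> : h (pt x y) - (u + v * (pt x y - z0)) = h (pt x y) - h z0 - v * (pt x y - z0).
  by rewrite /u; ring.
by apply; [lra|rewrite ler_pM2l].
Qed.

Lemma nested_intervals (u l : nat -> R) : (forall k, 0 <= l k) ->
  (forall k, u k <= u k.+1) -> (forall k, u k.+1 + l k.+1 <= u k + l k) ->
  exists x, forall k, u k <= x <= u k + l k.
Proof.
move=> l0 uS ulS.
have um k m : u k <= u (k + m)%N.
  by elim: m => [|m IH]; rewrite ?addn0 // addnS (le_trans IH).
have ulm k m : u (k + m)%N + l (k + m)%N <= u k + l k.
  by elim: m => [|m IH]; rewrite ?addn0 // addnS (le_trans _ IH).
have bd k m : u m <= u k + l k.
  apply: le_trans (um m k) _; rewrite addnC; apply: le_trans _ (ulm k m).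
  by rewrite lerDl.
have ub k : ubound [set u m | m in setT] (u k + l k) by move=> _ [m _ <-].
have ne : [set u m | m in setT] !=set0 by exists (u 0%N), 0%N.
exists (sup [set u m | m in setT]) => k; apply/andP; split; last exact: ge_sup.
by apply: ub_le_sup; [exists (u 0%N + l 0%N)|exists k].
Qed.

(** Successive quartering of a rectangle: [Q] passes to one of the four quarters, and the chosen
    corners determine nested intervals with a common point. *)
Lemma bisection (Q : R -> R -> nat -> Prop) a c L W : 0 <= L -> 0 <= W -> Q a c 0%N ->
  (forall x y k, Q x y k -> exists x' y', [/\ x' = x \/ x' = x + L / 2 ^+ k.+1,
     y' = y \/ y' = y + W / 2 ^+ k.+1 & Q x' y' k.+1]) ->
  exists x0 y0, forall k, exists x y, [/\ Q x y k, x <= x0 <= x + L / 2 ^+ k,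
    y <= y0 <= y + W / 2 ^+ k, a <= x /\ x + L / 2 ^+ k <= a + L &
    c <= y /\ y + W / 2 ^+ k <= c + W].
Proof.
move=> L0 W0 Q0 QS.
have /choice[F FP] : forall p : R * R * nat, exists q : R * R, Q p.1.1 p.1.2 p.2 ->
    [/\ q.1 = p.1.1 \/ q.1 = p.1.1 + L / 2 ^+ p.2.+1,
     q.2 = p.1.2 \/ q.2 = p.1.2 + W / 2 ^+ p.2.+1 & Q q.1 q.2 p.2.+1].
  move=> [[x y] k] /=; have [/QS[x' [y' qP]]|nQ] := pselect (Q x y k).
    by exists (x', y').
  by exists (x, y) => /nQ.
pose fix s k : R * R := if k is k'.+1 then F (s k', k') else (a, c).
have Qs k : Q (s k).1 (s k).2 k.
  by elim: k => // k IH; have [_ _] := FP (s k, k) IH.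
have half (l : R) k : l / 2 ^+ k = l / 2 ^+ k.+1 + l / 2 ^+ k.+1.
  by rewrite exprS; field; rewrite expf_neq0.
have ge (l : R) k : 0 <= l -> 0 <= l / 2 ^+ k by move=> ?; rewrite divr_ge0 ?exprn_ge0.
have sx k : (s k).1 <= (s k.+1).1 /\ (s k.+1).1 + L / 2 ^+ k.+1 <= (s k).1 + L / 2 ^+ k.
  have [/= X _ _] := FP (s k, k) (Qs k); have := half L k; have := ge L k.+1 L0.
  by case: X => ->; lra.
have sy k : (s k).2 <= (s k.+1).2 /\ (s k.+1).2 + W / 2 ^+ k.+1 <= (s k).2 + W / 2 ^+ k.
  have [/= _ X _] := FP (s k, k) (Qs k); have := half W k; have := ge W k.+1 W0.
  by case: X => ->; lra.
have [x0 x0P] := nested_intervals (fun k => ge L k L0) (fun k => (sx k).1) (fun k => (sx k).2).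
have [y0 y0P] := nested_intervals (fun k => ge W k W0) (fun k => (sy k).1) (fun k => (sy k).2).
exists x0, y0 => k; exists (s k).1, (s k).2; split=> //.
  by elim: k => [|k [IHx IHy]]; [rewrite /= expr0 divr1|have := sx k; lra].
by elim: k => [|k [IHx IHy]]; [rewrite /= expr0 divr1|have := sy k; lra].
Qed.

Lemma rect_split_x Hx Hy a m b c e :
  rect Hx Hy a b c e = rect Hx Hy a m c e + rect Hx Hy m b c e.
Proof. by rewrite /rect; ring. Qed.

Lemma rect_split_y Hx Hy a b c m e :
  rect Hx Hy a b c e = rect Hx Hy a b c m + rect Hx Hy a b m e.
Proof. by rewrite /rect; ring. Qed.

Lemma goursat d h Hx Hy a b c e : prim2 d h Hx Hy ->
  - d < a -> a <= b -> b < d -> - d < c -> c <= e -> e < d ->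
  (forall x y, a <= x <= b -> c <= y <= e -> hol h (pt x y)) ->
  rect Hx Hy a b c e = 0.
Proof.
move=> P da ab bd dc ce ed hh; apply/eqP; rewrite -cabs_eq0; apply: contrapT => /negP.
rewrite -/(cabs _ != 0) => eta0; set eta := cabs _ in eta0.
have {}eta0 : 0 < eta by rewrite lt_neqAle eq_sym eta0 cabs_ge0.
set L := b - a; set W := e - c.
have L0 : 0 <= L by rewrite subr_ge0. have W0 : 0 <= W by rewrite subr_ge0.
pose Q x y k := eta / 4 ^+ k <= cabs (rect Hx Hy x (x + L / 2 ^+ k) y (y + W / 2 ^+ k)).
have Q0 : Q a c 0%N.
  by rewrite /Q !expr0 !divr1 /L /W ![_ + (_ - _)]addrC !subrK.
have [|x0 [y0 xyP]] := @bisection Q a c L W L0 W0 Q0.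
  move=> x y k Qk; apply: contrapT => nex.
  have small x' y' : (x' = x \/ x' = x + L / 2 ^+ k.+1) -> (y' = y \/ y' = y + W / 2 ^+ k.+1) ->
      cabs (rect Hx Hy x' (x' + L / 2 ^+ k.+1) y' (y' + W / 2 ^+ k.+1)) < eta / 4 ^+ k.+1.
    move=> xx yy; rewrite ltNge; apply/negP => Qx; apply: nex; exists x', y'.
    by split.
  have half (l : R) : l / 2 ^+ k = l / 2 ^+ k.+1 + l / 2 ^+ k.+1.
    by rewrite exprS; field; rewrite expf_neq0.
  have q4 : eta / 4 ^+ k = 4 * (eta / 4 ^+ k.+1).
    by rewrite exprS; field; rewrite expf_neq0.
  move: Qk; rewrite /Q (half L) (half W) q4 !addrA.
  rewrite (rect_split_x _ _ x (x + L / 2 ^+ k.+1)).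
  rewrite (rect_split_y _ _ _ _ y (y + W / 2 ^+ k.+1)).
  rewrite (rect_split_y _ _ (x + _) _ y (y + W / 2 ^+ k.+1)).
  set r1 := rect _ _ _ _ _ _; set r2 := rect _ _ _ _ _ _.
  set r3 := rect _ _ _ _ _ _; set r4 := rect _ _ _ _ _ _.
  have s1 : cabs r1 < eta / 4 ^+ k.+1 by apply: small; left.
  have s2 : cabs r2 < eta / 4 ^+ k.+1 by apply: small; [left|right].
  have s3 : cabs r3 < eta / 4 ^+ k.+1 by apply: small; [right|left].
  have s4 : cabs r4 < eta / 4 ^+ k.+1 by apply: small; right.
  have := cabsD (r1 + r2) (r3 + r4); have := cabsD r1 r2; have := cabsD r3 r4; lra.
have [x1 [y1 [_ xa1 ya1 [ax1 xb1] [cy1 ye1]]]] := xyP 0%N.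
have hxy : hol h (pt x0 y0).
  apply: hh; rewrite /L /W expr0 divr1 in xa1 ya1 xb1 ye1.
    by apply/andP; move: xa1 => /andP[? ?]; lra.
  by apply/andP; move: ya1 => /andP[? ?]; lra.
(* The summand 1 keeps [S] positive for degenerate rectangles. *)
pose S := L + W + 1; have S0 : 0 < S by rewrite /S ltr_wpDl // addr_ge0.
(* The local estimate on the [k]-th rectangle is 4 e S^2 / 4^k; this choice of e makes it half of
   the lower bound eta / 4^k. *)
have e0 : 0 < eta / (8 * S ^+ 2) by rewrite divr_gt0 ?mulr_gt0 ?exprn_gt0.
have [s s0 sP] := goursat_local P hxy e0.
have [k kP] : exists k, S / 2 ^+ k < s.
  exists (Num.bound (S / s)); rewrite ltr_pdivrMr ?exprn_gt0 // mulrC -ltr_pdivrMr //.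
  apply: lt_trans (archi_boundP _) _; first by rewrite divr_ge0 ?ltW.
  by rewrite -natrX ltr_nat ltn_expl.
have [x [y [Qk xx yy [ax xb] [cy ye]]]] := xyP k.
have k0 : 0 < (2 : R) ^+ k by rewrite exprn_gt0.
have LS : L / 2 ^+ k <= S / 2 ^+ k by rewrite ler_pM2r ?invr_gt0 // /S -addrA lerDl addr_ge0.
have WS : W / 2 ^+ k <= S / 2 ^+ k.
  by rewrite ler_pM2r ?invr_gt0 // /S addrAC lerDr addr_ge0.
have := sP x (x + L / 2 ^+ k) y (y + W / 2 ^+ k).
have dx : - d < x := lt_le_trans da ax.
have dy : - d < y := lt_le_trans dc cy.
have xd : x + L / 2 ^+ k < d by apply: le_lt_trans xb _; rewrite /L addrC subrK.
have yd : y + W / 2 ^+ k < d by apply: le_lt_trans ye _; rewrite /W addrC subrK.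
move=> /(_ dx xd dy yd xx yy).
have -> : x + L / 2 ^+ k - x = L / 2 ^+ k by ring.
have -> : y + W / 2 ^+ k - y = W / 2 ^+ k by ring.
move=> /(_ (le_lt_trans LS kP) (le_lt_trans WS kP)) /(le_trans Qk).
apply/negP; rewrite -ltNge -mulrDl exprMn.
have -> : (2 ^+ k)^-1 ^+ 2 = (4 ^+ k)^-1 :> R.
  by rewrite exprVn -exprM mulnC exprM; congr (_ ^+ _)^-1; rewrite -natrX.
rewrite [4 * _ * (_ * _)]mulrA ltr_pM2r ?invr_gt0 ?exprn_gt0 //.
apply: (@le_lt_trans _ _ (4 * (eta / (8 * S ^+ 2)) * S ^+ 2)).
  apply: ler_wpM2l; first by apply: mulr_ge0 => //; apply: ltW.
  have LW : 0 <= L + W by apply: addr_ge0.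
  have LWS : L + W <= S by rewrite lerDl.
  by apply: lerXn2r => //; rewrite nnegrE ltW.
have -> : 4 * (eta / (8 * S ^+ 2)) * S ^+ 2 = eta / 2 by field; rewrite gt_eqF.
lra.
Qed.

Lemma rect_peel Hx Hy r x0 y0 e : 0 < e -> - r <= x0 - e -> x0 + e <= r ->
    - r <= y0 - e -> y0 + e <= r ->
    (forall a b c c', - r <= a -> a <= b -> b <= r -> - r <= c -> c <= c' -> c' <= r ->
      (forall x y, a <= x <= b -> c <= y <= c' -> x <> x0 \/ y <> y0) ->
      rect Hx Hy a b c c' = 0) ->
  rect Hx Hy (- r) r (- r) r = rect Hx Hy (x0 - e) (x0 + e) (y0 - e) (y0 + e).
Proof.
move=> e0 xl xr yl yr Z.
have [xe ye] : x0 - e <= x0 + e /\ y0 - e <= y0 + e by lra.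
have Z1 : rect Hx Hy (- r) (x0 - e) (- r) r = 0.
  by apply: Z; [lra|lra|lra|lra|lra|lra|move=> x y /andP[? ?] _; left; lra].
have Z2 : rect Hx Hy (x0 + e) r (- r) r = 0.
  by apply: Z; [lra|lra|lra|lra|lra|lra|move=> x y /andP[? ?] _; left; lra].
have Z3 : rect Hx Hy (x0 - e) (x0 + e) (- r) (y0 - e) = 0.
  by apply: Z; [lra|lra|lra|lra|lra|lra|move=> x y _ /andP[? ?]; right; lra].
have Z4 : rect Hx Hy (x0 - e) (x0 + e) (y0 + e) r = 0.
  by apply: Z; [lra|lra|lra|lra|lra|lra|move=> x y _ /andP[? ?]; right; lra].
rewrite (rect_split_x _ _ _ (x0 - e)) (rect_split_x _ _ (x0 - e) (x0 + e)).
rewrite Z1 Z2 add0r addr0.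
rewrite (rect_split_y _ _ _ _ _ (y0 - e)) (rect_split_y _ _ _ _ (y0 - e) (y0 + e)).
by rewrite Z3 Z4 add0r addr0.
Qed.

(** Goursat's theorem removes everything but a square of side 2 e around the exceptional point,
    where boundedness makes the integral O(e). *)
Lemma goursat_punctured d r g Hx Hy x0 y0 M s : prim2 d g Hx Hy -> r < d ->
  `|x0| < r -> `|y0| < r ->
  (forall x y, `|x| < d -> `|y| < d -> pt x y != pt x0 y0 -> hol g (pt x y)) ->
  0 < s -> (forall x y, `|x - x0| < s -> `|y - y0| < s -> cabs (g (pt x y)) <= M) ->
  rect Hx Hy (- r) r (- r) r = 0.
Proof.
move=> P rd x0r y0r gh s0 gM; apply/eqP; rewrite -cabs_eq0; apply/eqP/le_anti.
rewrite cabs_ge0 andbT.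
have M0 : 0 <= M by apply: le_trans (cabs_ge0 _) (gM x0 y0 _ _); rewrite subrr normr0.
apply/ler_addgt0Pr => e0 e00; rewrite add0r.
(* The perimeter estimate on the small square is 16 M e, which must not exceed [e0]; the other
   bounds keep the square inside the domain. *)
pose e := Num.min (Num.min (s / 2) (e0 / (16 * (M + 1)))) (Num.min ((r - `|x0|)) ((r - `|y0|))).
have M1 : 0 < 16 * (M + 1) by rewrite mulr_gt0 // ltr_wpDl.
have e1 : 0 < e by rewrite /e !lt_min !subr_gt0 x0r y0r !divr_gt0.
have es : e <= s / 2 by rewrite /e !ge_min lexx ?orbT.
have em : e <= e0 / (16 * (M + 1)) by rewrite /e !ge_min lexx ?orbT.
have ex : e <= r - `|x0| by rewrite /e !ge_min lexx ?orbT.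
have ey : e <= r - `|y0| by rewrite /e !ge_min lexx ?orbT.
have [xl xr] : -r <= x0 - e /\ x0 + e <= r.
  by have := ler_norm x0; have := ler_norm (- x0); rewrite normrN; lra.
have [yl yr] : -r <= y0 - e /\ y0 + e <= r.
  by have := ler_norm y0; have := ler_norm (- y0); rewrite normrN; lra.
have nin x y : pt x y = pt x0 y0 -> x = x0 /\ y = y0 by case.
have Z a b c c' : - r <= a -> a <= b -> b <= r -> - r <= c -> c <= c' -> c' <= r ->
    (forall x y, a <= x <= b -> c <= y <= c' -> x <> x0 \/ y <> y0) ->
    rect Hx Hy a b c c' = 0.
  move=> ra ab br rc cc cr no; apply: (goursat P) => //; try lra.
  move=> x y xab ycc; apply: gh.
  - by apply: in_itv_norm xab; lra.
  - by apply: in_itv_norm ycc; lra.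
  - by apply/eqP => /nin[? ?]; case: (no x y xab ycc).
rewrite (rect_peel e1 xl xr yl yr Z).
have B : cabs (rect Hx Hy (x0 - e) (x0 + e) (y0 - e) (y0 + e)) <=
    4 * M * ((x0 + e - (x0 - e)) + (y0 + e - (y0 - e))).
  apply: (rect_bound P); try lra.
  move=> x y /andP[? ?] /andP[? ?]; apply: gM; rewrite ltr_norml; apply/andP; lra.
apply: le_trans B _; move: em; rewrite ler_pdivlMr //; nra.
Qed.

End Goursat.

(** * Cauchy formula and Taylor expansion *)

Section Cauchy.
Variable R : realType.
Implicit Types (x y d e r M a b : R) (z w t u v c : R[i]) (P Q phi : R -> R[i]).
Implicit Types (f g h : R[i] -> R[i]) (Hx Hy : R -> R -> R[i]).
Local Open Scope complex_scope.
Local Open Scope classical_set_scope.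

Definition ccont h z := forall e, 0 < e -> exists2 d, 0 < d &
  forall k, cabs k < d -> cabs (h (z + k) - h z) < e.

Lemma hol_ccont h z : hol h z -> ccont h z.
Proof.
move=> [c hc] e e0; have [d d0 dP] := hc 1 ltr01.
have c0 : 0 < cabs c + 1 by rewrite ltr_wpDl ?cabs_ge0.
exists (Num.min d (e / (cabs c + 1))); first by rewrite lt_min d0 divr_gt0.
move=> k; rewrite lt_min ltr_pdivlMr // => /andP[/dP kd ke].
have := cabsD (h (z + k) - h z - c * k) (c * k); rewrite subrK cabsM => H.
by apply: le_lt_trans H _; apply: le_lt_trans ke; rewrite mulrDr mulr1 addrC mulrC lerD2l -[X in _ <= X]mul1r.
Qed.

Lemma ccont_rcont_x h x y : ccont h (pt x y) -> rcont (fun s => h (pt s y)) x.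
Proof.
move=> hc e e0; have [d d0 dP] := hc e e0; exists d => // k kd.
have -> : pt (x + k) y = pt x y + k%:C by rewrite /pt; simpc.
by apply: dP; rewrite cabs_real.
Qed.

Lemma ccont_rcont_y h x y : ccont h (pt x y) -> rcont (fun s => h (pt x s)) y.
Proof.
move=> hc e e0; have [d d0 dP] := hc e e0; exists d => // k kd.
have -> : pt x (y + k) = pt x y + 'i * k%:C by rewrite /pt; simpc.
by apply: dP; rewrite cabsM cabs_i mul1r cabs_real.
Qed.

Lemma hol_cst c z : hol (fun=> c) z.
Proof. by apply/holP; apply: derivable_cst. Qed.

Lemma hol_id z : hol id z.
Proof. by apply/holP; apply: derivable_id. Qed.

Lemma holB f g z : hol f z -> hol g z -> hol (fun t => f t - g t) z.
Proof. by move=> /holP F /holP G; apply/holP; apply: derivableB F G. Qed.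

Lemma holM f g z : hol f z -> hol g z -> hol (fun t => f t * g t) z.
Proof. by move=> /holP F /holP G; apply/holP; apply: derivableM F G. Qed.

Lemma holX f k z : hol f z -> hol (fun t => f t ^+ k) z.
Proof.
move=> hf; elim: k => [|k IH]; first exact: (hol_cst 1).
have -> : (fun t => f t ^+ k.+1) = (fun t => f t * f t ^+ k).
  by apply/funext => t; rewrite exprS.
exact: holM.
Qed.

Lemma holV f z : f z != 0 -> hol f z -> hol (fun t => (f t)^-1) z.
Proof. by move=> fz /holP F; apply/holP; apply: derivableV fz F. Qed.

Lemma hol_near f g z d : 0 < d -> (forall k, cabs k < d -> f (z + k) = g (z + k)) ->
  hol f z -> hol g z.
Proof.
move=> d0 fg [c fc]; exists c => e e0; have [s s0 sP] := fc e e0.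
exists (Num.min d s) => [|k]; first by rewrite lt_min d0.
rewrite lt_min => /andP[kd ks]; rewrite -fg // -[z]addr0 -fg ?cabs0 // addr0.
exact: sP.
Qed.

Lemma prim2_ex d r h : 0 < r -> r < d ->
  (forall x y, `|x| < d -> `|y| < d -> ccont h (pt x y)) ->
  exists Hx Hy, prim2 r h Hx Hy.
Proof.
move=> r0 rd hc.
have /choice[Hx HxP] : forall y, exists G : R -> R[i], `|y| < r ->
    forall x, `|x| < r -> has_rdiff G x (h (pt x y)).
  move=> y; have [yr|] := boolP (`|y| < r); last by exists (fun=> 0).
  have [|G GP] := @complex_primitive _ (fun x => h (pt x y)) r d r0 rd; last by exists G.
  by move=> x xd; apply/ccont_rcont_x/hc => //; apply: lt_trans rd.
have /choice[Hy HyP] : forall x, exists G : R -> R[i], `|x| < r ->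
    forall y, `|y| < r -> has_rdiff G y (h (pt x y)).
  move=> x; have [xr|] := boolP (`|x| < r); last by exists (fun=> 0).
  have [|G GP] := @complex_primitive _ (fun y => h (pt x y)) r d r0 rd; last by exists G.
  by move=> y yd; apply/ccont_rcont_y/hc => //; apply: lt_trans rd.
exists (fun x y => Hx y x), Hy => x y xr yr.
by split; [apply: HxP|apply: HyP].
Qed.

(* Integrals over the boundary of the square [-r, r]^2, as increments of
   primitives along the four sides. *)
Definition bint r h v := exists P1 P2 P3 P4,
  [/\ forall x, `|x| <= r -> has_rdiff P1 x (h (pt x (- r))) /\ has_rdiff P2 x (h (pt r x)),
      forall x, `|x| <= r -> has_rdiff P3 x (h (pt x r)) /\ has_rdiff P4 x (h (pt (- r) x))
    & v = (P1 r - P1 (- r)) + 'i * (P2 r - P2 (- r)) - (P3 r - P3 (- r)) - 'i * (P4 r - P4 (- r))].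

(** The sides are prolonged up to [d]: continuity beyond the corners makes the primitives
    differentiable at the corners. *)
Definition side r d z := exists2 x, `|x| <= d &
  [\/ z = pt x (- r), z = pt r x, z = pt x r | z = pt (- r) x].

Lemma bint_rect d r h Hx Hy : r < d -> 0 < r -> prim2 d h Hx Hy ->
  bint r h (rect Hx Hy (- r) r (- r) r).
Proof.
move=> rd r0 P; have nr : `|r| < d by rewrite gtr0_norm.
have nNr : `|- r| < d by rewrite normrN.
exists (Hx^~ (- r)), (Hy r), (Hx^~ r), (Hy (- r)); split=> // x xr; have xd := le_lt_trans xr rd.
  by have [? _] := P x (- r) xd nNr; have [_ ?] := P r x nr xd.
by have [? _] := P x r xd nr; have [_ ?] := P (- r) x nNr xd.
Qed.

Lemma bint_ex r d h : 0 < r -> r < d -> (forall z, side r d z -> ccont h z) ->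
  exists v, bint r h v.
Proof.
move=> r0 rd hc; have [rs sd] : r < (r + d) / 2 /\ (r + d) / 2 < d by lra.
have s0 : 0 < (r + d) / 2 := lt_trans r0 rs.
have [P1 P1P] := @complex_primitive _ (fun x => h (pt x (- r))) _ d s0 sd
  (fun x xd => ccont_rcont_x (hc _ (ex_intro2 _ _ x (ltW xd) (Or41 _ _ _ erefl)))).
have [P2 P2P] := @complex_primitive _ (fun x => h (pt r x)) _ d s0 sd
  (fun x xd => ccont_rcont_y (hc _ (ex_intro2 _ _ x (ltW xd) (Or42 _ _ _ erefl)))).
have [P3 P3P] := @complex_primitive _ (fun x => h (pt x r)) _ d s0 sd
  (fun x xd => ccont_rcont_x (hc _ (ex_intro2 _ _ x (ltW xd) (Or43 _ _ _ erefl)))).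
have [P4 P4P] := @complex_primitive _ (fun x => h (pt (- r) x)) _ d s0 sd
  (fun x xd => ccont_rcont_y (hc _ (ex_intro2 _ _ x (ltW xd) (Or44 _ _ _ erefl)))).
exists ((P1 r - P1 (- r)) + 'i * (P2 r - P2 (- r)) - (P3 r - P3 (- r)) - 'i * (P4 r - P4 (- r))).
exists P1, P2, P3, P4; split=> // x xr; have xs := le_lt_trans xr rs.
  by split; [apply: P1P|apply: P2P].
by split; [apply: P3P|apply: P4P].
Qed.

Lemma bint_lin r w h g v u : bint r h v -> bint r g u ->
  bint r (fun z => w * h z + g z) (w * v + u).
Proof.
move=> [P1 [P2 [P3 [P4 [A B ->]]]]] [Q1 [Q2 [Q3 [Q4 [A' B' ->]]]]].
exists (fun x => w * P1 x + Q1 x), (fun x => w * P2 x + Q2 x),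
  (fun x => w * P3 x + Q3 x), (fun x => w * P4 x + Q4 x); split.
- by move=> x xr; have [? ?] := A x xr; have [? ?] := A' x xr; split; apply: rdiff_lin.
- by move=> x xr; have [? ?] := B x xr; have [? ?] := B' x xr; split; apply: rdiff_lin.
- ring.
Qed.

Lemma bint_ext r h g v : (forall z, side r r z -> h z = g z) -> bint r h v -> bint r g v.
Proof.
move=> hg [P1 [P2 [P3 [P4 [A B ->]]]]]; exists P1, P2, P3, P4; split=> // x xr.
  have [A1 A2] := A x xr; rewrite -!hg //; exists x => //; [exact: Or42|exact: Or41].
have [A1 A2] := B x xr; rewrite -!hg //; exists x => //; [exact: Or44|exact: Or43].
Qed.

Lemma bint_bound r h v M : 0 < r -> (forall z, side r r z -> cabs (h z) <= M) ->
  bint r h v -> cabs v <= 16 * r * M.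
Proof.
move=> r0 hM [P1 [P2 [P3 [P4 [A B ->]]]]].
have rr : - r <= r by lra.
have nx x : - r <= x <= r -> `|x| <= r by rewrite ler_norml.
have B1 : cabs (P1 r - P1 (- r)) <= 2 * M * (r - - r).
  apply: (rdiff_increment rr (fun x xr => (A x (nx x xr)).1)) => x /nx xr.
  by apply: hM; exists x => //; apply: Or41.
have B2 : cabs (P2 r - P2 (- r)) <= 2 * M * (r - - r).
  apply: (rdiff_increment rr (fun x xr => (A x (nx x xr)).2)) => x /nx xr.
  by apply: hM; exists x => //; apply: Or42.
have B3 : cabs (P3 r - P3 (- r)) <= 2 * M * (r - - r).
  apply: (rdiff_increment rr (fun x xr => (B x (nx x xr)).1)) => x /nx xr.
  by apply: hM; exists x => //; apply: Or43.
have B4 : cabs (P4 r - P4 (- r)) <= 2 * M * (r - - r).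
  apply: (rdiff_increment rr (fun x xr => (B x (nx x xr)).2)) => x /nx xr.
  by apply: hM; exists x => //; apply: Or44.
move: B1 B2 B3 B4; set p1 := P1 r - _; set p2 := P2 r - _; set p3 := P3 r - _; set p4 := P4 r - _.
clear; have := cabsB (p1 + 'i * p2 - p3) ('i * p4).
have := cabsB (p1 + 'i * p2) p3; have := cabsD p1 ('i * p2).
by rewrite !cabsM !cabs_i !mul1r; lra.
Qed.

Lemma bint_unique r h u v : 0 < r -> bint r h u -> bint r h v -> u = v.
Proof.
move=> r0 hu hv; have := bint_bound (M := 0) r0 _ (bint_lin (-1) hu hv).
rewrite mulr0 => B; apply/esym/eqP; rewrite -subr_eq0 -cabs_eq0 eq_le cabs_ge0 andbT.
rewrite addrC -mulN1r; apply: B => z _.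
by rewrite mulN1r addNr cabs0.
Qed.

Lemma bint0 r : bint r (fun=> 0) 0.
Proof.
exists (fun=> 0), (fun=> 0), (fun=> 0), (fun=> 0).
have z x : has_rdiff (fun=> 0) x 0.
  move=> e e0; exists 1 => // k _; rewrite mul0r !subr0 cabs0.
  by rewrite mulr_ge0 // ltW.
by split=> //; rewrite subrr !mulr0 !subr0 addr0.
Qed.

Lemma bint_sum r N (a : nat -> R[i]) (F : nat -> R[i] -> R[i]) (v : nat -> R[i]) :
  (forall k, bint r (F k) (v k)) ->
  bint r (fun z => \sum_(k < N) a k * F k z) (\sum_(k < N) a k * v k).
Proof.
move=> Fv; elim: N => [|N IH].
  by rewrite big_ord0; apply: bint_ext (bint0 r) => z _; rewrite big_ord0.
rewrite big_ord_recr /= addrC; apply: bint_ext (bint_lin (a N) (Fv N) IH) => z _.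
by rewrite big_ord_recr /= addrC.
Qed.

Lemma side_neq r d z : 0 < r -> side r d z -> r <= cabs z.
Proof.
move=> r0 [x _ sz]; have [rz|rz] : `|complex.Re z| = r \/ `|complex.Im z| = r.
- by case: sz => ->; [right|left|right|left]; rewrite /= ?normrN gtr0_norm.
- by rewrite -rz Re_cabs.
- by rewrite -rz Im_cabs.
Qed.

(* All four sides contribute a positive imaginary part. *)
Lemma bint_inv_neq0 r v : 0 < r -> bint r (fun t => t^-1) v -> v != 0.
Proof.
move=> r0 [P1 [P2 [P3 [P4 [A B ->]]]]].
have rr : - r < r by lra.
have nx x : - r <= x <= r -> `|x| <= r by rewrite ler_norml.
have pos u P (q : R -> R[i]) : (forall x, - r <= x <= r -> has_rdiff P x (q x)) ->
    (forall x, 0 < complex.Re (u * q x)) -> 0 < complex.Re (u * (P r - P (- r))).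
  move=> Pq uq; have zd x : has_rdiff (fun=> 0) x 0.
    by move=> e e0; exists 1 => // k _; rewrite mul0r !subr0 cabs0 mulr_ge0 // ltW.
  have D x (xr : - r <= x <= r) := rdiff_Re (rdiff_lin u (Pq x xr) (zd x)).
  have := mean_value_gt0 rr D.
  have -> : complex.Re (u * P r + 0) - complex.Re (u * P (- r) + 0) =
    complex.Re (u * (P r - P (- r))) by rewrite -ReB !addr0 mulrBr.
  by apply=> x _; rewrite addr0.
have D2 x : 0 < x ^+ 2 + r ^+ 2 by rewrite ltr_wpDl ?sqr_ge0 ?exprn_gt0.
have D2' x : 0 < r ^+ 2 + x ^+ 2 by rewrite addrC.
have I1 : 0 < complex.Re (- 'i * (P1 r - P1 (- r))).
  apply: (pos _ _ _ (fun x xr => (A x (nx x xr)).1)) => x.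
  rewrite /= sqrrN; have : 0 < r / (x ^+ 2 + r ^+ 2) by rewrite divr_gt0.
  lra.
have I2 : 0 < complex.Re (1 * (P2 r - P2 (- r))).
  apply: (pos _ _ _ (fun x xr => (A x (nx x xr)).2)) => x.
  rewrite mul1r /=; by rewrite divr_gt0.
have I3 : 0 < complex.Re ('i * (P3 r - P3 (- r))).
  apply: (pos _ _ _ (fun x xr => (B x (nx x xr)).1)) => x.
  rewrite /=; have : 0 < r / (x ^+ 2 + r ^+ 2) by rewrite divr_gt0.
  lra.
have I4 : 0 < complex.Re (-1 * (P4 r - P4 (- r))).
  apply: (pos _ _ _ (fun x xr => (B x (nx x xr)).2)) => x.
  rewrite mulN1r /= sqrrN; have : 0 < r / (r ^+ 2 + x ^+ 2) by rewrite divr_gt0.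
  lra.
apply/eqP => /(congr1 (fun z => complex.Re (- 'i * z))).
move: I1 I2 I3 I4; move: (P1 r - _) (P2 r - _) (P3 r - _) (P4 r - _) => [a1 b1] [a2 b2] [a3 b3] [a4 b4].
by rewrite /=; lra.
Qed.

End Cauchy.

(** * Taylor polynomials of holomorphic functions *)

Section HolomorphicTaylor.
Variable R : realType.
Implicit Types (x y d e r M a b : R) (z w t u v c : R[i]) (f g h : R[i] -> R[i]).
Local Open Scope complex_scope.
Local Open Scope classical_set_scope.

Lemma rcont_bounded (phi : R -> R[i]) r d : 0 < r -> r < d ->
  (forall x, `|x| < d -> rcont phi x) -> exists M, forall x, `|x| <= r -> cabs (phi x) <= M.
Proof.
move=> r0 rd pc; have rr : - r <= r by lra.
have gc : {within `[(- r), r], continuous (fun x => cabs (phi x))}.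
  apply: continuous_in_subspaceT => x; rewrite inE /= in_itv /= => xr.
  have xd : `|x| < d by apply: le_lt_trans rd; rewrite ler_norml.
  apply/cvgrPdist_lt => e e0; have [s s0 sP] := pc x xd e e0.
  apply/nbhs_ballP; exists s => // y; rewrite /ball /= => xy.
  have := sP (y - x); rewrite [`|y - x|]distrC [x + (y - x)]addrC subrK => /(_ xy).
  have := cabsD (phi y - phi x) (phi x); have := cabsD (phi x - phi y) (phi y).
  rewrite !subrK [cabs (phi x - _)]cabs_distC => H1 H2 H3.
  by rewrite ltr_norml; apply/andP; lra.
have [c _ cP] := EVT_max rr gc.
by exists (cabs (phi c)) => x; rewrite ler_norml => xr; apply: cP; rewrite in_itv.
Qed.

Lemma side_bounded f r d : 0 < r -> r < d -> (forall z, side r d z -> ccont f z) ->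
  exists M, forall z, side r r z -> cabs (f z) <= M.
Proof.
move=> r0 rd fc.
have [M1 P1] := @rcont_bounded (fun x => f (pt x (- r))) r d r0 rd
  (fun x xd => ccont_rcont_x (fc _ (ex_intro2 _ _ x (ltW xd) (Or41 _ _ _ erefl)))).
have [M2 P2] := @rcont_bounded (fun x => f (pt r x)) r d r0 rd
  (fun x xd => ccont_rcont_y (fc _ (ex_intro2 _ _ x (ltW xd) (Or42 _ _ _ erefl)))).
have [M3 P3] := @rcont_bounded (fun x => f (pt x r)) r d r0 rd
  (fun x xd => ccont_rcont_x (fc _ (ex_intro2 _ _ x (ltW xd) (Or43 _ _ _ erefl)))).
have [M4 P4] := @rcont_bounded (fun x => f (pt (- r) x)) r d r0 rd
  (fun x xd => ccont_rcont_y (fc _ (ex_intro2 _ _ x (ltW xd) (Or44 _ _ _ erefl)))).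
exists (`|M1| + `|M2| + `|M3| + `|M4|) => z [x xr [] ->].
- by have := P1 x xr; have := ler_norm M1; have := normr_ge0 M2; have := normr_ge0 M3; have := normr_ge0 M4; lra.
- by have := P2 x xr; have := ler_norm M2; have := normr_ge0 M1; have := normr_ge0 M3; have := normr_ge0 M4; lra.
- by have := P3 x xr; have := ler_norm M3; have := normr_ge0 M1; have := normr_ge0 M2; have := normr_ge0 M4; lra.
- by have := P4 x xr; have := ler_norm M4; have := normr_ge0 M1; have := normr_ge0 M2; have := normr_ge0 M3; lra.
Qed.

Lemma horner_bounded (p : {poly R[i]}) : exists2 M, 0 <= M &
  forall z, cabs z <= 1 -> cabs p.[z] <= M.
Proof.
exists (\sum_(i < size p) cabs p`_i); first by apply: sumr_ge0 => i _; apply: cabs_ge0.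
move=> z z1; rewrite horner_coef; apply: le_trans (cabs_sum _ _ _) _.
apply: ler_sum => i _; rewrite cabsM cabsX ler_piMr ?cabs_ge0 //.
by rewrite exprn_ile1 ?cabs_ge0.
Qed.

Lemma dvd_Xn_coef (p : {poly R[i]}) N : (forall k, (k < N)%N -> p`_k = 0) ->
  exists q, p = q * 'X^N.
Proof.
move=> p0; exists (drop_poly N p); rewrite -[LHS](poly_take_drop N).
suff -> : take_poly N p = 0 by rewrite add0r.
by apply/polyP => k; rewrite coef_take_poly coef0; case: ltnP => // /p0.
Qed.

(** The integral of dt / (t - z) is not evaluated as 2 pi i but expanded in powers of z, with
    coefficients [w] and nonzero constant term. Cauchy's formula then presents f as a quotient of
    two expansions, and its Taylor polynomial is a truncation of the quotient series. *)
Lemma taylor_quotient f (v w : nat -> R[i]) N d M : w 0%N != 0 -> 0 < d -> (0 < N)%N ->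
  (forall z, cabs z < d ->
    cabs (f z * (\sum_(k < N) z ^+ k * w k) - \sum_(k < N) z ^+ k * v k) <= M * cabs z ^+ N) ->
  exists (q : {poly R[i]}) M' d', 0 < d' /\
    forall z, cabs z < d' -> cabs (f z - q.[z]) <= M' * cabs z ^+ N.
Proof.
move=> w0 d0 N0 fP.
pose W : fps R[i] := Fps w; pose Q := Fps v / W.
have WU : W \is a GRing.unit by rewrite fps_unitE.
pose q := \poly_(k < N) fcoef Q k; pose pw := \poly_(k < N) w k; pose pv := \poly_(k < N) v k.
have [s qwE] : exists s, q * pw - pv = s * 'X^N.
  apply: dvd_Xn_coef => k kN; rewrite coefB coefM [pv`_k]coef_poly kN.
  have -> : v k = fcoef (Q * W) k by rewrite /Q mulrVK.
  rewrite fcoefM -sumrB big1 // => i _; rewrite !coef_poly.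
  by rewrite (leq_ltn_trans (leq_ord i) kN) (leq_ltn_trans (leq_subr _ _) kN) subrr.
have wE z : pw.[z] = \sum_(k < N) z ^+ k * w k.
  by rewrite horner_poly; apply: eq_bigr => k _; rewrite mulrC.
have vE z : pv.[z] = \sum_(k < N) z ^+ k * v k.
  by rewrite horner_poly; apply: eq_bigr => k _; rewrite mulrC.
have [p1 p1E] : exists p1, pw - (w 0%N)%:P = p1 * 'X^1.
  by apply: dvd_Xn_coef => -[|//] _; rewrite coefB coefC coef_poly N0 subrr.
have [Ms Ms0 sM] := horner_bounded s; have [Mw Mw0 wM] := horner_bounded p1.
have cw : 0 < cabs (w 0%N) by rewrite cabs_gt0.
(* The last radius keeps [pw] at least half of its value at 0 in modulus, so dividing by it costs at
   most the factor 2 / |w 0|. [Ms] accounts for the tail of q pw - pv. *)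
exists q, ((M + Ms) * (2 / cabs (w 0%N))), (Num.min (Num.min d 1) (cabs (w 0%N) / (2 * (Mw + 1)))).
have Mw1 : 0 < 2 * (Mw + 1) by lra.
split=> [|z]; first by rewrite !lt_min d0 ltr01 divr_gt0.
rewrite !lt_min ltr_pdivlMr // => /andP[/andP[zd z1] zw].
have z1' := ltW z1; have zc := cabs_ge0 z.
have pwz : cabs (w 0%N) / 2 <= cabs pw.[z].
  have := congr1 (fun p => p.[z]) p1E; rewrite /= !hornerE => E.
  have := cabsB pw.[z] (pw.[z] - w 0%N).
  have -> : pw.[z] - (pw.[z] - w 0%N) = w 0%N by ring.
  rewrite E cabsM.
  have := wM z z1' => wz; have : cabs p1.[z] * cabs z <= Mw * cabs z by rewrite ler_wpM2r.
  nra.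
have pw0 : pw.[z] != 0 by rewrite -cabs_gt0; apply: lt_le_trans pwz; rewrite divr_gt0.
have := congr1 (fun p => p.[z]) qwE; rewrite /= !hornerE => E.
have fE : f z - q.[z] = ((f z * pw.[z] - pv.[z]) - (q.[z] * pw.[z] - pv.[z])) / pw.[z].
  by field.
rewrite fE E cabsM cabsV ler_pdivrMr ?cabs_gt0 //.
apply: le_trans (cabsB _ _) _; rewrite cabsM cabsX.
have := fP z zd; rewrite -wE -vE => H1.
have H2 : cabs s.[z] * cabs z ^+ N <= Ms * cabs z ^+ N by rewrite ler_wpM2r ?exprn_ge0 ?sM.
have zN : 0 <= cabs z ^+ N by rewrite exprn_ge0.
have MN : 0 <= M * cabs z ^+ N by apply: le_trans H1; apply: cabs_ge0.
apply: le_trans (lerD H1 H2) _; rewrite -mulrDl /=.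
have -> : (M + Ms) * 2 / cabs (w 0%N) * cabs z ^+ N * cabs pw.[z] =
  ((M + Ms) * cabs z ^+ N) * (cabs pw.[z] / (cabs (w 0%N) / 2)) by field; rewrite gt_eqF.
apply: ler_peMr; first by rewrite mulrDl addr_ge0 // mulr_ge0.
by rewrite ler_pdivlMr ?mul1r // divr_gt0.
Qed.

Lemma geometric_expansion z t N : t != 0 -> t - z != 0 ->
  (t - z)^-1 = \sum_(k < N) z ^+ k * (t ^+ k.+1)^-1 + z ^+ N * (t ^+ N * (t - z))^-1.
Proof.
move=> t0 tz; elim: N => [|N IH]; first by rewrite big_ord0 !expr0 add0r !mul1r.
rewrite big_ord_recr /= IH -addrA; congr (_ + _).
by rewrite !exprS; field; rewrite t0 tz expf_neq0.
Qed.

(** When [c] is the derivative at [u] this is continuous at [u], and it is holomorphic at the other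
    points where [f] is: the situation of [goursat_punctured]. *)
Definition diff_quotient f c u t := if t == u then c else (f t - f u) / (t - u).

Lemma diff_quotient_hol f c u t : t != u -> hol f t -> hol (diff_quotient f c u) t.
Proof.
move=> tu ft; have tu0 : 0 < cabs (t - u) by rewrite cabs_gt0 subr_eq0.
apply: (hol_near (f := fun s => (f s - f u) * (s - u)^-1) tu0) => [k kt|].
  rewrite /diff_quotient; case: eqP => // tk; move: kt.
  by rewrite -tk opprD addrA subrr sub0r cabsN ltxx.
apply: holM; first by apply: holB => //; apply: hol_cst.
apply: holV; first by rewrite subr_eq0.
by apply: holB; [apply: hol_id|apply: hol_cst].
Qed.

Lemma diff_quotient_ccont f c u : has_cdiff f u c -> ccont (diff_quotient f c u) u.
Proof.
move=> fc e e0; have [d d0 dP] := fc (e / 2) (divr_gt0 e0 (ltr0Sn R 1)); exists d => // k kd.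
rewrite /diff_quotient eqxx; case: eqP => [_|/eqP uk]; first by rewrite subrr cabs0.
have k0 : k != 0 by apply: contra uk => /eqP ->; rewrite addr0.
have -> : u + k - u = k by ring.
have -> : (f (u + k) - f u) / k - c = (f (u + k) - f u - c * k) / k by field.
rewrite cabsM cabsV ltr_pdivrMr ?cabs_gt0 //; apply: le_lt_trans (dP k kd) _.
by rewrite ltr_pM2r ?cabs_gt0 //; lra.
Qed.

Theorem holomorphic_taylor f d0 N : 0 < d0 -> (forall z, cabs z < d0 -> hol f z) ->
  exists (q : {poly R[i]}) M d, 0 < d /\
    forall z, cabs z < d -> cabs (f z - q.[z]) <= M * cabs z ^+ N.+1.
Proof.
(* The square of half side [d] lies in the disc of radius [d0]. The contour has half side [r], and
   [r'] leaves room between the two. *)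
move=> d00 fh; pose d := d0 / 2; pose r := d / 2; pose r' := (r + d) / 2.
have [r0 [rr' [r'd d0']]] : 0 < r /\ r < r' /\ r' < d /\ 0 < d by rewrite /r' /r /d; lra.
have inD x y : `|x| < d -> `|y| < d -> cabs (pt x y) < d0.
  by move=> xd yd; apply: le_lt_trans (cabs_pt _ _) _; rewrite /d in xd yd; lra.
have sideD z : side r r' z -> cabs z < d0.
  have rd : `|r| < d by rewrite gtr0_norm //; lra.
  by move=> [x xr [] ->]; apply: inD; rewrite ?normrN //; apply: le_lt_trans xr r'd.
have side0 z : side r r' z -> z != 0.
  by move=> /(side_neq r0) rz; rewrite -cabs_gt0; apply: lt_le_trans rz.
have fs z : side r r' z -> hol f z by move=> /sideD/fh.
have sI z : side r r z -> side r r' z.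
  by move=> [x xr zE]; exists x => //; apply: le_trans xr (ltW rr').
have hX k z : z != 0 -> hol (fun t => (t ^+ k)^-1) z.
  by move=> z0; apply: holV; [rewrite expf_neq0|apply/holX/hol_id].
have /choice[v vP] : forall k, exists v, bint r (fun t => f t * (t ^+ k.+1)^-1) v.
  move=> k; apply: (bint_ex r0 rr') => z sz; apply: hol_ccont.
  by apply: holM; [apply: fs|apply: hX; apply: side0].
have /choice[w wP] : forall k, exists w, bint r (fun t => (t ^+ k.+1)^-1) w.
  move=> k; apply: (bint_ex r0 rr') => z sz; apply: hol_ccont.
  by apply: hX; apply: side0.
have w0 : w 0%N != 0.
  apply: (bint_inv_neq0 r0); apply: bint_ext (wP 0%N) => z _.
  by rewrite expr1.
have [Mf MfP] := side_bounded r0 rr' (fun z sz => hol_ccont (fs z sz)).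
have z00 : cabs (0 : R[i]) < d0 by rewrite cabs0.
have [s s0 sP] := hol_ccont (fh 0 z00) ltr01.
(* Lower bound of |t^(N + 1) (t - z)| on the contour for |z| < r / 2, as |t| is at least [r]
   there. *)
pose K := r ^+ N.+1 * (r / 2).
have K0 : 0 < K by rewrite mulr_gt0 ?exprn_gt0 ?divr_gt0.
have Mf0 : 0 <= Mf.
  apply: le_trans (cabs_ge0 (f (pt r r))) (MfP _ _).
  by exists r; [rewrite gtr0_norm|apply: Or42].
apply: (@taylor_quotient f v w N.+1 (Num.min s (r / 2))
  (16 * r * (Mf / K) + (cabs (f 0) + 1) * (16 * r * K^-1))) => //.
  by rewrite lt_min s0 divr_gt0.
move=> z; rewrite lt_min => /andP[zs zr].
have fz : cabs (f z) <= cabs (f 0) + 1.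
  have := sP z zs; rewrite add0r; have := cabsD (f z - f 0) (f 0); rewrite subrK; lra.
have tz t : side r r' t -> r / 2 <= cabs (t - z).
  move=> /(side_neq r0) rt; have := cabsD (t - z) z; rewrite subrK; lra.
have tz0 t : side r r' t -> t - z != 0.
  by move=> /tz rt; rewrite -cabs_gt0; apply: lt_le_trans rt; rewrite divr_gt0.
have remh t : side r r' t -> hol (fun t => (t ^+ N.+1 * (t - z))^-1) t.
  move=> st; apply: holV; first by rewrite mulf_neq0 ?expf_neq0 ?tz0 ?side0.
  apply: holM; first by apply/holX/hol_id.
  by apply: holB; [apply: hol_id|apply: hol_cst].
have [al alP] : exists al, bint r (fun t => f t * (t ^+ N.+1 * (t - z))^-1) al.
  by apply: (bint_ex r0 rr') => t st; apply: hol_ccont; apply: holM; [apply: fs|apply: remh].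
have [be beP] : exists be, bint r (fun t => (t ^+ N.+1 * (t - z))^-1) be.
  by apply: (bint_ex r0 rr') => t st; apply: hol_ccont; apply: remh.
have remB t : side r r t -> cabs (t ^+ N.+1 * (t - z))^-1 <= K^-1.
  move=> /sI st; rewrite cabsV lef_pV2 ?posrE ?cabs_gt0 ?mulf_neq0 ?expf_neq0 ?tz0 ?side0 //.
  rewrite cabsM cabsX; apply: ler_pM; rewrite ?exprn_ge0 ?(ltW r0) ?tz //; first by lra.
  by apply: lerXn2r; rewrite ?nnegrE ?cabs_ge0 ?(ltW r0) //; apply: (side_neq r0 st).
have alB : cabs al <= 16 * r * (Mf / K).
  apply: (bint_bound r0 _ alP) => t st; rewrite cabsM.
  by apply: ler_pM; rewrite ?cabs_ge0 ?MfP ?remB //; apply: sI.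
have beB : cabs be <= 16 * r * K^-1 by apply: (bint_bound r0 _ beP) => t st; apply: remB.
have zd0 : cabs z < d0 by rewrite /r /d in zr r0; lra.
have [c fc] := fh z zd0; pose G := diff_quotient f c z.
have [x0 [y0 zE]] : exists x0 y0, z = pt x0 y0 by case: z {zs zr fz tz tz0 remh al alP be beP remB alB beB zd0 fc G} => a b; exists a, b.
(* Cauchy's formula: the difference quotient of [f] at [z] has integral zero over the contour. *)
have G0 : bint r G 0.
  have Gc x y : `|x| < d -> `|y| < d -> ccont G (pt x y).
    move=> xd yd; have [->|nz] := eqVneq (pt x y) z; first exact: diff_quotient_ccont.
    by apply/hol_ccont/diff_quotient_hol => //; apply/fh/inD.
  have [|Hx [Hy P]] := prim2_ex _ r'd Gc; first exact: lt_trans r0 rr'.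
  have [x0r y0r] : `|x0| < r /\ `|y0| < r.
    have := Re_cabs z; have := Im_cabs z; rewrite {1 3}zE /=; lra.
  have [e e0 eP] := diff_quotient_ccont fc ltr01.
  rewrite -(@goursat_punctured _ r' r G Hx Hy x0 y0 (cabs c + 1) (e / 2) P rr' x0r y0r).
  - exact: bint_rect rr' r0 P.
  - move=> x y xr yr; rewrite -zE => nz; apply: diff_quotient_hol => //.
    by apply/fh/inD; [apply: lt_trans xr r'd|apply: lt_trans yr r'd].
  - by rewrite divr_gt0.
  move=> x y xe ye; have := eP (pt x y - z); rewrite [z + _]addrC subrK.
  have -> : diff_quotient f c z z = c by rewrite /diff_quotient eqxx.
  have zxy : cabs (pt x y - z) < e.
    by rewrite zE pt_sub; apply: le_lt_trans (cabs_pt _ _) _; lra.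
  move=> /(_ zxy) H; have := cabsD (G (pt x y) - c) c; rewrite subrK /G; lra.
(* Integration of the finite geometric expansion of 1 / (t - z), alone and multiplied by f(t); [be]
   and [al] are the integrals of the remainders. *)
have S := bint_lin (- f z) (bint_lin (z ^+ N.+1) beP (bint_sum N.+1 (fun k => z ^+ k) wP))
  (bint_lin (z ^+ N.+1) alP (bint_sum N.+1 (fun k => z ^+ k) vP)).
have E : 0 = - f z * (z ^+ N.+1 * be + \sum_(k < N.+1) z ^+ k * w k) +
    (z ^+ N.+1 * al + \sum_(k < N.+1) z ^+ k * v k).
  apply: (bint_unique r0 G0); apply: bint_ext S => t /sI st.
  have tz' : t != z by rewrite -subr_eq0 tz0.
  rewrite /G /diff_quotient (negbTE tz') [in RHS]mulrBl.
  have := geometric_expansion N.+1 (side0 t st) (tz0 t st) => ->.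
  have -> : \sum_(k < N.+1) z ^+ k * (f t * (t ^+ k.+1)^-1) =
            f t * \sum_(k < N.+1) z ^+ k * (t ^+ k.+1)^-1.
    by rewrite mulr_sumr; apply: eq_bigr => k _; rewrite mulrCA.
  ring.
have -> : f z * (\sum_(k < N.+1) z ^+ k * w k) - \sum_(k < N.+1) z ^+ k * v k =
    (al - f z * be) * z ^+ N.+1.
  by apply/eqP; rewrite -subr_eq0 -oppr_eq0; apply/eqP; rewrite [RHS]E; ring.
rewrite cabsM cabsX ler_wpM2r ?exprn_ge0 ?cabs_ge0 //.
apply: le_trans (cabsB _ _) (lerD alB _).
by rewrite cabsM ler_pM ?cabs_ge0.
Qed.

End HolomorphicTaylor.

(** * Taylor expansion of smooth functions *)

Section RealTaylor.
Variable R : realType.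
Implicit Types (x y e rho M : R).
Local Open Scope complex_scope.
Local Open Scope classical_set_scope.

Lemma has_diffB (f g : R -> R) x c c' : has_diff f x c -> has_diff g x c' ->
  has_diff (fun y => f y - g y) x (c - c').
Proof. by move=> /has_diff_is_derive F /has_diff_is_derive G; apply/has_diff_is_derive; apply: is_deriveB. Qed.

Lemma taylor_le N (h : nat -> R -> R) M rho :
  (forall m y, `|y| <= rho -> has_diff (h m) y (h m.+1 y)) ->
  (forall y, `|y| <= rho -> `|h N y| <= M) ->
  forall y, `|y| <= rho -> `|h 0%N y - \sum_(j < N) h j 0 / j`!%:R * y ^+ j| <= M * `|y| ^+ N.
Proof.
elim: N h => [|N IH] h hd hM y yr; first by rewrite big_ord0 subr0 expr0 mulr1 hM.
have IH' := IH (fun m => h m.+1) (fun m y yr => hd m.+1 y yr) hM.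
pose p N (h : nat -> R -> R) := \poly_(j < N) (h j 0 / j`!%:R).
have pE m (g : nat -> R -> R) z : \sum_(j < m) g j 0 / j`!%:R * z ^+ j = (p m g).[z] by rewrite horner_poly.
have dp : deriv (p N.+1 h) = p N (fun m => h m.+1).
  apply/polyP => j; rewrite coef_deriv !coef_poly ltnS; case: ltnP => // _; last by rewrite mul0rn.
  rewrite factS natrM -mulr_natr; field.
  by rewrite pnatr_eq0 -lt0n fact_gt0 /= addrC natr1 pnatr_eq0.
pose phi z := h 0%N z - (p N.+1 h).[z].
have phi0 : phi 0 = 0.
  rewrite /phi horner_coef0 coef_poly /= fact0 divr1 subrr.
  by [].
have phid z : `|z| <= rho -> has_diff phi z (h 1%N z - (p N (fun m => h m.+1)).[z]).
  move=> zr; apply: has_diffB; first exact: hd.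
  by apply/has_diff_is_derive; rewrite -dp; apply: is_derive_poly.
have M0 : 0 <= M by apply: le_trans (normr_ge0 _) (hM y yr).
have phiM z : `|z| <= `|y| -> `|h 1%N z - (p N (fun m => h m.+1)).[z]| <= M * `|y| ^+ N.
  move=> zy; rewrite -pE; apply: le_trans (IH' z (le_trans zy yr)) _.
  by rewrite ler_wpM2l // lerXn2r ?nnegrE.
rewrite pE -/(phi y) exprSr mulrA.
have [y0|y0] := leP 0 y.
  have zin z : 0 <= z <= y -> `|z| <= `|y| by move=> /andP[z0 zy]; rewrite !ger0_norm.
  have := mean_value_le y0 (fun z zy => phid z (le_trans (zin z zy) yr)) (fun z zy => phiM z (zin z zy)).
  by rewrite phi0 !subr0 => H; rewrite [X in _ <= _ * X]ger0_norm.
have zin z : y <= z <= 0 -> `|z| <= `|y|.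
  by move=> /andP[yz z0]; rewrite !ler0_norm ?lerN2 // ltW.
have := mean_value_le (ltW y0) (fun z zy => phid z (le_trans (zin z zy) yr)) (fun z zy => phiM z (zin z zy)).
by rewrite phi0 !sub0r normrN => H; rewrite [X in _ <= _ * X]ltr0_norm.
Qed.

Variables (n : nat) (r : 'rV[R[i]]_n -> R) (p : 'rV[R[i]]_n).
Notation RIdx := (prod (ordinal n) bool).
Hypothesis r_smooth : smooth_near r p.
Implicit Types (c : RIdx -> R) (L s : seq RIdx).

Definition disp L c : 'rV[R[i]]_n := p + \sum_(k <- L) (c k)%:C *: rdir R k.

Lemma rdir_le1 (k : RIdx) j : cabs (rdir R k 0 j) <= 1.
Proof.
rewrite /rdir !mxE eqxx /=; case: (_ == _); last by rewrite mulr0 cabs0.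
by rewrite mulr1; case: (k.2); rewrite ?cabs_i ?cabs1.
Qed.

Lemma disp_ball L c rho e : (forall k, `|c k| <= rho) -> (size L)%:R * rho < e ->
  cball p e (disp L c).
Proof.
move=> cr Le j; rewrite /disp mxE addrAC subrr add0r; apply: le_lt_trans Le.
rewrite summxE; apply: le_trans (cabs_sum _ _ _) _.
elim: L => [|k L IH]; first by rewrite big_nil mul0r.
rewrite big_cons [size _]/= -natr1 mulrDl mul1r addrC lerD // mxE cabsM cabs_real.
by rewrite -[rho]mulr1 ler_pM ?cabs_ge0 ?rdir_le1.
Qed.

(** The expansion is made in one coordinate direction after the other, each exponent staying below
    [N] separately, as in the sums over [mindex]. [s] records the derivatives already taken. *)
Fixpoint box_taylor N c L s : R := if L is k :: L' then
    \sum_(j < N) box_taylor N c L' (nseq j k ++ s) / j`!%:R * c k ^+ j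
  else iter_rpartial s r p.

Lemma min_pos (d : nat -> R) m : (forall j, 0 < d j) ->
  exists2 e, 0 < e & forall j, (j < m)%N -> e <= d j.
Proof.
move=> d0; elim: m => [|m [e e0 eP]]; first by exists 1.
exists (Num.min e (d m)) => [|j]; first by rewrite lt_min e0 d0.
rewrite ltnS leq_eqVlt => /orP[/eqP ->|/eP ej]; first by rewrite ge_min lexx orbT.
by rewrite ge_min ej.
Qed.

Lemma has_diff_line s (k : RIdx) (z q : 'rV[R[i]]_n) y :
  rpartial_exists k (iter_rpartial s r) z -> z = q + y%:C *: rdir R k ->
  has_diff (fun y => iter_rpartial s r (q + y%:C *: rdir R k)) y (iter_rpartial (k :: s) r z).
Proof.
rewrite /rpartial_exists => dz zE.
have : has_diff (fun h : R => iter_rpartial s r (z + h%:C *: rdir R k)) 0 (iter_rpartial (k :: s) r z).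
  by apply/has_diff_is_derive; rewrite /= /rpartial derive1E; apply: derivableP.
move=> H d d0; have [t t0 tP] := H d d0; exists t; first exact: t0.
move=> h ht.
have := tP h ht; rewrite add0r scale0r addr0.
by rewrite zE rmorphD scalerDl addrA.
Qed.

Lemma box_taylor_le N L s : exists M d, [/\ 0 <= M, 0 < d & forall rho c, rho < d ->
  (forall k, `|c k| <= rho) ->
  `|iter_rpartial s r (disp L c) - box_taylor N c L s| <= M * rho ^+ N].
Proof.
have [e e0 eP] := r_smooth.
elim: L s => [|k L IH] s.
  exists 0, 1; split=> // rho c _ _.
  by rewrite /disp big_nil addr0 /= subrr normr0 mul0r.
have /choice[Md MdP] : forall j : nat, exists Md : R * R, [/\ 0 <= Md.1, 0 < Md.2 &
    forall rho c, rho < Md.2 -> (forall k, `|c k| <= rho) ->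
    `|iter_rpartial (nseq j k ++ s) r (disp L c) - box_taylor N c L (nseq j k ++ s)|
      <= Md.1 * rho ^+ N].
  by move=> j; have [M [d]] := IH (nseq j k ++ s); exists (M, d).
have [d1 d10 d1P] := @min_pos (fun j => (Md j).2) N (fun j => let: And3 _ x _ := MdP j in x).
have pb : cball p e p by move=> j; rewrite subrr cabs0.
(* Continuity at [p] bounds the [N]-th derivative in direction [k] by |D p| + 1 nearby, which
   controls the Taylor remainder. *)
have [/(_ 1 ltr01)[d2 d20 d2P] _] := eP p pb (nseq N k ++ s).
set D := iter_rpartial (nseq N k ++ s) r in d2P.
pose sz : R := (size L).+2%:R.
have sz0 : 0 < sz by rewrite ltr0n.
pose d := Num.min (Num.min 1 d1) (Num.min (e / sz) (d2 / sz)).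
have d0 : 0 < d by rewrite /d !lt_min ltr01 d10 !divr_gt0.
exists ((`|D p| + 1) + \sum_(j < N) (Md j).1), d; split=> //.
  apply: addr_ge0; first by rewrite addr_ge0.
  by apply: sumr_ge0 => j _; have [] := MdP j.
move=> rho c; rewrite !lt_min => /andP[/andP[rho1 rhod1] /andP[rhoe rhod2]] cr.
have rho0 : 0 <= rho by apply: le_trans (normr_ge0 _) (cr k).
pose h m y := iter_rpartial (nseq m k ++ s) r (disp L c + y%:C *: rdir R k).
have inb t y : 0 < t -> rho < t / sz -> `|y| <= rho -> cball p t (disp L c + y%:C *: rdir R k).
  move=> t0 rt yr j; rewrite ltr_pdivlMr // in rt.
  have sL : (size L)%:R * rho < t - rho.
    by rewrite ltrBrDr -[X in _ + X]mul1r -mulrDl natr1; apply: le_lt_trans rt; rewrite mulrC ler_wpM2l // ler_nat.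
  have B := disp_ball cr sL j.
  have -> : (disp L c + y%:C *: rdir R k) 0 j = disp L c 0 j + y%:C * rdir R k 0 j.
    by rewrite mxE [(_ *: rdir R k) 0 j]mxE.
  have -> : forall u v w : R[i], u + v - w = (u - w) + v by move=> *; ring.
  apply: le_lt_trans (cabsD _ _) _; rewrite -[t](subrK rho) ltr_leD //.
  by rewrite cabsM cabs_real -[rho]mulr1 ler_pM ?cabs_ge0 // rdir_le1.
have hd m y : `|y| <= rho -> has_diff (h m) y (h m.+1 y).
  move=> yr; have [_ /(_ k) ex] := eP _ (inb e y e0 rhoe yr) (nseq m k ++ s).
  exact: has_diff_line ex erefl.
have hM y : `|y| <= rho -> `|h N y| <= `|D p| + 1.
  move=> yr; have := d2P _ (inb d2 y d20 rhod2 yr); rewrite -/(h N y) => /ltW H.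
  by rewrite -[h N y](subrK (D p)) addrC; apply: le_trans (ler_normD _ _) (lerD _ H).
have T1 := taylor_le hd hM (cr k).
have -> : disp (k :: L) c = disp L c + (c k)%:C *: rdir R k.
  by rewrite /disp big_cons addrA addrAC.
rewrite [iter_rpartial s r _]/(h 0%N (c k)) /=.
rewrite -[X in `|X|](subrKA (\sum_(j < N) h j 0 / j`!%:R * c k ^+ j)).
apply: le_trans (ler_normD _ _) _; rewrite mulrDl lerD //.
  apply: le_trans T1 _; rewrite ler_wpM2l ?addr_ge0 // lerXn2r ?nnegrE //.
rewrite -sumrB mulr_suml; apply: le_trans (ler_norm_sum _ _ _) _.
apply: ler_sum => j _; rewrite -mulrBl -mulrBl !normrM.
have [M0 _ MP] := MdP j; have rj : rho < (Md j).2.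
  by apply: lt_le_trans rhod1 _; apply: d1P.
have := MP rho c rj cr; rewrite /h scale0r addr0 => H.
rewrite -mulrA -[X in _ <= X]mulr1 ler_pM //.
rewrite normfV normrX mulr_ile1 ?invr_ge0 ?exprn_ge0 //.
  have j1 : (1 : R) <= j`!%:R by rewrite ler1n fact_gt0.
  by rewrite ger0_norm ?ler0n // invf_le1 // (lt_le_trans ltr01 j1).
by apply: exprn_ile1 => //; apply: le_trans (cr k) (ltW rho1).
Qed.

Definition supported_on N L (g : {ffun RIdx -> 'I_N.+1}) :=
  [forall k, (k \notin L) ==> (g k == ord0)].

Lemma box_taylorE N c L s : uniq L -> box_taylor N.+1 c L s =
  \sum_(g : {ffun RIdx -> 'I_N.+1} | supported_on L g)
     iter_rpartial (flatten [seq nseq (g k) k | k <- rev L] ++ s) r p *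
     \prod_(k <- L) (c k ^+ g k / (g k)`!%:R).
Proof.
elim: L s => [|k L IH] s /=.
  move=> _; rewrite (big_pred1 [ffun=> ord0]) ?big_nil ?mulr1 // => g.
  apply/forallP/eqP => [g0|-> k]; last by rewrite ffunE eqxx implybT.
  by apply/ffunP => k; rewrite ffunE; have := g0 k; rewrite in_nil => /eqP.
move=> /andP[kL uL]; rewrite [RHS](partition_big (fun g : {ffun RIdx -> 'I_N.+1} => g k) predT) //=.
apply: eq_bigr => j _; rewrite (IH _ uL) mulr_suml mulr_suml.
pose upd (h : {ffun RIdx -> 'I_N.+1}) j := [ffun u => if u == k then j else h u].
rewrite [RHS](reindex_onto (upd^~ j) (upd^~ ord0)) /=; last first.
  move=> g /andP[_ /eqP gk]; apply/ffunP => u; rewrite !ffunE.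
  by case: eqP => // ->.
apply: eq_big => [h|h hP].
  apply/forallP/andP => [h0|[/andP[/forallP h0 _] /eqP hE] u].
    have hk : h k = ord0 by have := h0 k; rewrite kL => /eqP.
    split; last by apply/eqP/ffunP => u; rewrite !ffunE; case: eqP => // ->.
    rewrite ffunE eqxx eqxx andbT; apply/forallP => u; rewrite ffunE inE negb_or.
    by case: eqP => //= _; apply: h0.
  apply/implyP => xL; have [xk|xk] := eqVneq u k.
    by rewrite -hE ffunE xk eqxx.
  by have := h0 u; rewrite inE negb_or xk xL ffunE (negbTE xk).
have hx (u : RIdx) : u \in L -> upd h j u = h u.
  by move=> xL; rewrite ffunE; case: eqP => // xk; move: kL; rewrite -xk xL.
rewrite big_cons ffunE eqxx rev_cons map_rcons -cats1 flatten_cat /= cats0 ffunE eqxx -catA.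
have -> : [seq nseq (upd h j u) u | u <- rev L] = [seq nseq (h u) u | u <- rev L].
  by apply/eq_in_map => u; rewrite mem_rev => /hx ->.
have -> : \prod_(u <- L) (c u ^+ upd h j u / (upd h j u)`!%:R) =
    \prod_(u <- L) (c u ^+ h u / (h u)`!%:R).
  by apply: eq_big_seq => u /hx ->.
ring.
Qed.

Theorem real_taylor N : exists M d, [/\ 0 <= M, 0 < d & forall rho c, rho < d ->
  (forall k, `|c k| <= rho) ->
  `|r (p + \sum_k (c k)%:C *: rdir R k) -
    \sum_(g : mindex n N) taylor_coef r p g * \prod_k c k ^+ g k| <= M * rho ^+ N.+1].
Proof.
(* Each expansion prepends its direction to the word of derivatives, so the directions are taken in
   reversed order to produce the words [mindex_seq g]. *)
have [M [d [M0 d0 MP]]] := box_taylor_le N.+1 (rev (enum {: RIdx})) [::].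
exists M, d; split=> // rho c rd cr; have := MP rho c rd cr.
rewrite box_taylorE ?rev_uniq ?enum_uniq // /disp.
rewrite (perm_big (enum {: RIdx})) /=; last by rewrite perm_rev.
rewrite big_enum /=; congr (`|_ - _| <= _); apply: eq_big => [g|g _].
  by apply/forallP => k; rewrite mem_rev mem_enum.
rewrite cats0 revK /taylor_coef -mulrA; congr (_ * _).
rewrite (perm_big (enum {: RIdx})) /=; last by rewrite perm_rev.
by rewrite big_enum /= big_split /= natr_prod prodfV mulrC.
Qed.

End RealTaylor.

(** * Composition with formal curves *)

Section FormalComposition.
Variables (R : realType) (n : nat).
Local Open Scope complex_scope.
Notation C := R[i].
Notation RIdx := (prod (ordinal n) bool).
Implicit Types (a b : nat) (al be : mon n) (v w : mon n -> C) (s : seq RIdx).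

(* Power series in t and conj t, as series in t over series in conj t. *)
Definition fcoef2 (F : fps (fps C)) a b : C := fcoef (fcoef F a) b.
Definition of_ps2 (F : nat -> nat -> C) : fps (fps C) := Fps (fun a => Fps (F a)).

Lemma fcoef2M (F G : fps (fps C)) a b : fcoef2 (F * G) a b =
  \sum_(i < a.+1) \sum_(j < b.+1) fcoef2 F i j * fcoef2 G (a - i) (b - j).
Proof. by rewrite /fcoef2 fcoefM fcoef_sum. Qed.

Lemma fcoef2D (F G : fps (fps C)) a b : fcoef2 (F + G) a b = fcoef2 F a b + fcoef2 G a b.
Proof. by []. Qed.

Lemma fcoef2N (F : fps (fps C)) a b : fcoef2 (- F) a b = - fcoef2 F a b.
Proof. by []. Qed.

Definition fpsC2 (c : C) : fps (fps C) := fpsC (fpsC c).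

Lemma fcoef2C c F a b : fcoef2 (fpsC2 c * F) a b = c * fcoef2 F a b.
Proof. by rewrite /fcoef2 !fcoefCM. Qed.

Definition hol_part (f : fps C) : fps (fps C) := Fps (fun a => fpsC (fcoef f a)).
Definition antihol_part (f : fps C) : fps (fps C) :=
  fpsC (Fps (fun b => (fcoef f b)^*)).

Lemma hol_partM f g : hol_part (f * g) = hol_part f * hol_part g.
Proof.
apply: fpsP => a; apply: fpsP => b; rewrite fcoefM fcoef_sum.
under eq_bigr do rewrite fcoefCM /=.
by rewrite /= -sumrMnl; apply: eq_bigr => i _; rewrite mulrnAr.
Qed.

Lemma hol_part1 : hol_part 1 = 1.
Proof.
by apply: fpsP => a; apply: fpsP => b; case: a b => [|a] [|b].
Qed.

Lemma antihol_partM f g : antihol_part (f * g) = antihol_part f * antihol_part g.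
Proof.
apply: fpsP => a; rewrite fcoefCM; case: a => [|a]; last first.
  by rewrite -[LHS]/(0 : fps C) -[fcoef (antihol_part g) _]/(0 : fps C) mulr0.
apply: fpsP => b; rewrite -[LHS]/((fcoef (f * g) b)^*) [RHS]fcoefM fcoefM rmorph_sum /=.
by apply: eq_bigr => i _; rewrite rmorphM.
Qed.

Lemma antihol_part1 : antihol_part 1 = 1.
Proof.
apply: fpsP => a; apply: fpsP => b.
case: a b => [|a] [|b]; [exact: conjc1|exact: conjc0|by []|by []].
Qed.

Lemma fcoef2_hol_antihol f g a b :
  fcoef2 (hol_part f * antihol_part g) a b = fcoef f a * (fcoef g b)^*.
Proof.
by rewrite mulrC /fcoef2 /antihol_part fcoefCM mulrC fcoefCM.
Qed.

Variable zeta : formal_curve R n.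

(** The constant term is dropped: this is zeta_j - p_j. *)
Definition curve_fps (j : 'I_n) : fps C := Fps (fun m => if m is 0%N then 0 else zeta j m).
Definition curve_mon al : fps C := \prod_j curve_fps j ^+ al j.
(* the functional [phi |-> [t^a] phi (zeta - p)] on polynomials *)
Definition curve_functional a al := fcoef (curve_mon al) a.

Lemma curve_mon0 : curve_mon (mon0 n) = 1.
Proof. by rewrite /curve_mon big1 // => j _; rewrite ffunE expr0. Qed.

Lemma curve_mon_minc j al : curve_mon (minc j al) = curve_fps j * curve_mon al.
Proof.
rewrite /curve_mon [LHS](bigD1 j) //= [in RHS](bigD1 j) //= ffunE eqxx addn1 exprS -mulrA.
congr (_ * (_ * _)); apply: eq_bigr => k /negbTE kj.
by rewrite ffunE kj addn0.
Qed.

(* [T al be] is the value of a functional on [z^al * conj z^be]; [coord_op k] is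
   the transpose of multiplication by the real coordinate [k]. *)
Definition coord_op (k : RIdx) (T : mon n -> mon n -> C) : mon n -> mon n -> C :=
  fun al be => if k.2 then (T (minc k.1 al) be - T al (minc k.1 be)) / (2 * 'i)
               else (T (minc k.1 al) be + T al (minc k.1 be)) / 2.

Definition hop s T := foldr coord_op T s.
(** [v] tensor the conjugate of [w], evaluated on the product of the real coordinates listed in [s];
    [mon0] stands for the monomial 1. *)
Definition hform s v w := hop s (fun al be => v al * (w be)^*) (mon0 n) (mon0 n).

Lemma hop_lin s c T T' al be :
  hop s (fun al be => c * T al be + T' al be) al be = c * hop s T al be + hop s T' al be.
Proof.
elim: s al be => [|k s IH] al be //=; rewrite /coord_op !IH.
by case: (k.2); ring.
Qed.

Lemma hop_eq0 s T M al be : (forall al be, (M < mdeg al + mdeg be)%N -> T al be = 0) ->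
  (M < size s + mdeg al + mdeg be)%N -> hop s T al be = 0.
Proof.
move=> T0; elim: s al be => [|k s IH] al be /= Ms; first exact: T0.
rewrite /coord_op !IH ?mdeg_minc ?addnS // -?addnS -?addSn //.
by rewrite subrr addr0 !mul0r; case: (k.2).
Qed.

Definition rcoord2 (k : RIdx) := of_ps2 (formal_rcoord zeta k).

Lemma rcoord2E k : rcoord2 k =
  if k.2 then fpsC2 (2 * 'i)^-1 * (hol_part (curve_fps k.1) - antihol_part (curve_fps k.1))
  else fpsC2 2^-1 * (hol_part (curve_fps k.1) + antihol_part (curve_fps k.1)).
Proof.
apply: fpsP => a; apply: fpsP => b.
rewrite -[LHS]/(formal_rcoord zeta k a b) -[RHS]/(fcoef2 _ a b) /formal_rcoord.
have hE f : fcoef2 (hol_part f) a b = fcoef f a *+ (b == 0)%N by [].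
have aE f : fcoef2 (antihol_part f) a b = if a is 0%N then (fcoef f b)^* else 0.
  by case: (a).
case: (k.2); rewrite fcoef2C fcoef2D ?fcoef2N hE aE; case: a b {hE aE} => [|a] [|b];
  rewrite [RHS]mulrC ?mulr1n ?mulr0n ?conjc0 ?oppr0 ?addr0 ?add0r ?mul0r //.
Qed.

(** For functionals given by a curve, multiplying by a coordinate before evaluation is multiplying
    the series by that coordinate along the curve. This links the Hermitian form with
    [formal_comp]. *)
Lemma hop_curve s a b al be :
  hop s (fun al be => curve_functional a al * (curve_functional b be)^*) al be =
  fcoef2 (\prod_(k <- s) rcoord2 k * (hol_part (curve_mon al) * antihol_part (curve_mon be))) a b.
Proof.
elim: s al be => [|k s IH] al be; first by rewrite big_nil mul1r fcoef2_hol_antihol.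
rewrite /= /coord_op !IH big_cons !curve_mon_minc hol_partM antihol_partM rcoord2E.
case: (k.2); rewrite [LHS]mulrC -?fcoef2N -fcoef2D -fcoef2C; congr fcoef2; ring.
Qed.

Lemma hform_curve s a b :
  hform s (curve_functional a) (curve_functional b) = fcoef2 (\prod_(k <- s) rcoord2 k) a b.
Proof. by rewrite /hform hop_curve curve_mon0 hol_part1 antihol_part1 !mulr1. Qed.

Lemma of_ps2M F G : of_ps2 (ps2_mul F G) = of_ps2 F * of_ps2 G.
Proof.
apply: fpsP => a; apply: fpsP => b.
by rewrite -[RHS]/(fcoef2 _ a b) fcoef2M.
Qed.

Lemma of_ps2_1 : of_ps2 (@ps2_one R) = 1.
Proof.
by apply: fpsP => a; apply: fpsP => b; case: a b => [|a] [|b].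
Qed.

Lemma formal_monomialE N (g : mindex n N) :
  of_ps2 (formal_monomial zeta g) = \prod_(k : RIdx) rcoord2 k ^+ g k.
Proof.
rewrite /formal_monomial -big_enum /=; elim: (enum _) => [|k s IH] /=.
  by rewrite big_nil of_ps2_1.
rewrite big_cons of_ps2M IH; congr (_ * _).
rewrite /ps2_exp; elim: (nat_of_ord (g k)) => [|m IHm] /=; first by rewrite of_ps2_1 expr0.
by rewrite of_ps2M IHm exprS.
Qed.

Lemma prod_mindex_seq N (g : mindex n N) :
  \prod_(k <- mindex_seq g) rcoord2 k = \prod_(k : RIdx) rcoord2 k ^+ g k.
Proof.
rewrite /mindex_seq big_flatten /= big_map -big_enum /=.
by apply: eq_bigr => k _; rewrite big_nseq; elim: (nat_of_ord _) => //= m ->; rewrite exprS.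
Qed.

Lemma curve_mon_ord al k : (k < mdeg al)%N -> fcoef (curve_mon al) k = 0.
Proof.
elim/mon_ind: al k => [|j al IH] k; first by rewrite mdeg0.
rewrite mdeg_minc ltnS curve_mon_minc fcoefM big_ord_recl /= mul0r add0r => ka.
by rewrite big1 // => i _; rewrite IH ?mulr0 // (leq_trans _ ka) // ltn_subrL /= (leq_ltn_trans _ (ltn_ord i)).
Qed.

Lemma curve_functional_bdeg a : bdeg a (curve_functional a).
Proof. by move=> al; apply: curve_mon_ord. Qed.

End FormalComposition.

(** * The Hermitian form of the Taylor series *)

Section HermitianForm.
Variables (R : realType) (n : nat) (r : 'rV[R[i]]_n -> R) (p : 'rV[R[i]]_n).
Local Open Scope complex_scope.
Notation C := R[i].
Notation RIdx := (prod (ordinal n) bool).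
Implicit Types (v w : mon n -> C).

Definition nseq_word (g : RIdx -> nat) := flatten [seq nseq (g k) k | k <- enum {: RIdx}].

Lemma size_nseq_word g : size (nseq_word g) = (\sum_k g k)%N.
Proof.
rewrite /nseq_word size_flatten /shape -map_comp sumnE big_map big_enum /=.
by apply: eq_bigr => k _; rewrite size_nseq.
Qed.

(* The functional [v] in [z - p] tensor the conjugate of [w] in its conjugate,
   applied to the Taylor polynomial of [r]. *)
Definition herm N v w : C :=
  \sum_(g : mindex n N) (taylor_coef r p g)%:C * hform (mindex_seq g) v w.

Definition taylor_nat (g : RIdx -> nat) : R :=
  iter_rpartial (nseq_word g) r p / (\prod_k (g k)`!)%:R.

Lemma sum_mindex_widen N N' (F : {ffun RIdx -> nat} -> C) : (N <= N')%N ->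
  (forall g : {ffun RIdx -> nat}, (exists k, (N < g k)%N) -> F g = 0) ->
  \sum_(g : mindex n N') F [ffun k => g k : nat] = \sum_(g : mindex n N) F [ffun k => g k : nat].
Proof.
move=> NN F0; rewrite (bigID (fun g : mindex n N' => [forall k, (g k <= N)%N])) /= addrC big1 ?add0r.
  rewrite (reindex_onto (fun g : mindex n N => [ffun k => inord (g k)] : mindex n N')
    (fun g => [ffun k => inord (g k)])) /=.
    apply: eq_big => [g|g _]; last first.
      by congr F; apply/ffunP => k; rewrite !ffunE inordK // ltnS (leq_trans (leq_ord _) NN).
    apply/andP; split; first by apply/forallP => k; rewrite ffunE inordK ?leq_ord // ltnS (leq_trans (leq_ord _) NN).
    apply/eqP/ffunP => k; rewrite !ffunE; apply: val_inj; rewrite /= !inordK //;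
      by rewrite ltnS (leq_trans (leq_ord _) NN).
  move=> g /forallP gN; apply/ffunP => k; rewrite !ffunE; apply: val_inj.
  by rewrite /= !inordK // ltnS.
move=> g /forallPn[k kN]; apply: F0; exists k.
by rewrite ffunE ltnNge.
Qed.

(** Words longer than the joint degree of [v] and [w] contribute nothing, so every sufficiently
    large truncation gives the form of the full Taylor series. *)
Lemma herm_widen N N' v w M : (N <= N')%N -> (M <= N)%N ->
  (forall al be, (M < mdeg al + mdeg be)%N -> v al * (w be)^* = 0) ->
  herm N' v w = herm N v w.
Proof.
move=> NN MN vw0; pose F (g : {ffun RIdx -> nat}) := (taylor_nat g)%:C * hform (nseq_word g) v w.
have E N1 : herm N1 v w = \sum_(g : mindex n N1) F [ffun k => g k : nat].
  apply: eq_bigr => g _.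
  have wE : nseq_word [ffun k => g k : nat] = mindex_seq g.
    by rewrite /nseq_word; congr flatten; apply: eq_map => k; rewrite ffunE.
  rewrite /F wE /taylor_nat wE; congr (_%:C * _); congr (_ / _%:R).
  by apply: eq_bigr => k _; rewrite ffunE.
rewrite !E; apply: sum_mindex_widen => // g [k kN].
rewrite /F /hform (hop_eq0 vw0) ?mulr0 // mdeg0 !addn0 size_nseq_word.
by apply: leq_ltn_trans MN _; apply: leq_trans kN _; rewrite (bigD1 k) //= leq_addr.
Qed.

Lemma formal_compE zeta a b :
  formal_comp r p zeta a b = herm (a + b) (curve_functional zeta a) (curve_functional zeta b).
Proof.
apply: eq_bigr => g _; congr (_ * _); rewrite hform_curve prod_mindex_seq.
by rewrite -formal_monomialE.
Qed.

Lemma herm_linl N c v v' w :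
  herm N (fun al => c * v al + v' al) w = c * herm N v w + herm N v' w.
Proof.
rewrite /herm mulr_sumr -big_split /=; apply: eq_bigr => g _.
rewrite mulrCA -mulrDr; congr (_ * _); rewrite /hform -hop_lin.
by congr (hop _ _ _ _); apply/funext => al; apply/funext => be; ring.
Qed.

Lemma herm_linr N c v w w' :
  herm N v (fun al => c * w al + w' al) = c^* * herm N v w + herm N v w'.
Proof.
rewrite /herm mulr_sumr -big_split /=; apply: eq_bigr => g _.
rewrite mulrCA -mulrDr; congr (_ * _); rewrite /hform -hop_lin.
congr (hop _ _ _ _); apply/funext => al; apply/funext => be.
by rewrite rmorphD rmorphM; ring.
Qed.

Lemma formal_comp_herm zeta N a b : (a + b <= N)%N ->
  herm N (curve_functional zeta a) (curve_functional zeta b) = formal_comp r p zeta a b.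
Proof.
move=> abN; rewrite formal_compE; apply: (@herm_widen _ _ _ _ (a + b)) => // al be ab.
have [aal|ala] := ltnP a (mdeg al); first by rewrite curve_functional_bdeg ?mul0r.
have bbe : (b < mdeg be)%N by rewrite -(ltn_add2l a) (leq_trans ab) // leq_add2r.
have -> : curve_functional zeta b be = 0 by apply: curve_functional_bdeg.
by rewrite [X in _ * X]conjc0 mulr0.
Qed.

End HermitianForm.

(** * Expansions in t and its conjugate *)

Section Expansions.
Variable R : realType.
Local Open Scope complex_scope.
Notation C := R[i].
Local Notation cj := (@conjc R).
Implicit Types (f g h : C -> C) (F G : fps (fps C)) (Q : {poly {poly C}}) (t : C) (N k : nat).

Definition bigO k f := exists M d, [/\ 0 <= M, 0 < d &
  forall t, cabs t < d -> cabs (f t) <= M * cabs t ^+ k].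

Lemma bigOD k f g : bigO k f -> bigO k g -> bigO k (fun t => f t + g t).
Proof.
move=> [M [d [M0 d0 fM]]] [M' [d' [M'0 d'0 gM]]]; exists (M + M'), (Num.min d d').
split=> [||t]; [exact: addr_ge0|by rewrite lt_min d0|].
rewrite lt_min => /andP[td td']; apply: le_trans (cabsD _ _) _.
by rewrite mulrDl lerD ?fM ?gM.
Qed.

Lemma bigOM k l f g : bigO k f -> bigO l g -> bigO (k + l) (fun t => f t * g t).
Proof.
move=> [M [d [M0 d0 fM]]] [M' [d' [M'0 d'0 gM]]]; exists (M * M'), (Num.min d d').
split=> [||t]; [exact: mulr_ge0|by rewrite lt_min d0|].
rewrite lt_min => /andP[td td']; rewrite cabsM exprD mulrACA.
by rewrite ler_pM ?cabs_ge0 ?fM ?gM.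
Qed.

Lemma bigO_le k l f : (k <= l)%N -> bigO l f -> bigO k f.
Proof.
move=> kl [M [d [M0 d0 fM]]]; exists M, (Num.min d 1); split=> // [|t].
  by rewrite lt_min d0 ltr01.
rewrite lt_min => /andP[td t1]; apply: le_trans (fM t td) _.
by rewrite ler_wpM2l // ler_wiXn2l ?cabs_ge0 // ltW.
Qed.

Lemma bigO_eq k f g : (forall t, f t = g t) -> bigO k f -> bigO k g.
Proof. by move=> fg; have -> : g = f by apply/funext => t; rewrite fg. Qed.

Lemma bigO0 k : bigO k (fun=> 0).
Proof. by exists 0, 1; split=> // t _; rewrite cabs0 mul0r. Qed.

Lemma bigO_cst c : bigO 0 (fun=> c).
Proof. by exists (cabs c), 1; split=> [||t _]; rewrite ?cabs_ge0 // expr0 mulr1. Qed.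

Lemma bigO_sum (I : Type) (s : seq I) (P : pred I) k (f : I -> C -> C) :
  (forall i, P i -> bigO k (f i)) -> bigO k (fun t => \sum_(i <- s | P i) f i t).
Proof.
move=> fO; elim: s => [|i s IH].
  by apply: bigO_eq (bigO0 k) => t; rewrite big_nil.
have [Pi|nPi] := boolP (P i).
  by apply: bigO_eq (bigOD (fO i Pi) IH) => t; rewrite big_cons Pi.
by apply: bigO_eq IH => t; rewrite big_cons (negbTE nPi).
Qed.

Lemma bigO_tmon a b : bigO (a + b) (fun t => t ^+ a * cj t ^+ b).
Proof.
exists 1, 1; split=> // t _; rewrite cabsM !cabsX cabs_conj -exprD mul1r.
by [].
Qed.

(** The outer variable is t and the inner one conj t, in the order of [fcoef2]. *)
Definition ev2 Q t : C := (Q.[t%:P]).[cj t].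

Lemma ev2D Q Q' t : ev2 (Q + Q') t = ev2 Q t + ev2 Q' t.
Proof. by rewrite /ev2 !hornerD. Qed.

Lemma ev2M Q Q' t : ev2 (Q * Q') t = ev2 Q t * ev2 Q' t.
Proof. by rewrite /ev2 !hornerM. Qed.

Lemma ev2E Q : exists m, (forall a b, (m <= a)%N || (m <= b)%N -> Q`_a`_b = 0) /\
  forall t, ev2 Q t = \sum_(i < m) \sum_(j < m) Q`_i`_j * (t ^+ i * cj t ^+ j).
Proof.
pose m := maxn (size Q) (\max_(i < size Q) size (Q`_i)%R).
have Qa a : (m <= a)%N -> Q`_a = 0.
  by move=> ma; rewrite nth_default // (leq_trans (leq_maxl _ _) ma).
have Qb a : (size (Q`_a)%R <= m)%N.
  have [aQ|Qa'] := ltnP a (size Q); last by rewrite nth_default ?size_poly0.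
  by rewrite leq_max (leq_trans _ (leq_bigmax (Ordinal aQ))) ?orbT.
exists m; split=> [a b /orP[/Qa ->|mb]|t]; first by rewrite coef0.
  by rewrite nth_default // (leq_trans (Qb a)).
rewrite /ev2 (@horner_coef_wide _ m Q) ?leq_maxl // horner_sum; apply: eq_bigr => i _.
rewrite -polyC_exp hornerM hornerC (@horner_coef_wide _ m Q`_i) ?Qb // mulr_suml.
by apply: eq_bigr => j _; rewrite -mulrA [X in _ * X]mulrC.
Qed.

Lemma ev2_bounded Q : bigO 0 (ev2 Q).
Proof.
have [m [_ QE]] := ev2E Q.
apply: bigO_eq (fun t => esym (QE t)) _.
apply: bigO_sum => i _; apply: bigO_sum => j _.
apply: (@bigO_le 0 (i + j)) => //.
exact: (bigOM (bigO_cst _) (bigO_tmon i j)).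
Qed.

(** The quotients w / conj w with w = 1 + i y are pairwise distinct, so [q] has more roots than its
    degree allows. *)
Lemma ray_roots_eq0 (q : {poly C}) : (forall w : C, w != 0 -> q.[w / cj w] = 0) -> q = 0.
Proof.
move=> q0; apply: contrapT => /eqP qn0.
pose w (y : nat) : C := 1 +i* y%:R.
have w0 y : w y != 0 by rewrite eq_complex /= oner_eq0.
have w0' y : cj (w y) != 0 by rewrite conjc_eq0.
pose s := [seq w y / cj (w y) | y <- iota 0 (size q)].
have us : uniq s.
  rewrite map_inj_in_uniq ?iota_uniq // => y z _ _ /eqP.
  rewrite eqr_div // => /eqP /(congr1 (@complex.Im R)) /= E.
  by apply/eqP; rewrite -(eqr_nat R); apply/eqP; move: E; lra.
have rs : all (root q) s.
  by apply/allP => _ /mapP[y _ ->]; rewrite rootE q0.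
have := max_poly_roots qn0 rs us.
by rewrite size_map size_iota ltnn.
Qed.

(** Induction on the total degree [j]. The homogeneous part of degree [j] is O(|t|^(j + 1)), yet
    scales by x^j under real x, so it vanishes identically. Divided by conj(w)^j it is a polynomial
    in w / conj w, and [ray_roots_eq0] kills its coefficients. *)
Lemma ev2_bigO_coef0 Q k : bigO k (ev2 Q) -> forall a b, (a + b < k)%N -> Q`_a`_b = 0.
Proof.
move=> QO; suff H j : (j < k)%N -> forall a b, (a + b = j)%N -> Q`_a`_b = 0.
  by move=> a b ab; apply: (H (a + b)%N).
elim/ltn_ind: j => j IH jk.
have [m [Q0 QE]] := ev2E Q.
pose S t := \sum_(i < m) \sum_(l < m | (i + l == j)%N) Q`_i`_l * (t ^+ i * cj t ^+ l).
have SO : bigO j.+1 S.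
  have -> : S = fun t => ev2 Q t + \sum_(i < m) \sum_(l < m | (i + l != j)%N)
      - (Q`_i`_l * (t ^+ i * cj t ^+ l)).
    apply/funext => t; rewrite QE -big_split /=; apply: eq_bigr => i _.
    by rewrite [X in _ = X + _](bigID (fun l : 'I_m => (i + l == j)%N)) /= sumrN addrK.
  apply: bigOD; first exact: bigO_le QO.
  apply: bigO_sum => i _; apply: bigO_sum => l ilj.
  have [il|] := leqP (i + l)%N j.
    have il' : (i + l < j)%N by rewrite ltn_neqAle ilj.
    apply: bigO_eq (bigO0 _) => t.
    by rewrite (IH _ il' (ltn_trans il' jk) _ _ erefl) mul0r oppr0.
  move=> jil; apply: bigO_le jil _.
  apply: bigO_eq (bigOM (bigO_cst (- Q`_i`_l)) (bigO_tmon i l)) => t.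
  by rewrite mulNr.
have S0 w : S w = 0.
  have [M [d [M0 d0 MP]]] := SO; apply/eqP; rewrite -cabs_eq0 eq_le cabs_ge0 andbT.
  apply/ler_addgt0Pr => e e0; rewrite add0r.
  have w1 : 0 < cabs w + 1 by rewrite ltr_wpDl ?cabs_ge0.
  have Mw : 0 < M * cabs w ^+ j.+1 + 1 by rewrite ltr_wpDl // mulr_ge0 // exprn_ge0 ?cabs_ge0.
  pose x := Num.min (d / 2 / (cabs w + 1)) (e / (M * cabs w ^+ j.+1 + 1)).
  have x0 : 0 < x by rewrite lt_min !divr_gt0.
  have xd : x * cabs w < d.
    apply: (@le_lt_trans _ _ (d / 2)); last by lra.
    apply: (@le_trans _ _ (x * (cabs w + 1))); first by rewrite ler_wpM2l ?lerDl // ltW.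
    by rewrite -ler_pdivlMr // /x ge_min lexx.
  have SE : S (x%:C * w) = x%:C ^+ j * S w.
    rewrite /S mulr_sumr; apply: eq_bigr => i _; rewrite mulr_sumr; apply: eq_bigr => l /eqP <-.
    have -> : cj (x%:C * w) = x%:C * cj w.
      by case: (w) => u v; apply/eqP; rewrite eq_complex /=; apply/andP; split; apply/eqP; ring.
    by rewrite !exprMn exprD; ring.
  have := MP (x%:C * w); rewrite SE !cabsM !cabsX cabs_real (gtr0_norm x0) => /(_ xd).
  have -> : M * (x * cabs w) ^+ j.+1 = x ^+ j * (x * (M * cabs w ^+ j.+1)).
    by rewrite exprMn [x ^+ j.+1]exprSr; ring.
  rewrite ler_pM2l ?exprn_gt0 // => H.
  apply: le_trans H _.
  have : x * (M * cabs w ^+ j.+1 + 1) <= e by rewrite -ler_pdivlMr // /x ge_min lexx orbT.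
  by rewrite mulrDr mulr1; lra.
pose q : {poly C} := \sum_(i < m) \sum_(l < m | (i + l == j)%N) Q`_i`_l *: 'X^i.
have q0 : q = 0.
  apply: ray_roots_eq0 => w w0; have cw0 : cj w != 0 by rewrite conjc_eq0.
  apply: (mulfI (expf_neq0 j cw0)); rewrite mulr0 -(S0 w) /q /S horner_sum mulr_sumr.
  apply: eq_bigr => i _; rewrite horner_sum mulr_sumr; apply: eq_bigr => l /eqP <-.
  by rewrite hornerZ hornerXn exprD expr_div_n; field; rewrite expf_neq0.
move=> a b abj; have [/Q0 //|] := boolP ((m <= a)%N || (m <= b)%N).
rewrite negb_or -!ltnNge => /andP[am bm].
have := congr1 (fun q : {poly C} => q`_a) q0; rewrite /= coef0 /q coef_sum.
rewrite (bigD1 (Ordinal am)) //= [X in _ + X]big1 ?addr0; last first.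
  move=> i ia; rewrite coef_sum big1 // => l _; rewrite coefZ coefXn.
  suff -> : (a == i :> nat) = false by rewrite mulr0.
  by apply: contraNF ia => /eqP ai; apply/eqP/val_inj.
rewrite coef_sum (big_pred1 (Ordinal bm)) /=.
  by rewrite coefZ coefXn eqxx mulr1.
move=> l; rewrite -abj eqn_add2l.
by apply/eqP/eqP => [lb|->//]; apply: val_inj.
Qed.

(** [F] is the expansion of [f] in t and conj t up to total order [N]; its higher coefficients are
    unconstrained, which makes the relation stable under products. *)
Definition has_exp N f F := exists Q,
  (forall a b, (a + b <= N)%N -> Q`_a`_b = fcoef2 F a b) /\
  bigO N.+1 (fun t => f t - ev2 Q t).

Lemma has_exp_bigO N f g F : has_exp N g F -> bigO N.+1 (fun t => f t - g t) -> has_exp N f F.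
Proof.
move=> [Q [QF gQ]] fg; exists Q; split=> //.
by apply: bigO_eq (bigOD fg gQ) => t; rewrite addrA subrK.
Qed.

Lemma has_exp_eq N f g F : (forall t, f t = g t) -> has_exp N f F -> has_exp N g F.
Proof. by move=> fg; have -> : g = f by apply/funext => t; rewrite fg. Qed.

Lemma has_expD N f g F G : has_exp N f F -> has_exp N g G ->
  has_exp N (fun t => f t + g t) (F + G).
Proof.
move=> [Q [QF fQ]] [Q' [Q'G gQ']]; exists (Q + Q'); split=> [a b ab|].
  by rewrite !coefD QF // Q'G.
by apply: bigO_eq (bigOD fQ gQ') => t; rewrite ev2D; ring.
Qed.

Lemma has_expM N f g F G : has_exp N f F -> has_exp N g G ->
  has_exp N (fun t => f t * g t) (F * G).
Proof.
move=> [Q [QF fQ]] [Q' [Q'G gQ']]; exists (Q * Q'); split=> [a b ab|].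
  rewrite coefM coef_sum fcoef2M; apply: eq_bigr => i _; rewrite coefM.
  have ia := leq_ord i; apply: eq_bigr => j _; have jb := leq_ord j.
  rewrite QF ?Q'G //; first by apply: leq_trans ab; apply: leq_add; apply: leq_subr.
  by apply: leq_trans ab; apply: leq_add.
have gO : bigO 0 g.
  apply: bigO_eq (bigOD (bigO_le (leq0n _) gQ') (ev2_bounded Q')) => t.
  by rewrite subrK.
have O1 := bigOM fQ gO; have O2 := bigOM (ev2_bounded Q) gQ'; rewrite addn0 in O1; rewrite add0n in O2.
by apply: bigO_eq (bigOD O1 O2) => t; rewrite ev2M; ring.
Qed.

Lemma has_expC N c : has_exp N (fun=> c) (fpsC2 c).
Proof.
exists (c%:P%:P); split=> [a b _|].
  by rewrite coefC; case: a b => [|a] [|b]; rewrite /= ?coefC ?coef0.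
by apply: bigO_eq (bigO0 _) => t; rewrite /ev2 !hornerC subrr.
Qed.

Lemma fpsC2_1 : fpsC2 (1 : C) = 1.
Proof. by apply: fpsP => a; apply: fpsP => b; case: a b => [|a] [|b]. Qed.

Lemma has_expX N f F m : has_exp N f F -> has_exp N (fun t => f t ^+ m) (F ^+ m).
Proof.
move=> fF; elim: m => [|m IH]; first by rewrite expr0 -fpsC2_1; apply: has_expC.
rewrite exprS; apply: has_exp_eq (has_expM fF IH) => t.
by rewrite exprS.
Qed.

Lemma has_exp_prod N (I : Type) (s : seq I) (f : I -> C -> C) (F : I -> fps (fps C)) :
  (forall i, has_exp N (f i) (F i)) ->
  has_exp N (fun t => \prod_(i <- s) f i t) (\prod_(i <- s) F i).
Proof.
move=> fF; elim: s => [|i s IH].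
  by rewrite big_nil -fpsC2_1; apply: has_exp_eq (has_expC _ _) => t; rewrite big_nil.
by rewrite big_cons; apply: has_exp_eq (has_expM (fF i) IH) => t; rewrite big_cons.
Qed.

Lemma has_exp_sum N (I : Type) (s : seq I) (f : I -> C -> C) (F : I -> fps (fps C)) :
  (forall i, has_exp N (f i) (F i)) ->
  has_exp N (fun t => \sum_(i <- s) f i t) (\sum_(i <- s) F i).
Proof.
have z : has_exp N (fun=> 0) 0.
  have -> : (0 : fps (fps C)) = fpsC2 0.
    by apply: fpsP => a; apply: fpsP => b; case: a b => [|a] [|b].
  exact: has_expC.
move=> fF; elim: s => [|i s IH].
  by rewrite big_nil; apply: has_exp_eq z => t; rewrite big_nil.
by rewrite big_cons; apply: has_exp_eq (has_expD (fF i) IH) => t; rewrite big_cons.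
Qed.

Lemma has_exp_coef0 N f F k : has_exp N f F -> (k <= N.+1)%N -> bigO k f ->
  forall a b, (a + b < k)%N -> fcoef2 F a b = 0.
Proof.
move=> [Q [QF fQ]] kN fO a b ab; rewrite -QF; last by rewrite -ltnS (leq_trans ab kN).
apply: (ev2_bigO_coef0 _ ab).
have nO : bigO k (fun t => -1 * (f t - ev2 Q t)).
  by have := bigOM (bigO_cst (-1)) (bigO_le kN fQ).
by apply: bigO_eq (bigOD fO nO) => t; ring.
Qed.

Lemma has_exp_vanish N f F : has_exp N f F ->
  (forall a b, (a + b <= N)%N -> fcoef2 F a b = 0) -> bigO N.+1 f.
Proof.
move=> [Q [QF fQ]] F0; have [m [_ QE]] := ev2E Q.
have QO : bigO N.+1 (ev2 Q).
  apply: bigO_eq (fun t => esym (QE t)) _; apply: bigO_sum => i _; apply: bigO_sum => j _.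
  have [ij|ij] := leqP (i + j)%N N.
    by apply: bigO_eq (bigO0 _) => t; rewrite QF // F0 // mul0r.
  exact: bigO_le ij (bigOM (bigO_cst _) (bigO_tmon i j)).
by apply: bigO_eq (bigOD fQ QO) => t; rewrite subrK.
Qed.

End Expansions.

(** * Expansion of r along a holomorphic curve *)

Section PullbackExpansion.
Variables (R : realType) (n : nat) (r : 'rV[R[i]]_n -> R) (p : 'rV[R[i]]_n).
Local Open Scope complex_scope.
Notation C := R[i].
Notation RIdx := (prod (ordinal n) bool).
Local Notation cj := (@conjc R).

Lemma vanishes_to_bigO (f : C -> R) k : vanishes_to f k <-> bigO k (fun t => (f t)%:C).
Proof.
split=> [[M [d d0 fM]]|[M [d [M0 d0 fM]]]].
  exists `|M|, d; split=> // t /fM; rewrite cabs_real => H; apply: le_trans H _.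
  by rewrite ler_wpM2r ?exprn_ge0 ?cabs_ge0 ?ler_norm.
by exists M, d => // t /fM; rewrite cabs_real.
Qed.

Definition poly_curve (q : 'I_n -> {poly C}) : formal_curve R n := fun j m => (q j)`_m.

Lemma has_exp_hol N (f : C -> C) (c : C) (q : {poly C}) (F : fps C) :
  bigO N.+1 (fun t => f t - q.[t]) ->
  (forall m, fcoef F m = if m is 0%N then 0 else q`_m) -> q`_0 = c ->
  has_exp N (fun t => f t - c) (hol_part F).
Proof.
move=> fq FE q0; exists (map_poly polyC (q - c%:P)); split=> [a b _|].
  rewrite coef_map coefC /fcoef2 /= coefB coefC FE.
  by case: a b => [|a] [|b] /=; rewrite ?mulr0n ?mulr1n ?q0 ?subrr ?subr0.
by apply: bigO_eq fq => t; rewrite /ev2 horner_map hornerC !hornerE; ring.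
Qed.

Lemma bigO_conj k (f : C -> C) : bigO k f -> bigO k (fun t => cj (f t)).
Proof.
move=> [M [d [M0 d0 fM]]]; exists M, d; split=> // t /fM.
by rewrite [cabs (cj _)]cabs_conj.
Qed.

Lemma has_exp_antihol N (f : C -> C) (c : C) (q : {poly C}) (F : fps C) :
  bigO N.+1 (fun t => f t - q.[t]) ->
  (forall m, fcoef F m = if m is 0%N then 0 else q`_m) -> q`_0 = c ->
  has_exp N (fun t => cj (f t - c)) (antihol_part F).
Proof.
move=> fq FE q0; exists (map_poly cj (q - c%:P))%:P; split=> [a b _|].
  rewrite coefC; case: a => [|a] /=; last by rewrite coef0.
  rewrite coef_map /fcoef2 -[RHS]/(cj (fcoef F b)) FE; congr cj.
  by rewrite coefB coefC; case: b => [|b] /=; rewrite ?q0 ?subrr ?subr0.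
apply: bigO_eq (bigO_conj fq) => t; rewrite /ev2 hornerC horner_map -rmorphB; congr cj.
by rewrite !hornerE; ring.
Qed.

Section Curve.
Variables (N : nat) (zeta : C -> 'rV[C]_n) (q : 'I_n -> {poly C}).
Hypothesis zetaq : forall j, bigO N.+1 (fun t => zeta t 0 j - (q j).[t]).
Hypothesis q0 : forall j, (q j)`_0 = p 0 j.

Definition rcoord (k : RIdx) t : R :=
  if k.2 then complex.Im (zeta t 0 k.1 - p 0 k.1) else complex.Re (zeta t 0 k.1 - p 0 k.1).

Lemma has_exp_rcoord k : has_exp N (fun t => (rcoord k t)%:C) (rcoord2 (poly_curve q) k).
Proof.
have FE m : fcoef (curve_fps (poly_curve q) k.1) m = if m is 0%N then 0 else (q k.1)`_m.
  by case: m.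
have H := has_exp_hol (zetaq k.1) FE (q0 k.1).
have A := has_exp_antihol (zetaq k.1) FE (q0 k.1).
rewrite rcoord2E /rcoord; case: (k.2).
  have A' := has_expM (has_expC N (-1)) A.
  have E := has_expM (has_expC N (2 * 'i)^-1) (has_expD H A').
  have -> : hol_part (curve_fps (poly_curve q) k.1) - antihol_part (curve_fps (poly_curve q) k.1)
    = hol_part (curve_fps (poly_curve q) k.1) + fpsC2 (-1) * antihol_part (curve_fps (poly_curve q) k.1).
    apply: fpsP => a; apply: fpsP => b.
    by rewrite -[LHS]/(fcoef2 (_ - _) a b) -[RHS]/(fcoef2 (_ + _) a b) !fcoef2D fcoef2N fcoef2C mulN1r.
  apply: has_exp_eq E => t; rewrite ImJ_sub.
  have i0 : 'i != 0 :> C by rewrite eq_complex /= oner_eq0 andbF.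
  have i2 : 'i * 'i = -1 :> C by rewrite -expr2 sqr_i.
  have -> : (2 * 'i : C)^-1 = - 'i / 2.
    apply: (mulfI (mulf_neq0 (_ : 2 != 0 :> C) i0)); first by rewrite pnatr_eq0.
    rewrite mulfV ?mulf_neq0 ?pnatr_eq0 //.
    have -> : 2 * 'i * (- 'i / 2) = - ('i * 'i) :> C by field.
    by rewrite i2 opprK.
  by rewrite -[X in _ = _ / 2 * X]/('i%R : C); field.
have E := has_expM (has_expC N 2^-1) (has_expD H A).
by apply: has_exp_eq E => t; rewrite ReJ_add mulrC.
Qed.

Lemma curve_rcoord t : zeta t = p + \sum_k (rcoord k t)%:C *: rdir R k.
Proof.
apply/rowP => j; rewrite mxE summxE.
rewrite -(pair_bigA _ (fun l b => ((rcoord (l, b) t)%:C *: rdir R (l, b)) 0 j)) /=.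
rewrite (bigD1 j) //= [X in _ + (_ + X)]big1 ?addr0; last first.
  move=> l lj; rewrite big1 // => b _.
  by rewrite !mxE eqxx eq_sym (negbTE lj) /= !mulr0.
rewrite big_bool /= !mxE !eqxx /= !mulr1 addrC.
have := complexE (zeta t 0 j - p 0 j) => E.
rewrite -[LHS](subrK (p 0 j)) {1}E /rcoord /=; congr (_ + _).
by rewrite addrC mulrC.
Qed.

Lemma bigO_rho : exists M d, [/\ 0 <= M, 0 < d & forall t, cabs t < d ->
  forall k, `|rcoord k t| <= M * cabs t].
Proof.
have O1 j : bigO 1 (fun t => zeta t 0 j - p 0 j).
  have [q1 q1E] : exists q1 : {poly C}, q j - (p 0 j)%:P = q1 * 'X.
    exists (drop_poly 1 (q j - (p 0 j)%:P)); rewrite -[LHS](poly_take_drop 1).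
    suff -> : take_poly 1 (q j - (p 0 j)%:P) = 0 by rewrite add0r.
    apply/polyP => m; rewrite coef_take_poly coef0; case: m => [|m] //=.
    by rewrite coefB coefC q0 subrr.
  have q1O : bigO 1 (fun t => q1.[t] * t).
    have X1 : bigO 1 (fun t : C => t).
      by exists 1, 1; split=> // t _; rewrite mul1r expr1.
    have B0 : bigO 0 (fun t => q1.[t]).
      apply: bigO_eq (ev2_bounded (map_poly polyC q1)) => t.
      by rewrite /ev2 horner_map hornerC.
    exact: bigOM B0 X1.
  apply: bigO_eq (bigOD (bigO_le (ltn0Sn N) (zetaq j)) q1O) => t.
  have := congr1 (fun q => q.[t]) q1E; rewrite /= hornerMX hornerD hornerN hornerC => <-.
  by ring.
have /choice[Md MdP] : forall j, exists Md : R * R, [/\ 0 <= Md.1, 0 < Md.2 &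
    forall t, cabs t < Md.2 -> cabs (zeta t 0 j - p 0 j) <= Md.1 * cabs t].
  move=> j; have [M [d [M0 d0 MP]]] := O1 j; by exists (M, d).
have [d d0 dP] : exists2 d : R, 0 < d & forall j, d <= (Md j).2.
  have : forall s : seq 'I_n, exists2 d : R, 0 < d & forall j, j \in s -> d <= (Md j).2.
    elim=> [|j s [d d0 dP]]; first by exists 1.
    have [_ Mj _] := MdP j.
    exists (Num.min d (Md j).2); first by rewrite lt_min d0.
    move=> i; rewrite inE => /orP[/eqP ->|/dP id]; first by rewrite ge_min lexx orbT.
    by rewrite ge_min id.
  by move=> /(_ (enum 'I_n))[d d0 dP]; exists d => // j; apply: dP; rewrite mem_enum.
exists (\sum_j (Md j).1), d; split=> //.
  by apply: sumr_ge0 => j _; have [] := MdP j.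
move=> t td k; have [M0 _ MP] := MdP k.1.
have := MP t (lt_le_trans td (dP k.1)) => H.
apply: (@le_trans _ _ (cabs (zeta t 0 k.1 - p 0 k.1))).
  by rewrite /rcoord; case: (k.2); [apply: Im_cabs|apply: Re_cabs].
apply: le_trans H _; rewrite ler_wpM2r ?cabs_ge0 // (bigD1 k.1) //= lerDl.
by apply: sumr_ge0 => j _; have [] := MdP j.
Qed.

(** The displacement of the curve from [p] is O(|t|), so the Taylor remainder of order N + 1 of [r]
    is O(|t|^(N + 1)), and only the Taylor polynomial has to be expanded. *)
Lemma has_exp_pullback : smooth_near r p -> has_exp N (fun t => (r (zeta t))%:C)
  (\sum_(g : mindex n N) fpsC2 (taylor_coef r p g)%:C * \prod_k rcoord2 (poly_curve q) k ^+ g k).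
Proof.
move=> sm.
have E : has_exp N (fun t => \sum_(g : mindex n N) (taylor_coef r p g)%:C * \prod_k (rcoord k t)%:C ^+ g k)
  (\sum_(g : mindex n N) fpsC2 (taylor_coef r p g)%:C * \prod_k rcoord2 (poly_curve q) k ^+ g k).
  apply: (has_exp_sum (index_enum _) (f := fun (g : mindex n N) t =>
    (taylor_coef r p g)%:C * \prod_k (rcoord k t)%:C ^+ g k)) => g.
  apply: has_expM; first exact: has_expC.
  apply: (has_exp_prod (index_enum _) (f := fun k t => (rcoord k t)%:C ^+ g k)) => k.
  by apply: has_expX; apply: has_exp_rcoord.
apply: has_exp_bigO E _.
have [M [d [M0 d0 MP]]] := real_taylor sm N; have [B [s [B0 s0 BP]]] := bigO_rho.
have B1 : 0 < B + 1 by lra.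
exists (M * (B + 1) ^+ N.+1), (Num.min s (d / (B + 1))); split.
- by rewrite mulr_ge0 // exprn_ge0 // ltW.
- by rewrite lt_min s0 divr_gt0.
move=> t; rewrite lt_min ltr_pdivlMr // => /andP[ts td].
have rk k : `|rcoord k t| <= (B + 1) * cabs t.
  by apply: le_trans (BP t ts k) _; rewrite ler_wpM2r ?cabs_ge0 // lerDl.
rewrite mulrC in td; have := MP _ (fun k => rcoord k t) td rk.
rewrite -curve_rcoord exprMn mulrA => H.
have -> : \sum_(g : mindex n N) (taylor_coef r p g)%:C * \prod_k (rcoord k t)%:C ^+ g k =
    (\sum_(g : mindex n N) taylor_coef r p g * \prod_k rcoord k t ^+ g k)%:C.
  rewrite rmorph_sum; apply: eq_bigr => g _; rewrite [RHS]rmorphM.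
  congr (_ * _); rewrite rmorph_prod; by apply: eq_bigr => k _; rewrite rmorphXn.
by rewrite -rmorphB cabs_real.
Qed.

Lemma pullback_coef a b : (a + b <= N)%N ->
  fcoef2 (\sum_(g : mindex n N) fpsC2 (taylor_coef r p g)%:C *
     \prod_k rcoord2 (poly_curve q) k ^+ g k) a b = formal_comp r p (poly_curve q) a b.
Proof.
move=> abN; rewrite -(formal_comp_herm r p (poly_curve q) abN) /fcoef2 !fcoef_sum.
apply: eq_bigr => g _; rewrite -[LHS]/(fcoef2 _ a b) fcoef2C; congr (_ * _).
by rewrite hform_curve prod_mindex_seq.
Qed.

Theorem pullback_vanishes k : smooth_near r p -> (k <= N.+1)%N ->
  vanishes_to (fun t => r (zeta t)) k ->
  forall a b, (a + b < k)%N -> formal_comp r p (poly_curve q) a b = 0.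
Proof.
move=> sm kN /vanishes_to_bigO fO a b ab.
rewrite -pullback_coef; last by rewrite -ltnS (leq_trans ab).
exact: (has_exp_coef0 (has_exp_pullback sm) kN fO ab).
Qed.

Theorem vanishes_pullback : smooth_near r p ->
  (forall a b, (a + b <= N)%N -> formal_comp r p (poly_curve q) a b = 0) ->
  vanishes_to (fun t => r (zeta t)) N.+1.
Proof.
move=> sm F0; apply/vanishes_to_bigO; apply: has_exp_vanish (has_exp_pullback sm) _.
by move=> a b ab; rewrite pullback_coef // F0.
Qed.

End Curve.
End PullbackExpansion.

(** * Ultralimits of osculating functionals *)

Section UltraLimit.
Variables (R : realType) (U : set_system nat).
Hypothesis Uultra : UltraFilter U.
Local Open Scope complex_scope.
Local Open Scope classical_set_scope.
Notation C := R[i].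
Local Notation cj := (@conjc R).
Implicit Types (x y : nat -> C) (c d : C).

Definition ulim x c := forall e : R, 0 < e -> U [set K | (@cabs R (x K - c) < e)%R].

Lemma ulim_mono (A B : set nat) : (forall K, A K -> B K) -> U A -> U B.
Proof. by move=> AB; apply: filterS. Qed.

Lemma ulim_cst c : ulim (fun=> c) c.
Proof. by move=> e e0; apply: ulim_mono filterT => K _ /=; rewrite subrr cabs0. Qed.

Lemma ulimD x y c d : ulim x c -> ulim y d -> ulim (fun K => x K + y K) (c + d).
Proof.
move=> xc yd e e0; have e2 : 0 < e / 2 by rewrite divr_gt0.
apply: ulim_mono (filterI (xc _ e2) (yd _ e2)) => K /= [H1 H2].
have -> : x K + y K - (c + d) = (x K - c) + (y K - d) by ring.
by apply: le_lt_trans (cabsD _ _) _; lra.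
Qed.

Lemma ulimM x y c d : ulim x c -> ulim y d -> ulim (fun K => x K * y K) (c * d).
Proof.
move=> xc yd e e0; have cd0 : 0 < cabs c + cabs d + 1 by rewrite ltr_wpDl // addr_ge0 ?cabs_ge0.
pose s := Num.min 1 (e / (cabs c + cabs d + 1)).
have s0 : 0 < s by rewrite lt_min ltr01 divr_gt0.
apply: ulim_mono (filterI (xc _ s0) (yd _ s0)) => K /= [H1 H2].
have -> : x K * y K - c * d = (x K - c) * (y K - d) + c * (y K - d) + (x K - c) * d by ring.
have s1 : s <= 1 by rewrite ge_min lexx.
have se : s * (cabs c + cabs d + 1) <= e by rewrite -ler_pdivlMr // ge_min lexx orbT.
have c0 := cabs_ge0 c; have d0 := cabs_ge0 d.
have x0 := cabs_ge0 (x K - c); have y0 := cabs_ge0 (y K - d).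
have := cabsD ((x K - c) * (y K - d) + c * (y K - d)) ((x K - c) * d).
have := cabsD ((x K - c) * (y K - d)) (c * (y K - d)); rewrite !cabsM.
move: (cabs (x K - c)) (cabs (y K - d)) (cabs c) (cabs d) H1 H2 c0 d0 x0 y0 s0 s1 se.
move=> a b u v H1 H2 c0 d0 x0 y0 s0 s1 se T1 T2.
have P1 : a * b <= s * b by rewrite ler_wpM2r // ltW.
have P2 : s * b < s by rewrite -[X in _ < X]mulr1 ltr_pM2l // (lt_le_trans H2).
have P3 : u * b <= u * s by rewrite ler_wpM2l // ltW.
have P4 : a * v <= s * v by rewrite ler_wpM2r // ltW.
by apply: le_lt_trans T2 _; lra.
Qed.

Lemma ulim_conj x c : ulim x c -> ulim (fun K => cj (x K)) (cj c).
Proof.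
move=> xc e e0; apply: ulim_mono (xc e e0) => K /=.
by rewrite -rmorphB [cabs (cj _)]cabs_conj.
Qed.

Lemma ulim_sum (I : Type) (s : seq I) (x : I -> nat -> C) (c : I -> C) :
  (forall i, ulim (x i) (c i)) -> ulim (fun K => \sum_(i <- s) x i K) (\sum_(i <- s) c i).
Proof.
move=> xc; elim: s => [|i s IH].
  rewrite big_nil; have -> : (fun K => \sum_(i <- [::]) x i K) = fun=> 0 by apply/funext => K; rewrite big_nil.
  exact: ulim_cst.
rewrite big_cons; have -> : (fun K => \sum_(i <- i :: s) x i K) = fun K => x i K + \sum_(i <- s) x i K.
  by apply/funext => K; rewrite big_cons.
exact: ulimD.
Qed.

Lemma ulim_unique x c d : ulim x c -> ulim x d -> c = d.
Proof.
move=> xc xd; apply/eqP; rewrite -subr_eq0 -cabs_eq0; apply: contrapT => /negP cd.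
have {}cd : 0 < cabs (c - d) by rewrite lt_neqAle eq_sym cd cabs_ge0.
have e0 : 0 < cabs (c - d) / 2 by rewrite divr_gt0.
have [K [/= H1 H2]] := filter_ex (filterI (xc _ e0) (xd _ e0)).
have : cabs (c - d) <= cabs (x K - c) + cabs (x K - d).
  by have -> : c - d = - (x K - c) + (x K - d); [ring|rewrite (le_trans (cabsD _ _)) // cabsN].
lra.
Qed.

(** The limit is the supremum of the lower bounds valid on a set of the ultrafilter; where a lower
    bound fails, the complementary set belongs to the ultrafilter and gives an upper bound. *)
Lemma ulim_real (x : nat -> R) M : (forall K, `|x K| <= M) ->
  exists l : R, forall e : R, 0 < e -> U [set K | `|x K - l| < e].
Proof.
move=> xM; pose S := [set y : R | U [set K | y <= x K]].
have SM (y : R) : S y -> y <= M.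
  by move=> /filter_ex[K /= yK]; apply: le_trans yK _; apply: le_trans (ler_norm _) (xM K).
have S0 : S (- M).
  by apply: ulim_mono filterT => K _ /=; have := xM K; rewrite ler_norml => /andP[].
have hs : has_sup S by split; [exists (- M)|exists M].
exists (sup S) => e e0.
have [y Sy yc] := sup_adherent e0 hs.
have nS : ~ S (sup S + e).
  by move=> Se; have := ub_le_sup (proj2 hs) Se; rewrite gerDl leNgt e0.
have Uc : U (~` [set K | sup S + e <= x K]).
  by have [|//] := in_ultra_setVsetC [set K | sup S + e <= x K] Uultra => /nS.
apply: ulim_mono (filterI Sy Uc) => K /= [yK /negP]; rewrite -ltNge => Kc.
by rewrite ltr_norml; apply/andP; lra.
Qed.

Lemma ulim_ex x M : (forall K, cabs (x K) <= M) -> exists c, ulim x c.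
Proof.
move=> xM.
have [a aP] := ulim_real (fun K => le_trans (Re_cabs (x K)) (xM K)).
have [b bP] := ulim_real (fun K => le_trans (Im_cabs (x K)) (xM K)).
exists (a +i* b) => e e0; have e2 : 0 < e / 2 by rewrite divr_gt0.
apply: ulim_mono (filterI (aP _ e2) (bP _ e2)) => K /= [H1 H2].
apply: le_lt_trans (cabs_ReIm _) _.
have -> : complex.Re (x K - (a +i* b)) = complex.Re (x K) - a by case: (x K).
have -> : complex.Im (x K - (a +i* b)) = complex.Im (x K) - b by case: (x K).
lra.
Qed.

Lemma ultra_finite (T : finType) (phi : nat -> T) : exists t, U [set K | phi K = t].
Proof.
apply: contrapT => /forallNP H.
have : forall s : seq T, U [set K | phi K \notin s].
  elim=> [|t s IH]; first by apply: ulim_mono filterT => K.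
  have Ut : U (~` [set K | phi K = t]).
    by have [/H//|] := in_ultra_setVsetC [set K | phi K = t] Uultra.
  apply: ulim_mono (filterI IH Ut) => K /= [H1 H2].
  by rewrite inE negb_or H1 andbT; apply/eqP.
by move=> /(_ (enum T))/filter_ex[K /=]; rewrite mem_enum.
Qed.
End UltraLimit.

(** * The limit of the osculating modules *)

Section LimitModule.
Variables (R : realType) (n : nat) (r : 'rV[R[i]]_n -> R) (p : 'rV[R[i]]_n).
Local Open Scope complex_scope.
Local Open Scope classical_set_scope.
Notation C := R[i].
Local Notation cj := (@conjc R).
Variables (Z : nat -> formal_curve R n) (m : nat -> nat).
Hypothesis m0 : forall K, (0 < m K)%N.
Hypothesis Zm : forall K, exists j, Z K j (m K) != 0.
Hypothesis Zlow : forall K j i, (0 < i < m K)%N -> Z K j i = 0.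
Hypothesis Zvanish : forall K a b, (a + b < K * m K)%N -> formal_comp r p (Z K) a b = 0.
Variable U : set_system nat.
Hypothesis Uultra : UltraFilter U.
Hypothesis Uoo : forall K0, U [set K | (K0 <= K)%N].

(** Two indices below it have sum below K m_K, the range in which the coefficients of r o Z_K
    vanish. *)
Definition half_order K := ((K * m K)./2)%N.

Definition osculating K (v : mon n -> C) := exists c : nat -> C,
  v = fun al => \sum_(a < half_order K) c a * curve_functional (Z K) a al.

Lemma osculatingL K c v w : osculating K v -> osculating K w ->
  osculating K (fun al => c * v al + w al).
Proof.
move=> [d ->] [d' ->]; exists (fun a => c * d a + d' a); apply/funext => al.
by rewrite mulr_sumr -big_split /=; apply: eq_bigr => a _; ring.
Qed.

Lemma osculating0 K : osculating K (fun=> 0).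
Proof.
by exists (fun=> 0); apply/funext => al; rewrite big1 // => a _; rewrite mul0r.
Qed.

Lemma osculating_sum K (I : Type) (s : seq I) (c : I -> C) (v : I -> mon n -> C) :
  (forall i, osculating K (v i)) -> osculating K (fun al => \sum_(i <- s) c i * v i al).
Proof.
move=> Ov; elim: s => [|i s IH].
  have -> : (fun al => \sum_(i <- [::]) c i * v i al) = fun=> 0.
    by apply/funext => al; rewrite big_nil.
  exact: osculating0.
have -> : (fun al => \sum_(i <- i :: s) c i * v i al) =
    fun al => c i * v i al + \sum_(i <- s) c i * v i al by apply/funext => al; rewrite big_cons.
exact: osculatingL.
Qed.

Lemma osculating_functional K a : (a < half_order K)%N -> osculating K (curve_functional (Z K) a).
Proof.
move=> aS; exists (fun b => (b == a)%:R); apply/funext => al.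
rewrite (bigD1 (Ordinal aS)) //= eqxx mul1r big1 ?addr0 // => b ba.
suff -> : (b == a :> nat) = false by rewrite mul0r.
by apply: contraNF ba => /eqP ba; apply/eqP/val_inj.
Qed.

(** Multiplying by a coordinate before taking the coefficient of t^a involves no coefficient of
    index above a, so the bound on the indices is preserved. *)
Lemma osculating_shift K j v : osculating K v -> osculating K (shift j v).
Proof.
move=> [c ->]; apply: (@osculating_sum K _ (index_enum _) (fun a : 'I_(half_order K) => c a)
  (fun a al => curve_functional (Z K) a (minc j al))) => a.
have -> : (fun al => curve_functional (Z K) a (minc j al)) =
    fun al => \sum_(i < a.+1) fcoef (curve_fps (Z K) j) i * curve_functional (Z K) (a - i) al.
  by apply/funext => al; rewrite /curve_functional curve_mon_minc fcoefM.
apply: (@osculating_sum K _ (index_enum _) (fun i : 'I_a.+1 => fcoef (curve_fps (Z K) j) i)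
  (fun i al => curve_functional (Z K) (a - i) al)) => i.
by apply: osculating_functional; apply: leq_ltn_trans (leq_subr _ _) (ltn_ord a).
Qed.

Lemma herm_suml N (I : Type) (s : seq I) (c : I -> C) (v : I -> mon n -> C) w :
  herm r p N (fun al => \sum_(i <- s) c i * v i al) w = \sum_(i <- s) c i * herm r p N (v i) w.
Proof.
elim: s => [|i s IH].
  rewrite big_nil; under eq_fun do rewrite big_nil.
  have := herm_linl r p N (-1) (fun=> 0) (fun=> 0) w; rewrite [X in _ = X + _]mulN1r [X in _ = X]addNr; apply: etrans.
  by congr (herm r p N _ w); apply/funext => al; rewrite mulr0 addr0.
rewrite big_cons -IH -herm_linl; congr (herm r p N _ w); apply/funext => al.
by rewrite big_cons.
Qed.

Lemma herm_sumr N (I : Type) (s : seq I) (c : I -> C) (v : mon n -> C) (w : I -> mon n -> C) :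
  herm r p N v (fun al => \sum_(i <- s) c i * w i al) = \sum_(i <- s) cj (c i) * herm r p N v (w i).
Proof.
elim: s => [|i s IH].
  rewrite big_nil; under eq_fun do rewrite big_nil.
  have := herm_linr r p N (-1) v (fun=> 0) (fun=> 0); 
  rewrite [X in _ = X * _ + _](rmorphN1 cj) [X in _ = X + _]mulN1r [X in _ = X]addNr; apply: etrans.
  by congr (herm r p N v _); apply/funext => al; rewrite mulr0 addr0.
rewrite big_cons -IH -herm_linr; congr (herm r p N v _); apply/funext => al.
by rewrite big_cons.
Qed.

Lemma osculating_isotropic K D N v w : osculating K v -> osculating K w ->
  bdeg D v -> bdeg D w -> (D + D <= N)%N -> herm r p N v w = 0.
Proof.
move=> [c vE] [d wE] bv bw DN.
(* [v] and [w] have degree at most [D], but the functionals that compose them may have larger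
   degree. The wider truncation leaves the left side unchanged and is large enough to treat these
   functionals one by one. *)
have -> : herm r p N v w = herm r p (N + K * m K) v w.
  apply/esym/(@herm_widen _ _ r p N _ v w (D + D)) => //; first exact: leq_addr.
  move=> al be DD; have [Dal|alD] := ltnP D (mdeg al); first by rewrite bv ?mul0r.
  have -> : w be = 0.
    by apply: bw; rewrite -(ltn_add2l D) (leq_trans DD) // leq_add2r.
  by rewrite [X in _ * X]conjc0 mulr0.
rewrite vE herm_suml big1 // => a _; rewrite wE herm_sumr big1 ?mulr0 // => b _.
have ab : (a + b < K * m K)%N.
  have abh : (a + b < half_order K + half_order K)%N.
    by rewrite -addnS leq_add // ltnW.
  by apply: leq_trans abh _; rewrite addnn -[X in (_ <= X)%N](odd_double_half (K * m K)) leq_addl.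
rewrite formal_comp_herm ?Zvanish ?mulr0 //.
by apply: leq_trans (ltnW ab) (leq_addl _ _).
Qed.

(** The degree bound is uniform in [K], so that one truncation of the Hermitian form serves all
    members of the sequence and survives the limit. *)
Definition limit_module : set (mon n -> C) := fun f => exists D (F : nat -> mon n -> C),
  [/\ bdeg D f, forall K, osculating K (F K), forall K, bdeg D (F K) &
      forall al, ulim U (fun K => F K al) (f al)].

Lemma bdeg_le D D' (f : mon n -> C) : (D <= D')%N -> bdeg D f -> bdeg D' f.
Proof. by move=> DD fD al D'al; apply: fD; apply: leq_ltn_trans D'al. Qed.

Lemma limit_submod : submod limit_module.
Proof.
split=> [|c f g [D [F [fD OF FD Ff]]] [D' [G [gD OG GD Gg]]]|j f [D [F [fD OF FD Ff]]]|f].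
- exists 0%N, (fun _ _ => 0); split=> // [K|al]; first exact: osculating0.
  exact: ulim_cst.
- exists (D + D')%N, (fun K al => c * F K al + G K al).
  have [l1 l2] := (leq_addr D' D, leq_addl D D').
  split=> [al DD|K|K al DD|al].
  + by rewrite (bdeg_le l1 fD) // (bdeg_le l2 gD) // mulr0 addr0.
  + exact: osculatingL.
  + by rewrite (bdeg_le l1 (FD K)) // (bdeg_le l2 (GD K)) // mulr0 addr0.
  + by apply: ulimD => //; apply: ulimM => //; apply: ulim_cst.
- exists D, (fun K => shift j (F K)); split=> [al Dal|K|K al Dal|al].
  + by apply: fD; rewrite mdeg_minc ltnW.
  + exact: osculating_shift.
  + by apply: FD; rewrite mdeg_minc ltnW.
  + exact: Ff.
- by move=> [D [F [fD _ _ _]]]; exists D.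
Qed.

Lemma ulim_herm N (F G : nat -> mon n -> C) f g :
  (forall al, ulim U (fun K => F K al) (f al)) -> (forall al, ulim U (fun K => G K al) (g al)) ->
  ulim U (fun K => herm r p N (F K) (G K)) (herm r p N f g).
Proof.
move=> Ff Gg; apply: (ulim_sum Uultra (index_enum _) (x := fun gg K =>
  (taylor_coef r p gg)%:C * hform (mindex_seq gg) (F K) (G K))) => gg.
apply: ulimM; first exact: ulim_cst.
rewrite /hform; move: (mon0 n) {2 4}(mon0 n) => al be.
elim: (mindex_seq gg) al be => [|k s IH] al be /=.
  by apply: ulimM => //; apply: ulim_conj.
have cst c := @ulim_cst R U Uultra c.
rewrite /coord_op; case: (k.2); apply: ulimM => //; apply: ulimD => //.
have E x : - hop s (fun al be => f al * cj (g be)) al x = -1 * hop s (fun al be => f al * cj (g be)) al x.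
  by rewrite mulN1r.
rewrite [X in ulim _ _ X]E.
have -> : (fun K => - hop s (fun al be => F K al * cj (G K be)) al (minc k.1 be)) =
    (fun K => -1 * hop s (fun al be => F K al * cj (G K be)) al (minc k.1 be)).
  by apply/funext => K; rewrite mulN1r.
by apply: ulimM.
Qed.

Lemma limit_isotropic f g : limit_module f -> limit_module g ->
  exists N0, forall N, (N0 <= N)%N -> herm r p N f g = 0.
Proof.
move=> [D [F [fD OF FD Ff]]] [D' [G [gD OG GD Gg]]].
pose E := (D + D')%N; exists (E + E)%N => N EN.
have := ulim_herm N Ff Gg.
have -> : (fun K => herm r p N (F K) (G K)) = fun=> 0.
  apply/funext => K; apply: (osculating_isotropic (OF K) (OG K) _ _ EN).
    exact: bdeg_le (leq_addr _ _) (FD K).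
  exact: bdeg_le (leq_addl _ _) (GD K).
by move=> H; apply: (ulim_unique Uultra H (ulim_cst Uultra 0)).
Qed.

Lemma curve_fps_low K j i : (i < m K)%N -> fcoef (curve_fps (Z K) j) i = 0.
Proof. by case: i => [|i] //= im; apply: Zlow. Qed.

Lemma curve_mon_low K al i : (i < m K * mdeg al)%N -> fcoef (curve_mon (Z K) al) i = 0.
Proof.
elim/mon_ind: al i => [|j al IH] i; first by rewrite mdeg0 muln0.
rewrite mdeg_minc curve_mon_minc fcoefM => im; rewrite big1 // => l _.
have [lm|ml] := ltnP l (m K); first by rewrite curve_fps_low ?mul0r.
rewrite IH ?mulr0 // ltn_subLR; last by rewrite -ltnS.
by apply: leq_trans im _; rewrite mulnS leq_add2r.
Qed.

(** A monomial of degree d has order at least d m_K along the curve, and the [k]-th power of a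
    coordinate of order exactly m_K has order k m_K. *)
Lemma functional_exact_deg K k : exact_deg k (curve_functional (Z K) (k * m K)).
Proof.
split=> [al kal|]; first by apply: curve_mon_low; rewrite mulnC ltn_pmul2l.
have [j Zj] := Zm K.
suff [al [alk ac]] : exists al : mon n, mdeg al = k /\ fcoef (curve_mon (Z K) al) (k * m K) != 0.
  by exists al.
elim: k => [|k [al [alk ac]]].
  by exists (mon0 n); rewrite mdeg0 curve_mon0 mul0n fcoef1 oner_eq0.
exists (minc j al); rewrite mdeg_minc alk curve_mon_minc mulSn; split=> //.
have mlt : (m K < (m K + k * m K).+1)%N by rewrite ltnS leq_addr.
rewrite fcoefM (bigD1 (Ordinal mlt)) // big1 => [|l lm].
  rewrite [X in X != 0]addr0 mulf_neq0 //; last by rewrite [nat_of_ord _]/= addKn.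
  by rewrite [nat_of_ord _]/= /curve_fps /=; case: (m K) (m0 K) Zj.
have {}lm : l != m K :> nat by apply: contraNneq lm => lm; apply/eqP/val_inj.
have [lm'|ml] := ltnP l (m K); first by rewrite curve_fps_low ?mul0r.
rewrite curve_mon_low ?mulr0 // alk ltn_subLR; last by rewrite -ltnS.
by rewrite [(m K * k)%N]mulnC ltn_add2r ltn_neqAle eq_sym lm.
Qed.

(* The functionals of index [k * m K] have exact degree [k], so a combination of
   one more of them than there are monomials of degree at most [D] kills all
   of these monomials; dividing by its largest value keeps the limit nonzero. *)
Lemma osculating_normalized D K : (2 * #|{: box n D}|.+1 <= K)%N ->
  exists h (al : box n #|{: box n D}|), [/\ osculating K h, bdeg #|{: box n D}| h,
    forall be, cabs (h be) <= 1, forall be, (mdeg be <= D)%N -> h be = 0 & h (mon_of al) = 1].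
Proof.
set q := #|{: box n D}| => qK.
have [c [c0 [al1 /andP[_ alq] hal]]] := @exact_deg_dep _ n q 0
  (fun k => curve_functional (Z K) (k * m K))
  (fun k i => curve_functional (Z K) (k * m K) (mon_of (enum_val i)))
  (fun k _ => functional_exact_deg K k).
pose h al := \sum_(k < q.+1) c k * curve_functional (Z K) (k * m K) al.
have hO : osculating K h.
  apply: (@osculating_sum K _ (index_enum _) c (fun k : 'I_q.+1 => curve_functional (Z K) (k * m K))) => k.
  apply: osculating_functional; rewrite /half_order.
  (* From K >= 2 (q + 1), the indices k m_K with k <= q lie below half of K m_K. *)
  have H : (2 * q.+1 * m K <= K * m K)%N by rewrite leq_mul2r qK orbT.
  have kq := leq_ord k; have mK := m0 K.
  have H2 : (k * m K < q.+1 * m K)%N by rewrite ltn_pmul2r // ltnS.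
  apply: leq_trans H2 _; rewrite -[X in (X <= _)%N]doubleK; apply: half_leq.
  by rewrite -muln2 mulnC mulnA.
have hq : bdeg q h.
  move=> al qal; rewrite /h big1 // => k _.
  have [-> //] := functional_exact_deg K k; rewrite ?mulr0 //.
  by apply: leq_ltn_trans qal; apply: leq_ord.
have hD be : (mdeg be <= D)%N -> h be = 0.
  by move=> /mon_ofP[b ->]; have := c0 (enum_rank b); under eq_bigr do rewrite enum_rankK.
have [b1 b1E] := mon_ofP alq.
case: (Order.TotalTheory.arg_maxP (fun b : box n q => cabs (h (mon_of b))) (erefl : predT b1)) => b _ bmax.
have hb : h (mon_of b) != 0.
  rewrite -cabs_gt0; apply: lt_le_trans (bmax b1 isT); rewrite cabs_gt0 -b1E.
  exact: hal.
exists (fun al => (h (mon_of b))^-1 * h al), b; split=> [|al qal|be|be bD|].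
- have := osculatingL (h (mon_of b))^-1 hO (osculating0 K).
  by under eq_fun do [rewrite addr0].
- by rewrite (hq _ qal) mulr0.
- rewrite cabsM cabsV mulrC ler_pdivrMr ?cabs_gt0 // mul1r.
  have [beq|qbe] := leqP (mdeg be) q; last by rewrite hq // cabs0 cabs_ge0.
  by have [b' ->] := mon_ofP beq; apply: bmax.
- by rewrite (hD _ bD) mulr0.
- by rewrite mulVf.
Qed.

(** Normalized elements vanish in degrees at most [D], are bounded by 1 and equal 1 at a monomial of
    a fixed finite box. The ultrafilter makes this monomial constant, so the limit equals 1 there,
    and its degree exceeds [D]. Small [K], for which no such element is provided, receive the zero
    functional. *)
Lemma limit_unbounded : unbounded limit_module.
Proof.
move=> D; set q := #|{: box n D}|; set K0 := (2 * q.+1)%N.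
have /choice[hb hbP] : forall K, exists hb : (mon n -> C) * box n q,
    [/\ osculating K hb.1, bdeg q hb.1, forall be, cabs (hb.1 be) <= 1,
      forall be, (mdeg be <= D)%N -> hb.1 be = 0 & (K0 <= K)%N -> hb.1 (mon_of hb.2) = 1].
  move=> K; have [K0K|KK0] := leqP K0 K.
    by have [h [al [? ? ? ? ?]]] := osculating_normalized K0K; exists (h, al).
  exists ((fun=> 0), [ffun=> ord0]); split.
  - exact: osculating0.
  - by [].
  - by move=> be; rewrite [cabs _]cabs0.
  - by [].
  - by [].
have /choice[f fP] : forall al, exists c, ulim U (fun K => (hb K).1 al) c.
  by move=> al; apply: (@ulim_ex _ _ Uultra _ 1) => K; have [_ _ ->] := hbP K.
have [b Ub] := ultra_finite Uultra (fun K => (hb K).2).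
have fb : f (mon_of b) = 1.
  apply: (ulim_unique Uultra (fP _)) => e e0.
  apply: ulim_mono (filterI Ub (Uoo K0)) => K /= [Kb K0K].
  by have [_ _ _ _ H] := hbP K; rewrite -Kb H // subrr cabs0.
have f0 al : (forall K, (hb K).1 al = 0) -> f al = 0.
  move=> h0; apply: (ulim_unique Uultra (fP al)).
  have -> : (fun K => (hb K).1 al) = fun=> 0 by apply/funext => K; rewrite h0.
  exact: ulim_cst.
exists f, (mon_of b); split.
- exists q, (fun K => (hb K).1); split=> [al qal|K|K|al].
  + by apply: f0 => K; have [_ H _ _ _] := hbP K; apply: H.
  + by have [] := hbP K.
  + by have [] := hbP K.
  + exact: fP.
- rewrite leqNgt; apply/negP => bD; move: fb; rewrite f0.
    by move/eqP; rewrite eq_sym oner_eq0.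
  by move=> K; have [_ _ _ H _] := hbP K; apply: H; apply: ltnW.
- by rewrite fb oner_neq0.
Qed.

Theorem limit_curve : exists zeta : formal_curve R n,
  [/\ forall j, zeta j 0%N = p 0 j, formal_nonconstant zeta &
    formal_vanishes_inf (formal_comp r p zeta)].
Proof.
have [z [z0 [j zj] zV]] := curve_in_submodule limit_submod limit_unbounded.
pose zeta : formal_curve R n := fun j k => if k is 0%N then p 0 j else fcoef (z j) k.
have zE i : curve_fps zeta i = z i by apply: fpsP => -[|k] //=; rewrite z0.
exists zeta; split=> //.
  have [[|k] zk _] := fps_neq0_ord zj; first by rewrite z0 eqxx in zk.
  by exists j; exists k.+1.
have V k : limit_module (curve_functional zeta k).
  have := zV k; congr limit_module; apply/funext => al.
  rewrite /curve_functional /curve_mon; congr fcoef; apply: eq_bigr => i _.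
  by rewrite zE.
move=> a b; have [N0 H] := limit_isotropic (V a) (V b).
by rewrite -(@formal_comp_herm _ _ r p zeta (a + b + N0)) ?leq_addr // H // leq_addl.
Qed.

End LimitModule.

(** * Infinite type *)

Local Open Scope complex_scope.

Section OrderOfVanishing.
Variable R : realType.
Notation C := R[i].

Lemma vanishes_to_le (f : C -> R) k l : (k <= l)%N -> vanishes_to f l -> vanishes_to f k.
Proof. by move=> kl /vanishes_to_bigO fl; apply/vanishes_to_bigO; apply: bigO_le kl fl. Qed.

Lemma ord_vanishE (f : C -> R) m : (forall k, vanishes_to f k <-> (k <= m)%N) ->
  ord_vanish f = (m%:R)%:E.
Proof.
move=> fm; apply/eqP; rewrite eq_le; apply/andP; split.
  by apply: ge_ereal_sup => _ [k /= /fm km <-]; rewrite lee_fin ler_nat.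
by apply: ereal_sup_ubound; exists m => //=; apply/fm.
Qed.

Lemma bigO_horner k (q : {poly C}) :
  bigO k (fun t => q.[t]) <-> forall i, (i < k)%N -> q`_i = 0.
Proof.
split=> [qO i ik|q0].
  have QO : bigO k (ev2 (map_poly polyC q)).
    by apply: bigO_eq qO => t; rewrite /ev2 horner_map hornerC.
  have := ev2_bigO_coef0 QO (_ : i + 0 < k)%N.
  by rewrite addn0 coef_map coefC /=; apply.
have tq : take_poly k q = 0.
  by apply/polyP => i; rewrite coef_take_poly coef0; case: ltnP => // /q0.
have B0 : bigO 0 (fun t => (drop_poly k q).[t]).
  apply: bigO_eq (ev2_bounded (map_poly polyC (drop_poly k q))) => t.
  by rewrite /ev2 horner_map hornerC.
have Xk : bigO k (fun t : C => t ^+ k).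
  by exists 1, 1; split=> // t _; rewrite mul1r cabsX.
apply: bigO_eq (bigOM B0 Xk) => t.
by rewrite -[in RHS](poly_take_drop k q) tq add0r hornerM hornerXn.
Qed.

Lemma hol_horner (q : {poly C}) z : hol (fun t => q.[t]) z.
Proof.
elim/poly_ind: q => [|q c IH].
  have -> : (fun t : C => 0.[t]) = fun=> 0 by apply/funext => t; rewrite horner0.
  exact: hol_cst.
have -> : (fun t => (q * 'X + c%:P).[t]) = fun t => q.[t] * t - (- c).
  by apply/funext => t; rewrite hornerMXaddC opprK.
by apply: holB (hol_cst _ _); apply: holM IH (hol_id _).
Qed.
End OrderOfVanishing.

Section CurveOrder.
Variables (R : realType) (n : nat).
Notation C := R[i].
Implicit Types (zeta : C -> 'rV[C]_n).

Definition curve_size zeta (t : C) : R := \sum_(j < n) cabs (zeta t 0 j - zeta 0 0 j).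

Lemma vanishes_curve_size zeta k : vanishes_to (curve_size zeta) k <->
  forall j, bigO k (fun t => zeta t 0 j - zeta 0 0 j).
Proof.
split=> [/vanishes_to_bigO[M [d [M0 d0 zM]]] j|zO].
  exists M, d; split=> // t /zM; apply: le_trans; rewrite cabs_real.
  apply: le_trans (ler_norm _); rewrite /curve_size (bigD1 j) //= lerDl.
  by apply: sumr_ge0 => i _; apply: cabs_ge0.
apply/vanishes_to_bigO.
apply: (@bigO_eq _ _ (fun t => \sum_(j < n) (cabs (zeta t 0 j - zeta 0 0 j))%:C)).
  by move=> t; rewrite -rmorph_sum.
apply: bigO_sum => j _; have [M [d [M0 d0 zM]]] := zO j.
by exists M, d; split=> // t /zM; rewrite cabs_real ger0_norm ?cabs_ge0.
Qed.

Lemma holo_near0_taylor zeta N : holo_near0 zeta -> exists q : 'I_n -> {poly C},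
  (forall j, bigO N.+1 (fun t => zeta t 0 j - (q j).[t])) /\ forall j, (q j)`_0 = zeta 0 0 j.
Proof.
move=> [d d0 zh].
have /choice[q qP] : forall j, exists q : {poly C}, bigO N.+1 (fun t => zeta t 0 j - q.[t]).
  move=> j; have zj t : cabs t < d -> hol (fun s => zeta s 0 j) t.
    by move=> td; apply/holP; apply: zh.
  have [q [M [e [e0 qM]]]] := holomorphic_taylor N d0 zj.
  exists q, `|M|, e; split=> // t /qM H; apply: le_trans H _.
  by rewrite ler_wpM2r ?exprn_ge0 ?cabs_ge0 ?ler_norm.
exists q; split=> // j; have [M [e [M0 e0 qM]]] := qP j.
have := qM 0; rewrite cabs0 expr0n mulr0 => /(_ e0) H.
apply/esym/eqP; rewrite -subr_eq0 -cabs_eq0 -horner_coef0.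
by rewrite eq_le H cabs_ge0.
Qed.

Lemma taylor_curve_size zeta N (q : 'I_n -> {poly C}) k :
  (forall j, bigO N.+1 (fun t => zeta t 0 j - (q j).[t])) ->
  (forall j, (q j)`_0 = zeta 0 0 j) -> (k <= N.+1)%N ->
  vanishes_to (curve_size zeta) k <-> forall j i, (0 < i < k)%N -> (q j)`_i = 0.
Proof.
move=> zq q0 kN; have coefq j i : (q j - (zeta 0 0 j)%:P)`_i = if i is 0%N then 0 else (q j)`_i.
  by rewrite coefB coefC; case: i => [|i] /=; rewrite ?q0 ?subrr ?subr0.
rewrite vanishes_curve_size; split=> [zO j i /andP[i0 ik]|qi j].
  have := (bigO_horner k (q j - (zeta 0 0 j)%:P)).1 _ i ik.
  rewrite coefq; case: i i0 ik => // i _ _; apply.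
  have NzO : bigO k (fun t => -1 * (zeta t 0 j - (q j).[t])).
    exact: bigO_le kN (bigOM (bigO_cst (-1)) (zq j)).
  by apply: bigO_eq (bigOD (zO j) NzO) => t; rewrite hornerD hornerN hornerC; ring.
have qO : bigO k (fun t => (q j - (zeta 0 0 j)%:P).[t]).
  by apply/bigO_horner => i ik; rewrite coefq; case: i ik => // i ik; apply: qi.
apply: bigO_eq (bigOD (bigO_le kN (zq j)) qO) => t.
by rewrite hornerD hornerN hornerC; ring.
Qed.

Lemma curve_functional_eq (z z' : formal_curve R n) N al a :
  (forall j i, (i <= N)%N -> z j i = z' j i) -> (a <= N)%N ->
  curve_functional z a al = curve_functional z' a al.
Proof.
move=> zz; elim/mon_ind: al a => [|j al IH] a aN; first by rewrite /curve_functional !curve_mon0.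
rewrite /curve_functional !curve_mon_minc !fcoefM; apply: eq_bigr => i _; congr (_ * _).
  have iN : (i <= N)%N by apply: leq_trans aN; apply: leq_ord.
  by move: (nat_of_ord i) iN => -[|l] //= lN; apply: zz.
by apply: IH; apply: leq_trans (leq_subr _ _) aN.
Qed.

Lemma formal_comp_eq (r : 'rV[C]_n -> R) p (z z' : formal_curve R n) N a b :
  (forall j i, (i <= N)%N -> z j i = z' j i) -> (a + b <= N)%N ->
  formal_comp r p z a b = formal_comp r p z' a b.
Proof.
move=> zz abN; rewrite -!(formal_comp_herm r p _ (leqnn (a + b))).
congr (herm r p _ _ _); apply/funext => al; apply: curve_functional_eq zz _.
  exact: leq_trans (leq_addr _ _) abN.
exact: leq_trans (leq_addl _ _) abN.
Qed.
End CurveOrder.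

(** * Infinite type and formal curves of infinite contact *)

Section TypeCriterion.
Variables (R : realType) (n : nat) (r : 'rV[R[i]]_n -> R) (p : 'rV[R[i]]_n).
Hypothesis sm : smooth_near r p.
Notation C := R[i].

Lemma high_contact_curve K : dangelo_type r p = +oo%E ->
  exists (z : formal_curve R n) m, [/\ (0 < m)%N, exists j, z j m != 0,
    forall j i, (0 < i < m)%N -> z j i = 0 &
    forall a b, (a + b < K * m)%N -> formal_comp r p z a b = 0].
Proof.
move=> Doo.
have : ((K%:R : R)%:E < dangelo_type r p)%E by rewrite Doo ltry.
move=> /ereal_sup_gt[_ [zeta [zh z0 _] <-]] Kz.
(* An infinite [nu_curve zeta] would give the ratio 0, since [fine +oo = 0]. *)
have [x nuE] : exists x : R, nu_curve zeta = x%:E.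
  case E : (nu_curve zeta) => [x| |]; first by exists x.
    by move: Kz; rewrite E /= invr0 mule0 lte_fin ltrn0.
  by move: Kz; rewrite E /= invr0 mule0 lte_fin ltrn0.
have [k kz] : exists k, ~ vanishes_to (curve_size zeta) k.
  apply: contrapT => /forallNP H.
  have : (((Num.bound `|x|)%:R : R)%:E <= nu_curve zeta)%E.
    by apply: ereal_sup_ubound; exists (Num.bound `|x|) => //=; apply: contrapT (H _).
  rewrite nuE lee_fin leNgt => /negP; apply.
  by apply: le_lt_trans (ler_norm _) _; exact: archi_boundP.
(* The order [m] of the curve is the predecessor of the first order to which it fails to vanish; it
   is positive because the curve is holomorphic at 0. *)
pose P k := ~~ `[< vanishes_to (curve_size zeta) k >].
have exP : exists k, P k by exists k; apply/asboolPn.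
have V1 : vanishes_to (curve_size zeta) 1.
  have [q [zq q0]] := holo_near0_taylor 0 zh.
  by apply/(taylor_curve_size zq q0 (leqnn _)) => j i; case: i => [|[]].
have [M /asboolPn PM Mmin] := ex_minnP exP.
have M1 : (1 < M)%N by rewrite ltnNge; apply/negP => M1; apply: PM; apply: vanishes_to_le V1.
case: M M1 PM Mmin => // m m0 PM Mmin; rewrite ltnS in m0.
have vP l : vanishes_to (curve_size zeta) l <-> (l <= m)%N.
  split=> [vl|lm]; first by rewrite leqNgt; apply/negP => ml; apply: PM; apply: vanishes_to_le vl.
  apply: contrapT => /asboolPn /Mmin; by rewrite ltnNge lm.
have num : nu_curve zeta = (m%:R)%:E by apply: ord_vanishE vP.
have vK : vanishes_to (fun t => r (zeta t)) (K * m).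
  move: Kz; rewrite num /= lte_pdivlMr ?ltr0n // -EFinM -natrM.
  move=> /ereal_sup_gt[_ [l /= vl <-]]; rewrite lte_fin ltr_nat => Kl.
  exact: vanishes_to_le (ltnW Kl) vl.
(* This Taylor order covers both the contact range K m and the leading coefficient of index [m],
   also when K = 0. *)
have [q [zq q0]] := holo_near0_taylor (K * m + m) zh.
have KN : (K * m <= (K * m + m).+1)%N by rewrite -addnS leq_addr.
have mN : (m.+1 <= (K * m + m).+1)%N by rewrite ltnS leq_addl.
exists (poly_curve q), m; split=> //.
- have /(taylor_curve_size zq q0 mN) H : ~ vanishes_to (curve_size zeta) m.+1 by [].
  apply: contrapT => /forallNP nz; apply: H => j i /andP[i0]; rewrite ltnS leq_eqVlt.
  case/orP => [/eqP ->|im]; first by apply/eqP; rewrite -[_ == _]negbK; apply/negP; apply: nz.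
  by apply: ((taylor_curve_size zq q0 (ltnW mN)).1 ((vP m).2 (leqnn m))); rewrite i0.
- exact: ((taylor_curve_size zq q0 (ltnW mN)).1 ((vP m).2 (leqnn m))).
- by apply: (pullback_vanishes zq _ sm KN vK) => j; rewrite q0 z0.
Qed.

Lemma infinite_type_formal_curve : dangelo_type r p = +oo%E ->
  exists zeta : formal_curve R n, [/\ forall j, zeta j 0%N = p 0 j,
    formal_nonconstant zeta & formal_vanishes_inf (formal_comp r p zeta)].
Proof.
move=> Doo.
have /choice[Zm ZmP] : forall K, exists Zm : formal_curve R n * nat,
    [/\ (0 < Zm.2)%N, exists j, Zm.1 j Zm.2 != 0,
      forall j i, (0 < i < Zm.2)%N -> Zm.1 j i = 0 &
      forall a b, (a + b < K * Zm.2)%N -> formal_comp r p Zm.1 a b = 0].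
  by move=> K; have [z [m H]] := high_contact_curve K Doo; exists (z, m).
(* The ultrafilter refines the eventual filter, so it contains every tail. *)
have [U [Uultra ooU]] := ultraFilterLemma eventually_filter.
apply: (@limit_curve R n r p (fun K => (Zm K).1) (fun K => (Zm K).2) _ _ _ _ U) => [K|K|K|K|K0].
- by have [] := ZmP K.
- by have [] := ZmP K.
- by have [] := ZmP K.
- by have [] := ZmP K.
- by apply: ooU; exists K0.
Qed.

Lemma formal_curve_infinite_type (zeta : formal_curve R n) :
  (forall j, zeta j 0%N = p 0 j) -> formal_nonconstant zeta ->
  formal_vanishes_inf (formal_comp r p zeta) -> dangelo_type r p = +oo%E.
Proof.
move=> z0 znc zinf; pose P m := (0 < m)%N && [exists j, zeta j m != 0].
have exP : exists m, P m.
  by have [j [m m0 zm]] := znc; exists m; rewrite /P m0; apply/existsP; exists j.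
have [m /andP[m0 /existsP[j0 zm]] mmin] := ex_minnP exP.
have zlow j i : (0 < i < m)%N -> zeta j i = 0.
  move=> /andP[i0 im]; apply/eqP; rewrite -[_ == _]negbK; apply/negP => zi.
  have := mmin i; rewrite /P i0 leqNgt im; case: existsP => [_ /(_ isT)|[]] //.
  by exists j.
suff big N : (m <= N)%N -> (((N.+1)%:R / m%:R : R)%:E <= dangelo_type r p)%E.
  (* [N] is at least [m], so truncation preserves the order of the curve, and (N + 1) / m exceeds
     [A]. *)
  apply/eqyP => A A0; pose N := (m + Num.bound (A * m%:R))%N.
  apply: le_trans (big N (leq_addr _ _)); rewrite lee_fin ler_pdivlMr ?ltr0n //.
  apply/ltW; apply: (lt_le_trans (archi_boundP _)); first by rewrite mulr_ge0 // ltW.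
  by rewrite ler_nat; apply: leqW; apply: leq_addl.
move=> mN; pose q j := \poly_(i < N.+1) zeta j i.
pose c (t : C) : 'rV[C]_n := \row_j (q j).[t].
have cE t j : c t 0 j = (q j).[t] by rewrite mxE.
have qi j i : (i <= N)%N -> (q j)`_i = zeta j i by move=> iN; rewrite coef_poly ltnS iN.
have c0 : c 0 = p by apply/rowP => j; rewrite cE horner_coef0 qi // z0.
have cq j : bigO N.+1 (fun t => c t 0 j - (q j).[t]).
  by apply: (@bigO_eq _ _ (fun=> 0)) (bigO0 _ _) => t; rewrite cE subrr.
have q0 j : (q j)`_0 = c 0 0 j by rewrite cE horner_coef0.
have vP k : vanishes_to (curve_size c) k <-> (k <= m)%N.
  split=> [vk|km]; last first.
    apply: (vanishes_to_le km); apply/(taylor_curve_size cq q0 (leqW mN)) => j i im.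
    rewrite qi ?zlow //; case/andP: im => _ im; exact: leq_trans (ltnW im) mN.
  rewrite leqNgt; apply/negP => mk.
  have /(taylor_curve_size cq q0 (_ : m.+1 <= N.+1)%N) H := vanishes_to_le mk vk.
  by move: zm; rewrite -qi // H ?eqxx ?m0 /=.
have num : nu_curve c = (m%:R)%:E by apply: ord_vanishE vP.
have ch : holo_curve_germ p c.
  split=> //.
    exists 1 => // t _ j; apply/holP; have -> : (fun s => c s 0 j) = fun s => (q j).[s].
      by apply/funext => s; rewrite cE.
    exact: hol_horner.
  move=> [d d0 cc]; suff : vanishes_to (curve_size c) m.+1 by move/vP; rewrite ltnn.
  exists 0, d => // t td; rewrite mul0r /curve_size cc // big1 ?normr0 // => j _.
  by rewrite subrr cabs0.
have vr : vanishes_to (fun t => r (c t)) N.+1.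
  have q0p j : (q j)`_0 = p 0 j by rewrite q0 c0.
  apply: (vanishes_pullback cq q0p sm) => a b abN.
  (* Coefficients with a + b <= N depend only on the terms of the curve up to order [N], where it
     agrees with its truncation. *)
  rewrite -[RHS](zinf a b); apply: (@formal_comp_eq _ _ r p _ _ N) => //.
apply: (@le_trans _ _ (nu_pullback r c * ((fine (nu_curve c))^-1)%:E)%E).
  rewrite num /= EFinM; apply: lee_wpmul2r; first by rewrite lee_fin invr_ge0.
  by apply: ereal_sup_ubound; exists N.+1.
by apply: ereal_sup_ubound; exists c.
Qed.
End TypeCriterion.

Theorem theorem2 (R : realType) (n : nat) (r : 'rV[R[i]]_n -> R)
    (p : 'rV[R[i]]_n) :
  smooth_near r p ->
  r p = 0 ->
  (exists k : 'I_n * bool, rpartial k r p != 0) ->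
  (dangelo_type r p = +oo%E <->
   exists zeta : formal_curve R n,
     [/\ forall j : 'I_n, zeta j 0%N = p 0 j,
         formal_nonconstant zeta &
         formal_vanishes_inf (formal_comp r p zeta)]).
Proof.
move=> sm _ _; split; first exact: infinite_type_formal_curve.
by move=> [zeta [z0 znc zinf]]; apply: formal_curve_infinite_type zinf.
Qed.
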